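(* Let $1<p<\infty$, $f\in L^p$, $\mathbf{A}=\{a_n\}_{n\ge1}\in NBVS$, and let $f$ be a sum-function of either of the series $$\sum_{n=1}^\infty a_n\cos nx\qquad\text{or}\qquad\sum_{n=1}^\infty a_n\sin nx .$$ If $f\in\Lambda_p^*$, then there is a constant $K$, independent of $h$, such that $$\omega_p(f,h)\le K\,h\,|\log h|^{1/p}\qquad\text{for all } 0<h\le \tfrac12 .$$
   Context: A sequence $\mathbf{A}=\{a_n\}_{n\ge1}$ of nonnegative real numbers belongs to $NBVS$ if there is a constant $K(\mathbf{A})$, depending only on $\mathbf{A}$, such that $\sum_{m=n}^{2n}|\Delta a_m|\le K(\mathbf{A})(a_n+a_{2n})$ for all $n=1,2,\dots$, where $\Delta a_m=a_m-a_{m+1}$. $L^p$ is the space of $2\pi$-periodic functions that are $p$-power integrable over a period, with usual norm $\|\cdot\|_p$. For $f\in L^p$ and $h>0$, $$\omega_p(f,h):=\sup_{|t|\le h}\|f(x+t)-f(x)\|_p,\qquad \omega_p^*(f,h):=\sup_{0<t\le h}\|f(x+t)+f(x-t)-2f(x)\|_p .$$ The Zygmund class is $\Lambda_p^*:=\{f\in L^p:\ \omega_p^*(f,h)=O(h)\}$ (as $h\to0^+$). A sum-function of a trigonometric series is the function $f$ that is the sum of the series. The constant $K$ may depend on $p$ and $\mathbf{A}$. *)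

(* Defs.v *)
(* MathComp-Analysis *)
From HB Require Import structures.
From mathcomp Require Import all_boot all_order all_algebra.
From mathcomp Require Import all_classical all_reals all_analysis.

Set Implicit Arguments.
Unset Strict Implicit.
Unset Printing Implicit Defensive.

Import Order.TTheory GRing.Theory Num.Theory.
Import numFieldNormedType.Exports.

Local Open Scope classical_set_scope.
Local Open Scope ring_scope.

(* Sequences indexed by n >= 1 are functions on nat whose value at 0 is never
   used. *)
Definition NBVS (R : realType) (a : nat -> R) : Prop :=
  (forall n, (1 <= n)%N -> 0 <= a n) /\
  exists K : R, forall n, (1 <= n)%N ->
    \sum_(n <= m < (2 * n).+1) `|a m - a m.+1| <= K * (a n + a (2 * n)%N).

Definition period (R : realType) : set R := `[0, pi *+ 2].

Lemma measurable_period (R : realType) : measurable (@period R).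
Proof. exact: measurable_itv. Qed.

Definition period_measure (R : realType) : {measure set (measurableTypeR R) -> \bar R} :=
  mrestr (@lebesgue_measure R) (@measurable_period R).

Definition Lp_norm (R : realType) (p : R) (f : R -> R) : \bar R :=
  'N[@period_measure R]_(p%:E)[EFin \o f]%E.

Definition in_Lp (R : realType) (p : R) (f : R -> R) : Prop :=
  periodic f (pi *+ 2) /\ f \in Lfun (@period_measure R) p%:E.

Definition omega (R : realType) (p : R) (f : R -> R) (h : R) : \bar R :=
  ereal_sup [set Lp_norm p (fun x => f (x + t) - f x) |
             t in [set t | `|t| <= h]].

Definition omega_star (R : realType) (p : R) (f : R -> R) (h : R) : \bar R :=
  ereal_sup [set Lp_norm p (fun x => f (x + t) + f (x - t) - 2 * f x) |
             t in [set t | 0 < t <= h]].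

Definition Zygmund_class (R : realType) (p : R) (f : R -> R) : Prop :=
  in_Lp p f /\
  exists C : R, \forall h \near 0^'+, (omega_star p f h <= (C * h)%:E)%E.

(* Pointwise sum of \sum_(n >= 1) u_n.  The points of 2 pi Z are exempted: the
   cosine series reduces there to \sum_n a_n, which need not converge, and a
   single point per period does not affect f as an element of L^p. *)
Definition is_sum_function (R : realType) (u : nat -> R -> R) (f : R -> R)
    : Prop :=
  forall x : R, (forall k : int, x != k%:~R * (pi *+ 2)) ->
    \sum_(1 <= n < N) u n x @[N --> \oo] --> f x.

(* Main.v *)
Require Import Defs.
From HB Require Import structures.
From mathcomp Require Import all_boot all_order all_algebra.
From mathcomp Require Import all_classical all_reals all_analysis.
From mathcomp Require Import measurable_realfun.
From mathcomp Require Import ring lra zify.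

Set Implicit Arguments.
Unset Strict Implicit.
Unset Printing Implicit Defensive.

Import Order.TTheory GRing.Theory Num.Theory.
Import numFieldNormedType.Exports.

Local Open Scope classical_set_scope.
Local Open Scope ring_scope.

(** Both series are written as the sum of the a_n cos (n x - th), with th = 0
    or th = pi / 2.

    The first half of the proof is the decay a_n = O(n^(1/p - 2)), [coeff_bound].
    Let t = 1/n, let g be the second difference f(x + t) + f(x - t) - 2 f(x),
    and let D be the sum of the cos (k x - th) for n <= k < 2n.  The k-th
    Fourier coefficient of g is that of f times - 4 sin^2 (k t / 2), and this
    factor is bounded away from 0 on the block; hence the integral of g D has
    absolute value at least a constant times the sum of the a_k over the block.
    By Hoelder's inequality ([dirichlet_pairing]) it is at most a constant times
    ||g||_p n^(1/p) = O(n^(1/p - 1)), by the Zygmund condition.  The NBVS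
    inequality then passes from sums over blocks to single coefficients
    ([NBVS_block_coeff]).

    This uses that a_k is the k-th Fourier coefficient of f, although f is only
    given as the pointwise sum of the series: this is the uniqueness theorem of
    du Bois-Reymond and de la Vallee-Poussin, proved here for bounded
    coefficients ([fourier_coeff]).  The function F, sum of the
    - a_n cos (n x - th) / n^2, is continuous, and by Riemann's summation
    theorem its symmetric second derivative is f on (0, 2 pi) ([Fser_sd]).
    Therefore F is an affine function minus the Green potential of f
    ([green_repr]), which gives the integral of f against a cosine in terms of
    that of F.  The representation is obtained from a maximum principle, after f
    has been replaced by a majorant that exceeds each of its values in a
    neighbourhood of the point, with almost the same integral
    ([vitali_caratheodory]).

    In the second half the series is cut at an index N close to 1/h.  The head
    is differentiated and the tail is left as it is.  Both are estimated by
    absolute values and by summation by parts, the division between the two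
    depending on the size of |sin (x/2)|, and the result is
      |f(x + t) - f(x)| <= B h (|sin (x/2)| + h)^(-1/p)   for |t| <= h,
    outside a countable set ([increment_bound]).  The p-th power of the right
    hand side is (B h)^p / (|sin (x/2)| + h), whose integral over a period is
    O(h^p |log h|). *)

(** * Integration over a period *)

Lemma lebesgue_period_lty (R : realType) :
  (@lebesgue_measure R (@period R) < +oo)%E.
Proof.
by rewrite /period /= lebesgue_measure_itv /=; case: ifP => // _; rewrite -EFinB ltry.
Qed.

(** Lebesgue measure restricted to the period, seen as a measure on the whole
    line. It is convertible to [period_measure R], with the finiteness of its
    total mass recorded in its type; integrals over the period are integrals
    over the whole line for this measure. *)
Definition pm (R : realType) : {finite_measure set (measurableTypeR R) -> \bar R} :=
  @mfrestr _ (measurableTypeR R) R _ (@lebesgue_measure R)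
    (@measurable_period R) (lebesgue_period_lty R).

Lemma twopi_gt0 (R : realType) : 0 < pi *+ 2 :> R.
Proof. by rewrite pmulrn_lgt0 // pi_gt0. Qed.

Lemma period_measureT (R : realType) : pm R [set: R] = (pi *+ 2)%:E.
Proof.
rewrite /pm /= /mfrestr /mrestr setTI /period lebesgue_measure_itv /=.
by rewrite lte_fin twopi_gt0 oppr0 adde0.
Qed.

Lemma period_measureC0 (R : realType) : pm R (~` @period R) = 0%E.
Proof. by rewrite /pm /= /mfrestr /mrestr setICl measure0. Qed.

Lemma ge0_integral_periodE (R : realType) (f : R -> \bar R) :
  measurable_fun [set: R] f -> (forall x : R, (0 <= f x)%E) ->
  (\int[pm R]_x f x = \int[lebesgue_measure]_(x in @period R) f x)%E.
Proof.
move=> mf f0.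
rewrite [LHS](@ge0_negligible_integral _ (measurableTypeR R) R (pm R) setT
  (~` @period R))//=.
- rewrite setTD setCK; apply: eq_measure_integral => A mA AD.
  by rewrite /mfrestr /mrestr; congr (lebesgue_measure _); exact/setIidPl.
- exact: measurableC (@measurable_period R).
- exact: period_measureC0.
Qed.

Lemma integrable_periodE (R : realType) (f : R -> R) :
  measurable_fun [set: R] f ->
  (@lebesgue_measure R).-integrable (@period R) (EFin \o f) ->
  (pm R).-integrable [set: R] (EFin \o f).
Proof.
move=> mf /integrableP[_ fi]; apply/integrableP; split.
  exact/measurable_EFinP.
rewrite ge0_integral_periodE //.
by apply: measurableT_comp => //; exact/measurable_EFinP.
Qed.

Lemma Rintegral_periodE (R : realType) (f : R -> R) :
  measurable_fun [set: R] f ->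
  \int[pm R]_x f x = \int[lebesgue_measure]_(x in @period R) f x.
Proof.
move=> mf; rewrite /Rintegral; congr fine.
have mF : measurable_fun [set: R] (EFin \o f) by exact/measurable_EFinP.
rewrite integralE [in RHS]integralE; congr (_ - _)%E;
  apply: ge0_integral_periodE => //.
- exact: measurable_funepos.
- exact: measurable_funeneg.
Qed.

Lemma integrable_period_cont (R : realType) (f : R -> R) : continuous f ->
  (pm R).-integrable [set: R] (EFin \o f).
Proof.
move=> cf; apply: integrable_periodE; first exact: continuous_measurable_fun.
apply: continuous_compact_integrable; first exact: segment_compact.
exact: continuous_subspaceT.
Qed.

Lemma FTC_period (R : realType) (F f : R -> R) :
  continuous f -> (forall x : R, is_derive x 1 F (f x)) ->
  \int[pm R]_x f x = F (pi *+ 2) - F 0.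
Proof.
move=> cf dF.
have cF : continuous F.
  by move=> x; apply/differentiable_continuous/derivable1_diffP; case: (dF x).
rewrite Rintegral_periodE; last exact: continuous_measurable_fun.
rewrite /Rintegral (@continuous_FTC2 _ _ F) //.
- exact: twopi_gt0.
- exact: continuous_subspaceT.
- split.
  + by move=> x _; case: (dF x).
  + exact: cvg_at_right_filter (cF _).
  + exact: cvg_at_left_filter (cF _).
- by move=> x _; rewrite derive1E; case: (dF x).
Qed.

(** * A maximum principle and the Green function of the second derivative *)

(** A remainder that is quadratic in the increment is a convenient way to
    establish a derivative for piecewise quadratic functions. *)
Lemma is_derive_quadratic (R : realType) (f : R -> R) (x d C : R) :
  (forall h, h != 0 -> `|f (x + h) - f x - d * h| <= C * h ^+ 2) ->
  is_derive x 1 f d.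
Proof.
move=> H.
have cv : h^-1 *: ((f \o shift x) (h *: 1) - f x) @[h --> (0:R)^'] --> d.
  apply/cvgrPdist_le => e e0.
  have C0 : 0 < `|C| + 1 by rewrite ltr_wpDl.
  near=> h.
  have h0 : h != 0 by near: h; exact: nbhs_dnbhs_neq.
  have he : `|h| <= e / (`|C| + 1).
    near: h; apply: dnbhs0_le; exact: divr_gt0.
  rewrite /= scaler1 [h + x]addrC -mulr_algl scaler1 /=.
  have -> : d - h^-1 * (f (x + h) - f x) = - (h^-1 * (f (x + h) - f x - d * h)).
    by field.
  rewrite normrN normrM normfV -ler_pdivlMl ?invr_gt0 ?normr_gt0// invrK.
  apply: le_trans (H h h0) _; rewrite -[h ^+ 2]real_normK ?num_real// expr2 mulrCA.
  apply: ler_wpM2l => //; move: he; rewrite ler_pdivlMr// => he.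
  apply: le_trans he; rewrite mulrC; apply: ler_wpM2l => //.
  by apply: le_trans (ler_norm _) _; rewrite lerDl.
split; last exact: cvg_lim cv.
by apply/cvg_ex; exists d.
Unshelve. all: by end_near. Qed.

(** Maximum principle: a continuous function whose symmetric second difference
    is positive for arbitrarily small steps, at every interior point, lies
    below its chord. At an interior maximum of the difference with the chord
    every second difference would be nonpositive. *)
Lemma max0_le_chord (R : realType) (a b : R) (G : R -> R) :
  a < b -> {within `[a, b], continuous G} ->
  (forall x, a < x < b -> forall r, 0 < r ->
     exists2 h, 0 < h < r & 0 < G (x + h) + G (x - h) - 2 * G x) ->
  forall x, a <= x <= b -> G x <= (G a * (b - x) + G b * (x - a)) / (b - a).
Proof.
move=> ab cG sd x xab.
pose l (z : R) := (G a * (b - z) + G b * (z - a)) / (b - a).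
have ba0 : b - a != 0 by rewrite gt_eqF// subr_gt0.
have cl : continuous l.
  move=> z; apply: cvgM; last exact: cvg_cst.
  by apply: cvgD; (apply: cvgM; [exact: cvg_cst|]); apply: cvgB => //; exact: cvg_cst.
have cH : {within `[a, b], continuous (G \- l)}.
  by move=> z; apply: cvgB; [exact: cG|exact: continuous_subspaceT cl z].
have [c cab cmax] := EVT_max (ltW ab) cH.
rewrite -/(l x) -subr_le0.
have := cmax x; rewrite in_itv /= => /(_ xab) /le_trans; apply.
move: cab; rewrite in_itv /= => /andP[].
rewrite le_eqVlt => /predU1P[<- _|ac].
  by rewrite /l subrr mulr0 addr0 mulfK// subrr.
rewrite le_eqVlt => /predU1P[->|cb].
  by rewrite /l subrr mulr0 add0r mulfK// subrr.
rewrite leNgt; apply/negP => Hc.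
have [] := sd c _ (Num.min (c - a) (b - c)); first by rewrite ac cb.
  by rewrite lt_min !subr_gt0 ac cb.
move=> h /andP[h0]; rewrite lt_min => /andP[h1 h2].
apply/negP; rewrite -leNgt.
have /cmax : c + h \in `[a, b] by rewrite in_itv /=; apply/andP; split; lra.
have /cmax : c - h \in `[a, b] by rewrite in_itv /=; apply/andP; split; lra.
have : l (c + h) + l (c - h) = 2 * l c by rewrite /l; field.
rewrite /=; lra.
Qed.

(** The triangular kernel of half-width [h], of integral [h ^+ 2]. *)
Definition hat (R : realType) (h s : R) : R := Num.max 0 (h - `|s|).

(** The Green function min(x, y) (L - max(x, y)) / L of - d^2/dx^2 on [0, L]
    with zero boundary values; this form needs a single case distinction. *)
Definition green (R : realType) (L x y : R) : R :=
  x * (L - y) / L - Num.max 0 (x - y).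

Lemma greenC (R : realType) (L x y : R) : L != 0 -> green L x y = green L y x.
Proof.
move=> L0; rewrite /green /Num.max; do 2 case: ifPn; rewrite -?leNgt => *.
- lra.
- by field.
- by field.
- have -> : x = y by lra. by field.
Qed.

Lemma green_ge0 (R : realType) (L x y : R) : 0 < L ->
  0 <= x <= L -> 0 <= y <= L -> 0 <= green L x y.
Proof.
move=> L0 /andP[x0 xL] /andP[y0 yL]; rewrite /green subr_ge0 ge_max.
apply/andP; split; first by rewrite divr_ge0 ?(ltW L0)// mulr_ge0 ?subr_ge0.
by rewrite ler_pdivlMr//; nra.
Qed.

Lemma green_le (R : realType) (L x y : R) : 0 < L ->
  0 <= x <= L -> 0 <= y <= L -> green L x y <= L.
Proof.
move=> L0 /andP[x0 xL] /andP[y0 yL]; rewrite /green.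
apply: (@le_trans _ _ (x * (L - y) / L)).
  by rewrite gerBl le_max lexx.
by rewrite ler_pdivrMr//; nra.
Qed.

Lemma green0 (R : realType) (L y : R) : 0 <= y -> green L 0 y = 0.
Proof.
by move=> y0; rewrite /green !mul0r max_l ?subr0// subr_le0.
Qed.

Lemma greenL (R : realType) (L y : R) : L != 0 -> y <= L -> green L L y = 0.
Proof.
move=> L0 yL; rewrite /green max_r ?subr_ge0//.
by rewrite [L * _]mulrC mulfK// subrr.
Qed.

(** The second difference of the Green function in its first variable is minus
    the triangular kernel: there is no error term. *)
Lemma green_sd (R : realType) (L x h y : R) : 0 < h ->
  green L (x + h) y + green L (x - h) y + hat h (y - x) = 2 * green L x y.
Proof.
move=> h0; rewrite /green /hat.
have -> : (x + h) * (L - y) / L = x * (L - y) / L + h * (L - y) / L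
  by rewrite -!mulrA -mulrDl.
have -> : (x - h) * (L - y) / L = x * (L - y) / L - h * (L - y) / L
  by rewrite -!mulrA -mulrBl.
move: (x * (L - y) / L) (h * (L - y) / L) => u v.
have [xy|xy] := ger0P (y - x); rewrite /Num.max; repeat case: ifPn;
  rewrite -?leNgt => *; lra.
Qed.

Lemma green_lip (R : realType) (L x x' y : R) : 0 < L -> 0 <= y <= L ->
  green L x' y <= green L x y + 2 * `|x - x'|.
Proof.
move=> L0 /andP[y0 yL]; rewrite /green.
have c1 : 0 <= (L - y) / L <= 1.
  by rewrite divr_ge0 ?subr_ge0 ?(ltW L0)// ler_pdivrMr// mul1r gerBl.
rewrite -!mulrA; set c := _ / _ in c1 *.
have [h|h] := ger0P (x - x'); rewrite /Num.max; do 2 case: ifPn;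
  rewrite -?leNgt => *; nra.
Qed.

Lemma is_derive_max0 (R : realType) (c x : R) :
  is_derive x 1 (fun s => Num.max 0 (s - c) ^+ 2 / 2) (Num.max 0 (x - c)).
Proof.
apply: (@is_derive_quadratic _ _ _ _ 1) => h h0.
rewrite ler_norml; apply/andP; split; rewrite /Num.max; do 2 case: ifPn;
  rewrite -?leNgt => *; nra.
Qed.

Lemma continuous_hat (R : realType) (h c : R) : continuous (fun y => hat h (y - c)).
Proof.
move=> x; apply/cvgrPdist_le => e e0; near=> y.
have : `|x - y| <= e by near: y; exact: cvgr_dist_le.
rewrite /hat; rewrite !ler_norml => /andP[h1 h2].
have [a|a] := ger0P (x - c); have [b|b] := ger0P (y - c);
 apply/andP; split;
  rewrite /Num.max; do 2 case: ifPn; rewrite -?leNgt => *; lra.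
Unshelve. all: by end_near. Qed.

Lemma continuous_green (R : realType) (L x : R) : continuous (green L x).
Proof.
move=> y; apply: cvgB.
  apply: cvgM; last exact: cvg_cst.
  by apply: cvgM; [exact: cvg_cst|apply: cvgB => //; exact: cvg_cst].
apply/cvgrPdist_le => e e0; near=> z.
have : `|y - z| <= e by near: z; exact: cvgr_dist_le.
rewrite !ler_norml => /andP[h1 h2]; apply/andP; split;
  rewrite /Num.max; do 2 case: ifPn; rewrite -?leNgt => *; lra.
Unshelve. all: by end_near. Qed.

Lemma integral_hat (R : realType) (L x h : R) : 0 < h -> h <= x -> x + h <= L ->
  (\int[lebesgue_measure]_(y in `[0%R, L]) (hat h (y - x))%:E = (h ^+ 2)%:E)%E.
Proof.
move=> h0 hx xL.
pose F s : R := Num.max 0 (s - (x - h)) ^+ 2 / 2 - 2 * (Num.max 0 (s - x) ^+ 2 / 2) +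
  Num.max 0 (s - (x + h)) ^+ 2 / 2.
have dF (y : R) : is_derive y 1 F (hat h (y - x)).
  have -> : hat h (y - x) = Num.max 0 (y - (x - h)) - 2 * Num.max 0 (y - x) +
      Num.max 0 (y - (x + h)).
    rewrite /hat; have [a|a] := ger0P (y - x);
      rewrite /Num.max; repeat case: ifPn; rewrite -?leNgt => *; lra.
  have d1 := is_derive_max0 (x - h) y.
  have d2 := is_derive_max0 x y.
  have d3 := is_derive_max0 (x + h) y.
  exact: is_deriveD.
have cF : continuous F.
  by move=> y; apply/differentiable_continuous/derivable1_diffP; case: (dF y).
rewrite (@continuous_FTC2 _ _ F) //.
- rewrite -EFinB; congr EFin; rewrite /F.
  have m0 (a : R) : 0 <= a -> Num.max 0 a = a by move=> /max_r.
  have m1 (a : R) : a <= 0 -> Num.max 0 a = 0 by move=> /max_l.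
  rewrite (m0 (L - (x - h))); last lra.
  rewrite (m0 (L - x)); last lra.
  rewrite (m0 (L - (x + h))); last lra.
  rewrite (m1 (0 - (x - h))); last lra.
  rewrite (m1 (0 - x)); last lra.
  rewrite (m1 (0 - (x + h))); last lra.
  by field.
- lra.
- exact/continuous_subspaceT/continuous_hat.
- split.
  + by move=> y _; case: (dF y).
  + exact: cvg_at_right_filter (cF _).
  + exact: cvg_at_left_filter (cF _).
- by move=> y _; rewrite derive1E; case: (dF y).
Qed.

(** * Majorants in the style of Vitali and Caratheodory *)

Lemma lebesgue_segment (R : realType) (L : R) : 0 <= L ->
  @lebesgue_measure R `[0%R, L]%classic = L%:E.
Proof.
rewrite le_eqVlt => /predU1P[<-|L0]; first by rewrite set_itv1 lebesgue_measure_set1.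
by rewrite lebesgue_measure_itv /= lte_fin L0 oppr0 adde0.
Qed.

(** A nonnegative measurable function has a majorant [w] with almost the same
    integral that stays, near each point [x] of the segment, above the value
    [phi x]. The function [w] may take the value +oo. *)
Lemma vitali_caratheodory (R : realType) (L eps : R) (phi : R -> R) :
  0 < L -> 0 < eps -> measurable_fun [set: R] phi -> (forall x, 0 <= phi x) ->
  exists w : R -> \bar R, [/\ measurable_fun [set: R] w,
    (forall x, (0 <= w x)%E),
    (forall x, 0 <= x <= L -> exists2 r, 0 < r &
       forall y, `|y - x| < r -> ((phi x)%:E <= w y)%E) &
    (\int[lebesgue_measure]_(x in `[0%R, L]) w x <=
     \int[lebesgue_measure]_(x in `[0%R, L]) (phi x)%:E + eps%:E)%E].
Proof.
move=> L0 eps0 mphi phi0.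
pose D : set R := `[0%R, L]%classic; pose mu := @lebesgue_measure R.
have mD : measurable D by exact: measurable_itv.
(* E k is the set where k dl <= phi < (k+1) dl, and w is the sum of the (k+1)
   dl 1_(U k) for open sets U k containing E k. Rounding phi up costs dl L =
   eps / 2; the excess of U k over E k is less than ek, chosen so that the
   (k+1) dl ek add up to eps / 2. *)
pose dl : R := eps / 2 / L; have dl0 : 0 < dl by rewrite !divr_gt0.
pose c (k : nat) : R := k.+1%:R * dl.
have c0 k : 0 < c k by rewrite mulr_gt0.
pose E (k : nat) : set R := D `&` phi @^-1` `[k%:R * dl, c k[%classic.
have mE k : measurable (E k).
  apply: measurableI; first by [].
  rewrite -[X in measurable X]setTI; apply: mphi; first exact: measurableT.
  exact: measurable_itv.
have muE k : (mu (E k) < +oo)%E.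
  apply: (@le_lt_trans _ _ (mu D)); first by apply: le_measure; [rewrite inE;
    exact: mE|rewrite inE; exact: mD|move=> x []].
  by rewrite /mu /D lebesgue_segment ?ltry// ltW.
pose ek (k : nat) : R := eps / 2 / (2 ^ k.+1)%:R / c k.
have ek0 k : 0 < ek k by rewrite !divr_gt0// ltr0n expn_gt0.
have /choice[U HU] k : exists V : set R,
    [/\ open V, E k `<=` V & (mu (V `\` E k) < (ek k)%:E)%E].
  exact: lebesgue_regularity_outer.
have oU k : open (U k) by case: (HU k).
have mU k : measurable (U k) by exact: open_measurable.
have EU k : E k `<=` U k by case: (HU k).
have triv : trivIset setT E.
  apply/trivIsetP => i j _ _ ij; rewrite -subset0 => x [[_ /= xi] [_ /= xj]].
  have ti : Num.truncn (phi x / dl) = i.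
    apply: truncn_def; move: xi; rewrite in_itv /= => /andP[? ?].
    by rewrite ler_pdivlMr// ltr_pdivrMr// -/(c i); apply/andP.
  have tj : Num.truncn (phi x / dl) = j.
    apply: truncn_def; move: xj; rewrite in_itv /= => /andP[? ?].
    by rewrite ler_pdivlMr// ltr_pdivrMr// -/(c j); apply/andP.
  by move/eqP: ij; apply; rewrite -ti -tj.
have DE x : D x -> E (Num.truncn (phi x / dl)) x.
  move=> Dx; split => //=; rewrite in_itv /= /c.
  by rewrite -ler_pdivlMr// -ltr_pdivrMr//; apply: truncn_itv;
    rewrite divr_ge0 ?phi0 ?(ltW dl0).
have bigE : \bigcup_k E k = D.
  rewrite eqEsubset; split; first by move=> x [k _ []].
  by move=> x Dx; exists (Num.truncn (phi x / dl)) => //; exact: DE.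
pose f (k : nat) (x : R) : \bar R := (c k * \1_(U k) x)%:E.
have mf k : measurable_fun [set: R] (f k).
  by apply/measurable_EFinP; apply: measurable_funM => //; exact: measurable_indic.
have f0 k x : (0 <= f k x)%E by rewrite lee_fin mulr_ge0 ?(ltW (c0 k)).
exists (fun x => \sum_(0 <= k <oo) f k x)%E; split.
- by apply: ge0_emeasurable_sum => // k x _ _; exact: f0.
- by move=> x; apply: nneseries_ge0 => k _ _; exact: f0.
- move=> x Dx; set k := Num.truncn (phi x / dl).
  have /DE-Ex : D x by rewrite /D /= in_itv.
  have /EU Ux := Ex.
  have := oU k; rewrite openE => /(_ x Ux); rewrite /interior => /nbhs_ballP[r /= r0 rU].
  exists r => // y yr.
  have Uy : U k y by apply: rU; rewrite /ball /= distrC.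
  apply: (@le_trans _ _ (f k y)).
    rewrite /f indicE mem_set// mulr1 lee_fin.
    by case: Ex => _ /=; rewrite in_itv /= => /andP[_ /ltW].
  apply: le_trans; last exact: (@nneseries_lim_ge _ _ xpredT 0%N k.+1).
  rewrite big_nat_recr//= leeDr//; apply: sume_ge0 => i _; exact: f0.
- rewrite integral_nneseries//; last by move=> k; apply: measurable_funTS; exact: mf.
  have mphiE : measurable_fun D (fun x => (phi x + dl)%:E).
    by apply/measurable_EFinP/measurable_funTS/measurable_funD.
  pose A k := (\int[mu]_(x in E k) (phi x + dl)%:E)%E.
  apply: (@le_trans _ _ (\sum_(0 <= k <oo) (A k + (eps / 2 / (2 ^ k.+1)%:R)%:E))%E).
    apply: lee_nneseries => [k _ _|k _]; first by apply: integral_ge0 => x _; exact: f0.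
    have -> : (\int[lebesgue_measure]_(x in `[0%R, L]) f k x = (c k)%:E * mu (U k `&` D))%E.
      under eq_integral do rewrite /f EFinM.
      rewrite ge0_integralZl//.
      - rewrite integral_indic; [by []|exact: mD|exact: mU].
      - apply/measurable_EFinP; apply: measurable_funTS; exact: measurable_indic (mU k).
      - by rewrite lee_fin ltW.
    apply: (@le_trans _ _ ((c k)%:E * (mu (E k) + (ek k)%:E))%E).
      apply: lee_wpmul2l; first by rewrite lee_fin ltW.
      apply: (@le_trans _ _ (mu (E k `|` (U k `\` E k)))).
        apply: le_measure; rewrite ?inE.
        + exact: (measurableI _ _ (mU k) mD).
        + exact: (measurableU _ _ (mE k) (measurableD (mU k) (mE k))).
        + by move=> x [Ux _]; have [|] := pselect (E k x); [left|right].
      apply: (@le_trans _ _ (mu (E k) + mu (U k `\` E k))%E).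
        by apply: measureU2; [exact: mE|exact: (measurableD (mU k) (mE k))].
      by rewrite leeD2l//; case: (HU k) => _ _ /ltW.
    rewrite ge0_muleDr ?lee_fin ?(ltW (ek0 k))//.
    have -> : ((c k)%:E * (ek k)%:E = (eps / 2 / (2 ^ k.+1)%:R)%:E)%E.
      by rewrite -EFinM; congr EFin; rewrite /ek mulrC divfK// gt_eqF.
    rewrite leeD2r// /A -integral_cst; last exact: mE.
    apply: ge0_le_integral.
    + exact: mE.
    + by move=> x _; rewrite /= lee_fin ltW.
    + exact: measurable_cst.
    + by apply: measurable_funS mphiE => // x [].
    + move=> x [_ /=]; rewrite in_itv /= => /andP[h1 _].
      by rewrite lee_fin /c -natr1 mulrDl mul1r lerD2r.
  have A0 k : (0 <= A k)%E.
    by apply: integral_ge0 => x _; rewrite lee_fin addr_ge0// ltW.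
  apply: le_trans (epsilon_trick xpredT A0 _) _; first by rewrite divr_ge0 ?(ltW eps0).
  rewrite /A -ge0_integral_bigcup//; last 2 first.
  + by rewrite bigE.
  + by move=> x _; rewrite lee_fin addr_ge0// ltW.
  rewrite bigE.
  under eq_integral do rewrite EFinD.
  rewrite ge0_integralD//; last 3 first.
  + by move=> x _; rewrite lee_fin.
  + exact/measurable_EFinP/measurable_funTS.
  + by move=> x _; rewrite lee_fin ltW.
  rewrite (_ : (\int[mu]_(x in D) dl%:E)%E = (eps / 2)%:E); last first.
    transitivity (dl%:E * L%:E)%E.
      by rewrite integral_cst//; congr (_ * _)%E; exact: lebesgue_segment (ltW L0).
    by rewrite -EFinM /dl divfK// gt_eqF.
  by rewrite -addeA -EFinD -splitr.
Qed.

(** * Green potentials of nonnegative densities *)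

(** Integral over [0, L] of [c] with respect to the density [w]; the density is
    extended-real valued. *)
Definition wint (R : realType) (L : R) (w : R -> \bar R) (c : R -> R) : \bar R :=
  (\int[lebesgue_measure]_(y in `[0%R, L]) ((c y)%:E * w y))%E.

Lemma measurable_wint (R : realType) (L : R) (w : R -> \bar R) (c : R -> R) :
  measurable_fun [set: R] w -> continuous c ->
  measurable_fun `[0%R, L]%classic (fun y => (c y)%:E * w y)%E.
Proof.
move=> mw cc; apply: measurable_funTS; apply: emeasurable_funM => //.
by apply/measurable_EFinP; exact: continuous_measurable_fun.
Qed.

Lemma wintD (R : realType) (L : R) (w : R -> \bar R) (c1 c2 : R -> R) :
  measurable_fun [set: R] w -> (forall x, 0 <= w x)%E ->
  continuous c1 -> continuous c2 ->
  (forall y, 0 <= y <= L -> 0 <= c1 y) -> (forall y, 0 <= y <= L -> 0 <= c2 y) ->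
  wint L w (fun y => c1 y + c2 y) = (wint L w c1 + wint L w c2)%E.
Proof.
move=> mw w0 cc1 cc2 c10 c20; rewrite /wint -ge0_integralD.
- apply: eq_integral => y; rewrite inE /= in_itv /= => yD.
  by rewrite EFinD ge0_muleDl// lee_fin; [exact: c10|exact: c20].
- exact: measurable_itv.
- by move=> y; rewrite /= in_itv /= => yD; rewrite mule_ge0// lee_fin c10.
- exact: measurable_wint.
- by move=> y; rewrite /= in_itv /= => yD; rewrite mule_ge0// lee_fin c20.
- exact: measurable_wint.
Qed.

Lemma le_wint (R : realType) (L : R) (w : R -> \bar R) (c1 c2 : R -> R) :
  measurable_fun [set: R] w -> (forall x, 0 <= w x)%E ->
  continuous c1 -> continuous c2 ->
  (forall y, 0 <= y <= L -> 0 <= c1 y) -> (forall y, 0 <= y <= L -> c1 y <= c2 y) ->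
  (wint L w c1 <= wint L w c2)%E.
Proof.
move=> mw w0 cc1 cc2 c10 c12; rewrite /wint; apply: ge0_le_integral.
- exact: measurable_itv.
- by move=> y; rewrite /= in_itv /= => yD; rewrite mule_ge0// lee_fin c10.
- exact: measurable_wint.
- exact: measurable_wint.
- move=> y; rewrite /= in_itv /= => yD.
  by apply: lee_wpmul2r => //; rewrite lee_fin c12.
Qed.

Lemma wint_cst (R : realType) (L : R) (w : R -> \bar R) (b : R) :
  measurable_fun [set: R] w -> (forall x, 0 <= w x)%E -> 0 <= b ->
  wint L w (fun=> b) = (b%:E * \int[lebesgue_measure]_(y in `[0%R, L]) w y)%E.
Proof.
move=> mw w0 b0; rewrite /wint ge0_integralZl//.
exact: measurable_funTS.
Qed.

Lemma wint_fin (R : realType) (L : R) (w : R -> \bar R) (b : R) (c : R -> R) :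
  measurable_fun [set: R] w -> (forall x, 0 <= w x)%E -> continuous c ->
  (\int[lebesgue_measure]_(y in `[0%R, L]) w y < +oo)%E ->
  (forall y, 0 <= y <= L -> 0 <= c y <= b) ->
  wint L w c \is a fin_num.
Proof.
move=> mw w0 cc wfin cb.
have i0 : (0 <= wint L w c)%E.
  apply: integral_ge0 => y /=; rewrite in_itv /= => /cb /andP[c0 _].
  by rewrite mule_ge0.
rewrite ge0_fin_numE//.
apply: (@le_lt_trans _ _ (wint L w (fun=> `|b|))).
  apply: le_wint => //; first exact: cst_continuous.
    by move=> y /cb /andP[].
  by move=> y /cb /andP[_ h]; apply: le_trans h (ler_norm _).
by rewrite wint_cst// lte_mul_pinfty.
Qed.

(** The potential of a nonnegative integrable density is Lipschitz. *)
Lemma continuous_wint_green (R : realType) (L : R) (w : R -> \bar R) :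
  0 < L -> measurable_fun [set: R] w -> (forall x, 0 <= w x)%E ->
  (\int[lebesgue_measure]_(y in `[0%R, L]) w y < +oo)%E ->
  {within `[0%R, L], continuous (fun x => fine (wint L w (green L x)))}.
Proof.
move=> L0 mw w0 wfin.
pose W := fine (\int[lebesgue_measure]_(y in `[0%R, L]) w y)%E.
have Wge0 : 0 <= W by apply: fine_ge0; apply: integral_ge0.
have EW : (\int[lebesgue_measure]_(y in `[0%R, L]) w y)%E = W%:E.
  by rewrite /W fineK// ge0_fin_numE// integral_ge0.
have gfin x : 0 <= x <= L -> wint L w (green L x) \is a fin_num.
  move=> xD; apply: (@wint_fin _ _ _ L) => //; first exact: continuous_green.
  by move=> y yD; rewrite green_ge0// green_le.
have lip x x' : 0 <= x <= L -> 0 <= x' <= L ->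
    fine (wint L w (green L x')) <= fine (wint L w (green L x)) + 2 * `|x - x'| * W.
  move=> xD x'D; rewrite -lee_fin EFinD !fineK ?gfin//.
  rewrite EFinM -EW -wint_cst// -wintD//; try exact: continuous_green;
    try exact: cst_continuous; try by move=> y yD; exact: green_ge0.
  apply: le_wint => //.
  - exact: continuous_green.
  - by move=> y; apply: cvgD; [exact: continuous_green|exact: cvg_cst].
  - by move=> y yD; exact: green_ge0.
  - by move=> y yD; exact: green_lip.
have K0 : 0 < 2 * W + 1 by rewrite ltr_wpDl ?mulr_ge0.
apply/subspace_continuousP => x /=; rewrite in_itv /= => xD.
apply/cvgrPdist_le => /= e e0; rewrite near_withinE; near=> z.
rewrite /= in_itv /= => zD.
have xz : `|x - z| <= e / (2 * W + 1).
  by near: z; apply: cvgr_dist_le => //; exact: divr_gt0.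
have h : 2 * `|x - z| * W <= e.
  move: xz; rewrite ler_pdivlMr// => xz; apply: le_trans xz.
  by rewrite mulrDr mulr1 mulrCA mulrA lerDl.
have := lip x z xD zD; have := lip z x zD xD; rewrite [`|z - x|]distrC.
move: h; set c := 2 * _ * W; move=> h h1 h2.
suff : `|fine (wint L w (green L x)) - fine (wint L w (green L z))| <= e by [].
by rewrite ler_norml; apply/andP; split; lra.
Unshelve. all: by end_near. Qed.

(** Integrated form of [green_sd]. *)
Lemma wint_green_sd (R : realType) (L x h : R) (w : R -> \bar R) :
  0 < L -> measurable_fun [set: R] w -> (forall x, 0 <= w x)%E ->
  (\int[lebesgue_measure]_(y in `[0%R, L]) w y < +oo)%E ->
  0 < h -> h <= x -> x + h <= L ->
  fine (wint L w (green L (x + h))) + fine (wint L w (green L (x - h))) +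
  fine (wint L w (fun y => hat h (y - x))) = 2 * fine (wint L w (green L x)).
Proof.
move=> L0 mw w0 wfin h0 hx xL.
have xD : 0 <= x <= L by apply/andP; split; lra.
have xhD : 0 <= x + h <= L by apply/andP; split; lra.
have xhD' : 0 <= x - h <= L by apply/andP; split; lra.
have gfin z : 0 <= z <= L -> wint L w (green L z) \is a fin_num.
  move=> zD; apply: (@wint_fin _ _ _ L) => //; first exact: continuous_green.
  by move=> y yD; rewrite green_ge0// green_le.
have hat0 s : 0 <= hat h s by rewrite /hat le_max lexx.
have hfin : wint L w (fun y => hat h (y - x)) \is a fin_num.
  apply: (@wint_fin _ _ _ h) => //; first exact: continuous_hat.
  by move=> y yD; rewrite hat0 /hat ge_max (ltW h0) gerBl normr_ge0.
apply: EFin_inj; rewrite mulr_natl mulr2n.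
rewrite !EFinD !fineK ?gfin//.
have c1 : continuous (fun y => green L (x + h) y + green L (x - h) y).
  by move=> y; apply: cvgD; exact: continuous_green.
have c2 : continuous (fun y => hat h (y - x)) by exact: continuous_hat.
have cg z := @continuous_green R L z.
rewrite -!wintD//.
  by congr wint; apply/funext => y; rewrite green_sd// mulr_natl mulr2n.
all: move=> y yD; first [exact: hat0|by rewrite green_ge0|
  by apply: addr_ge0; rewrite green_ge0].
Qed.

(** * Functions with an integrable symmetric second derivative *)

(** The affine function that agrees with [F] at 0 and at [L]. *)
Definition chord (R : realType) (L : R) (F : R -> R) (x : R) : R :=
  (F 0 * (L - x) + F L * x) / L.

(** One half of [green_repr] for a nonnegative density: if the upper symmetric
    second derivative of [F] is at most [phi], then [F] is at least the
    solution of G'' = phi with the same boundary values. *)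
Lemma green_upper_ge0 (R : realType) (L : R) (F phi : R -> R) :
  0 < L -> measurable_fun [set: R] phi -> (forall x, 0 <= phi x) ->
  (\int[lebesgue_measure]_(y in `[0%R, L]) (phi y)%:E < +oo)%E ->
  {within `[0%R, L], continuous F} ->
  (forall x, 0 < x < L -> forall d, 0 < d -> exists2 r, 0 < r & forall h, 0 < h < r ->
     F (x + h) + F (x - h) - 2 * F x <= h ^+ 2 * (phi x + d)) ->
  forall x, 0 <= x <= L ->
    chord L F x - F x <= fine (wint L (EFin \o phi) (green L x)).
Proof.
move=> L0 mphi phi0 phifin cF sdF x xD.
have Ln0 : L != 0 by rewrite gt_eqF.
have mphiE : measurable_fun [set: R] (EFin \o phi) by exact/measurable_EFinP.
have phiE0 y : (0 <= (EFin \o phi) y)%E by rewrite lee_fin.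
have gP z y : 0 <= z <= L -> 0 <= y <= L -> 0 <= green L z y <= L.
  by move=> zD yD; rewrite green_ge0// green_le.
have gfin (w : R -> \bar R) z : measurable_fun [set: R] w -> (forall x, 0 <= w x)%E ->
    (\int[lebesgue_measure]_(y in `[0%R, L]) w y < +oo)%E ->
    0 <= z <= L -> wint L w (green L z) \is a fin_num.
  move=> mw w0 wfin zD; apply: (@wint_fin _ _ _ L) => //; first exact: continuous_green.
  by move=> y; exact: gP.
apply/ler_addgt0Pr => e e0.
pose eps := e / (L + L ^+ 2).
have LL0 : 0 < L + L ^+ 2 by rewrite addr_gt0// exprn_gt0.
have eps0 : 0 < eps by rewrite divr_gt0.
have [w [mw w0 lw iw]] := vitali_caratheodory L0 eps0 mphi phi0.
have wfin : (\int[lebesgue_measure]_(y in `[0%R, L]) w y < +oo)%E.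
  by apply: (le_lt_trans iw); rewrite lte_add_pinfty// ltry.
pose Ga z := fine (wint L w (green L z)).
(* With w a majorant of phi as above, the potential Ga of w has second
   difference at most - h^2 phi(z) for small h, and eps z^2 makes the second
   difference of G strictly positive. *)
pose G z := eps * z ^+ 2 - Ga z - F z.
have Ga0 : Ga 0 = 0.
  rewrite /Ga (_ : wint L w _ = 0%E)//; apply: integral0_eq => y /=.
  by rewrite in_itv /= => /andP[y0 _]; rewrite green0// mul0e.
have GaL : Ga L = 0.
  rewrite /Ga (_ : wint L w _ = 0%E)//; apply: integral0_eq => y /=.
  by rewrite in_itv /= => /andP[_ yL]; rewrite greenL// mul0e.
have cG : {within `[0%R, L], continuous G}.
  have c1 : {within `[0%R, L], continuous (fun z => eps * z ^+ 2)}.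
    apply: continuous_subspaceT => z; apply: cvgM; first exact: cvg_cst.
    exact: exprn_continuous.
  have c2 := continuous_wint_green L0 mw w0 wfin.
  by move=> z; apply: cvgB; [apply: cvgB; [exact: c1|exact: c2]|exact: cF].
have sdG z : 0 < z < L -> forall r, 0 < r ->
    exists2 h, 0 < h < r & 0 < G (z + h) + G (z - h) - 2 * G z.
  move=> /andP[z0 zL] r r0.
  have [|r1 r10 H1] := lw z; first by rewrite !ltW.
  have [|r2 r20 H2] := sdF z _ _ eps0; first by rewrite z0.
  pose h := Num.min (Num.min (r / 2) (r1 / 2)) (Num.min (r2 / 2) (Num.min z (L - z))).
  have h0 : 0 < h by rewrite !lt_min !divr_gt0// z0 subr_gt0 zL.
  have : h <= h by [].
  rewrite {2}/h !le_min => /andP[/andP[hr hr1] /and3P[hr2 hz hL]].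
  exists h; first by apply/andP; split; lra.
  have hr2' : 0 < h < r2 by apply/andP; split; lra.
  have h2 := H2 h hr2'.
  have zhL : z + h <= L by lra.
  have h3 : Ga (z + h) + Ga (z - h) + fine (wint L w (fun y => hat h (y - z))) =
      2 * Ga z := wint_green_sd L0 mw w0 wfin h0 hz zhL.
  have h4 : phi z * h ^+ 2 <= fine (wint L w (fun y => hat h (y - z))).
    have hat0 s : 0 <= hat h s by rewrite /hat le_max lexx.
    rewrite -lee_fin fineK; last first.
      apply: (@wint_fin _ _ _ h) => //; first exact: continuous_hat.
      by move=> y yD; rewrite hat0 /hat ge_max (ltW h0) gerBl normr_ge0.
    rewrite EFinM -(integral_hat h0 hz zhL) -ge0_integralZl//=.
    - apply: ge0_le_integral => //.
      + by move=> y _; rewrite mule_ge0// lee_fin.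
      + apply: emeasurable_funM => //; apply/measurable_EFinP/measurable_funTS.
        by apply: continuous_measurable_fun; exact: continuous_hat.
      + apply: emeasurable_funM; last exact: measurable_funTS.
        apply/measurable_EFinP/measurable_funTS.
        by apply: continuous_measurable_fun; exact: continuous_hat.
      + move=> y _; rewrite muleC.
        have [yz|yz] := leP h `|y - z|.
          by rewrite /hat max_l ?mul0e// subr_le0.
        by apply: lee_wpmul2l; [rewrite lee_fin|apply: H1; lra].
    - apply/measurable_EFinP/measurable_funTS.
      by apply: continuous_measurable_fun; exact: continuous_hat.
    - by move=> y _; rewrite lee_fin.
    - by rewrite lee_fin.
  have hh0 : 0 < h ^+ 2 by rewrite exprn_gt0.
  have h5 : 0 < eps * h ^+ 2 by rewrite mulr_gt0.
  have e1 : eps * (z + h) ^+ 2 + eps * (z - h) ^+ 2 - 2 * (eps * z ^+ 2) =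
      2 * (eps * h ^+ 2) by ring.
  have e2 : h ^+ 2 * (phi z + eps) = phi z * h ^+ 2 + eps * h ^+ 2 by ring.
  rewrite e2 in h2; clearbody h; rewrite /G; lra.
have Gx := max0_le_chord L0 cG sdG xD.
(* The integral of w exceeds that of phi by eps at most. It is split with the
   nonnegative weights green and L - green; the second part is no smaller for
   w than for phi, which bounds the first. *)
have GaB : Ga x <= fine (wint L (EFin \o phi) (green L x)) + L * eps.
  have wI (u : R -> \bar R) : measurable_fun [set: R] u -> (forall x, 0 <= u x)%E ->
     (wint L u (green L x) + wint L u (fun y => (L - green L x y)%R) =
      L%:E * \int[lebesgue_measure]_(y in `[0%R, L]) u y)%E.
    move=> mu_ u0; rewrite -wint_cst//; last exact: ltW.
    rewrite -wintD//.
    - by congr wint; apply/funext => y; rewrite addrC subrK.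
    - exact: continuous_green.
    - by move=> y; apply: cvgB; [exact: cvg_cst|exact: continuous_green].
    - by move=> y yD; have /andP[] := gP _ _ xD yD.
    - by move=> y yD; rewrite subr_ge0; have /andP[] := gP _ _ xD yD.
  have fin2 (u : R -> \bar R) : measurable_fun [set: R] u -> (forall x, 0 <= u x)%E ->
      (\int[lebesgue_measure]_(y in `[0%R, L]) u y < +oo)%E ->
      wint L u (fun y => L - green L x y) \is a fin_num.
    move=> mu_ u0 uf; apply: (@wint_fin _ _ _ L) => //.
    - by move=> y; apply: cvgB; [exact: cvg_cst|exact: continuous_green].
    - move=> y yD; have /andP[g1 g2] := gP _ _ xD yD.
      by apply/andP; split; lra.
  have cLg : continuous (fun y => L - green L x y).
    by move=> y; apply: cvgB; [exact: cvg_cst|exact: continuous_green].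
  have A1 := wI _ mw w0; have A2 := wI _ mphiE phiE0.
  have A3 : (wint L (EFin \o phi) (fun y => L - green L x y)%R <=
             wint L w (fun y => L - green L x y)%R)%E.
    apply: ge0_le_integral => //.
    - move=> y; rewrite /= in_itv /= => yD; apply: mule_ge0; last exact: phiE0.
      by rewrite lee_fin subr_ge0; have /andP[] := gP _ _ xD yD.
    - exact: measurable_wint mphiE cLg.
    - exact: measurable_wint mw cLg.
    - move=> y; rewrite /= in_itv /= => yD; apply: lee_wpmul2l.
        by rewrite lee_fin subr_ge0; have /andP[] := gP _ _ xD yD.
      have [r r0] := lw _ yD; apply; by rewrite subrr normr0.
  have I0 (u : R -> \bar R) : (forall x, 0 <= u x)%E ->
      (0 <= \int[lebesgue_measure]_(y in `[0%R, L]) u y)%E.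
    by move=> u0; exact: integral_ge0.
  have f1 : (\int[lebesgue_measure]_(y in `[0%R, L]) w y)%E \is a fin_num.
    by rewrite ge0_fin_numE// I0.
  have f2 : (\int[lebesgue_measure]_(y in `[0%R, L]) (EFin \o phi) y)%E \is a fin_num.
    by rewrite ge0_fin_numE// I0.
  move: A1 A2 A3 iw; rewrite /Ga.
  rewrite -(fineK f1) -(fineK f2) -(fineK (gfin _ _ mw w0 wfin xD)).
  rewrite -(fineK (gfin _ _ mphiE phiE0 phifin xD)).
  rewrite -(fineK (fin2 _ mw w0 wfin)) -(fineK (fin2 _ mphiE phiE0 phifin)).
  rewrite -!EFinD -!EFinM !lee_fin => -[A1] [A2] A3 A4.
  have A5 := ler_wpM2l (ltW L0) A4.
  rewrite mulrDr in A5; lra.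
move: Gx; rewrite /G Ga0 GaL -/(Ga x) !subr0 expr0n /= mulr0 sub0r => Gx.
have e1 : eps * (L + L ^+ 2) = e by rewrite /eps divfK// gt_eqF.
have -> : chord L F x = - ((- F 0 * (L - x) + (eps * L ^+ 2 - F L) * x) / L) + eps * L * x.
  by rewrite /chord; field.
have x2 : 0 <= eps * x ^+ 2 by rewrite mulr_ge0 ?(ltW eps0)// sqr_ge0.
have x3 : eps * L * x <= eps * L * L.
  by apply: ler_wpM2l; [rewrite mulr_ge0 ?(ltW eps0) ?(ltW L0)|case/andP: xD].
have e2 : eps * (L + L ^+ 2) = L * eps + eps * L * L by ring.
move: Gx; set q := _ / L => Gx; clearbody q.
rewrite e2 in e1; lra.
Qed.

Lemma integral_cst_segment (R : realType) (L c : R) : 0 <= L ->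
  (\int[lebesgue_measure]_(y in `[0%R, L]) (EFin \o cst (c : R)) y = (c * L)%:E)%E.
Proof.
move=> L0; have mD : measurable (`[0%R, L]%classic : set R) by exact: measurable_itv.
have := @integral_cst _ _ _ (@lebesgue_measure R) _ mD c%:E.
by rewrite EFinM -(lebesgue_segment L0).
Qed.

(** The same for an integrable density [f] of any sign. The density n +
    max(f,-n) is nonnegative and corresponds to [F] minus n times the potential
    of 1; then n tends to infinity by dominated convergence. *)
Lemma green_upper (R : realType) (L : R) (F f : R -> R) :
  0 < L -> measurable_fun [set: R] f ->
  (@lebesgue_measure R).-integrable `[0%R, L] (EFin \o f) ->
  {within `[0%R, L], continuous F} ->
  (forall x, 0 < x < L -> forall d, 0 < d -> exists2 r, 0 < r & forall h, 0 < h < r ->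
     F (x + h) + F (x - h) - 2 * F x <= h ^+ 2 * (f x + d)) ->
  forall x, 0 <= x <= L ->
    chord L F x - F x <= \int[lebesgue_measure]_(y in `[0%R, L]) (green L x y * f y).
Proof.
move=> L0 mf intf cF sdF x xD.
pose mu := @lebesgue_measure R; pose D : set R := `[0%R, L]%classic.
have mD : measurable D by exact: measurable_itv.
pose one : R -> \bar R := EFin \o cst 1.
have one0 y : (0 <= one y)%E by rewrite lee_fin.
have mone : measurable_fun [set: R] one by exact/measurable_EFinP.
have onefin : (\int[lebesgue_measure]_(y in `[0%R, L]) one y < +oo)%E.
  rewrite (_ : integral _ _ _ = L%:E) ?ltry//.
  by rewrite /one integral_cst_segment ?mul1r// ltW.
pose Ga1 z := fine (wint L one (green L z)).
have cGa1 := continuous_wint_green L0 mone one0 onefin.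
have intG (u : R -> R) : mu.-integrable D (EFin \o u) ->
    mu.-integrable D (EFin \o (fun y => green L x y * u y)).
  move=> iu.
  have iLu : mu.-integrable D (EFin \o (fun y => L * u y)).
    under [X in integrable _ _ X]eq_fun do rewrite /= EFinM.
    exact: integrableZl.
  apply: le_integrable iLu => //.
  - apply/measurable_EFinP; apply: measurable_funM.
      apply: measurable_funTS; apply: continuous_measurable_fun; exact: continuous_green.
    by apply/measurable_EFinP; exact: measurable_int iu.
  - move=> y; rewrite /D /= in_itv /= => yD; rewrite lee_fin !normrM.
    by apply: ler_wpM2r => //; rewrite !ger0_norm ?green_le ?green_ge0// ltW.
have intcst (c : R) : mu.-integrable D (EFin \o cst c).
  apply/integrableP; split; first exact/measurable_EFinP.
  rewrite (_ : integral _ _ _ = (`|c| * L)%:E) ?ltry//.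
  by rewrite -(integral_cst_segment _ (ltW L0)).
pose fn (n : nat) y := Num.max (f y) (- n%:R).
have mfn n : measurable_fun [set: R] (fn n) by exact: measurable_maxr.
have fnle n y : `|fn n y| <= `|f y|.
  have n0 : (0 : R) <= n%:R by [].
  rewrite /fn; have [h|h] := leP (f y) (- n%:R) => //.
  by rewrite ler0_norm ?oppr_le0// ler0_norm; lra.
have ifn n : mu.-integrable D (EFin \o fn n).
  apply: le_integrable intf => //; first by apply/measurable_EFinP;
    exact: measurable_funTS (mfn n).
  by move=> y _; rewrite lee_fin fnle.
have main n : chord L F x - F x <= \int[mu]_(y in D) (green L x y * fn n y).
  pose phi y := fn n y + n%:R.
  have mphi : measurable_fun [set: R] phi by exact: measurable_funD.
  have phi0 y : 0 <= phi y.
    by rewrite /phi /fn -(addNr n%:R) lerD2r le_max lexx orbT.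
  pose Fn z := F z - n%:R * Ga1 z.
  have cFn : {within `[0%R, L], continuous Fn}.
    move=> z; apply: cvgB; first exact: cF.
    by apply: cvgM; [exact: cvg_cst|exact: cGa1].
  have iphi : mu.-integrable D (EFin \o phi).
    rewrite (_ : EFin \o phi = (EFin \o fn n) \+ (EFin \o cst n%:R))%E//.
    by apply: integrableD => //; exact: intcst.
  have phifin : (\int[lebesgue_measure]_(y in `[0%R, L]) (phi y)%:E < +oo)%E.
    exact: integrable_lty iphi.
  have sdFn z : 0 < z < L -> forall d, 0 < d -> exists2 r, 0 < r & forall h, 0 < h < r ->
     Fn (z + h) + Fn (z - h) - 2 * Fn z <= h ^+ 2 * (phi z + d).
    move=> /andP[z0 zL] d d0.
    have [|r r0 H] := sdF z _ d d0; first by rewrite z0.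
    exists (Num.min r (Num.min z (L - z))); first by rewrite !lt_min r0 z0 subr_gt0.
    move=> h; rewrite !lt_min => /and4P[h0 hr hz hL].
    have zhL : z + h <= L by lra.
    have := wint_green_sd L0 mone one0 onefin h0 (ltW hz) zhL.
    rewrite -!/(Ga1 _) (_ : fine (wint _ _ (fun y => hat h (y - z))) = h ^+ 2); last first.
      rewrite /wint; under eq_integral do rewrite /= mule1.
      by rewrite (integral_hat h0 (ltW hz) zhL).
    have := H h; rewrite h0 hr => /(_ isT).
    have fl : f z <= fn n z by rewrite le_max lexx.
    have : h ^+ 2 * (f z + d) <= h ^+ 2 * (fn n z + d).
      by apply: ler_wpM2l; [exact: sqr_ge0|rewrite lerD2r].
    rewrite /Fn /phi => k1 k2 k3.
    have k4 : n%:R * (Ga1 (z + h) + Ga1 (z - h) - 2 * Ga1 z) = - (n%:R * h ^+ 2).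
      by rewrite (_ : Ga1 (z + h) + _ - _ = - h ^+ 2) ?mulrN//; lra.
    have -> : h ^+ 2 * (fn n z + n%:R + d) = h ^+ 2 * (fn n z + d) + n%:R * h ^+ 2 by ring.
    have -> : F (z + h) - n%:R * Ga1 (z + h) + (F (z - h) - n%:R * Ga1 (z - h)) -
       2 * (F z - n%:R * Ga1 z) = F (z + h) + F (z - h) - 2 * F z -
       n%:R * (Ga1 (z + h) + Ga1 (z - h) - 2 * Ga1 z) by ring.
    by rewrite k4 opprK lerD2r; exact: le_trans k1.
  have := green_upper_ge0 L0 mphi phi0 phifin cFn sdFn xD.
  have Ga0 : Ga1 0 = 0.
    rewrite /Ga1 (_ : wint L _ _ = 0%E)//; apply: integral0_eq => y /=.
    by rewrite in_itv /= => /andP[y0 _]; rewrite green0// mul0e.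
  have GaL : Ga1 L = 0.
    rewrite /Ga1 (_ : wint L _ _ = 0%E)//; apply: integral0_eq => y /=.
    by rewrite in_itv /= => /andP[_ yL]; rewrite greenL ?mul0e// gt_eqF.
  have -> : chord L Fn x = chord L F x by rewrite /chord /Fn Ga0 GaL mulr0 !subr0.
  have -> : fine (wint L (EFin \o phi) (green L x)) =
      \int[mu]_(y in D) (green L x y * fn n y) + n%:R * Ga1 x.
    have -> : Ga1 x = \int[mu]_(y in D) (green L x y * 1).
      by rewrite /Ga1 /wint /Rintegral; under [in RHS]eq_integral do rewrite EFinM.
    have i1 := intG _ (intcst 1).
    rewrite -RintegralZl// -RintegralD//.
    - rewrite /wint /Rintegral; congr fine; apply: eq_integral => y _.
      by rewrite /phi /= -EFinM; congr EFin; ring.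
    - exact: intG.
    - under [X in integrable _ _ X]eq_fun do rewrite /= EFinM.
      exact: integrableZl.
  by rewrite /Fn opprB addrA addrAC -addrA; set q := _ * Ga1 x; lra.
have intg := intG _ intf.
have := @dominated_convergence _ _ _ mu D mD
  (fun n => EFin \o (fun y => green L x y * fn n y))
  (EFin \o (fun y => green L x y * f y)) (EFin \o (fun y => `|green L x y * f y|)).
case.
- by move=> n; have /measurable_int := intG _ (ifn n).
- by have /measurable_int := intg.
- apply/aeW => y _; apply: cvg_near_cst; near=> n => /=.
  rewrite /fn max_l//.
  have : `|f y| <= n%:R by near: n; exact: nbhs_infty_ger.
  by rewrite ler_norml => /andP[].
- rewrite (_ : EFin \o _ = abse \o (EFin \o (fun y => green L x y * f y)))//.
  exact: integrable_abse.
- apply/aeW => y n _ /=; rewrite lee_fin !normrM.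
  by apply: ler_wpM2l => //; exact: fnle.
have fing : (\int[mu]_(y in D) (green L x y * f y)%:E)%E \is a fin_num.
  by apply: integrable_fin_num intg.
move=> _ _; rewrite -(fineK fing) => /fine_cvgP[_ cv].
apply: (cvgr_to_ge cv); near=> n => /=; exact: main.
Unshelve. all: by end_near. Qed.

Lemma integrable_contM (R : realType) (L : R) (c f : R -> R) :
  continuous c ->
  (@lebesgue_measure R).-integrable `[0%R, L] (EFin \o f) ->
  (@lebesgue_measure R).-integrable `[0%R, L] (EFin \o (fun y => c y * f y)).
Proof.
move=> cc iff.
rewrite (_ : EFin \o _ = (EFin \o c) \* (EFin \o f))%E//.
apply: integrableMr => //.
- by apply: measurable_funTS; exact: continuous_measurable_fun.
- have := @segment_compact R 0 L.
  move=> /(continuous_compact (continuous_subspaceT cc)) /compact_bounded[M [Mr HM]].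
  by exists M; split=> // x Mx y Dy; apply: (HM x Mx); exists y.
Qed.

(** A continuous function with the integrable symmetric second derivative [f]
    at every interior point is its chord minus the Green potential of [f]. *)
Lemma green_repr (R : realType) (L : R) (F f : R -> R) :
  0 < L -> measurable_fun [set: R] f ->
  (@lebesgue_measure R).-integrable `[0%R, L] (EFin \o f) ->
  {within `[0%R, L], continuous F} ->
  (forall x, 0 < x < L -> forall d, 0 < d -> exists2 r, 0 < r & forall h, 0 < h < r ->
     `|F (x + h) + F (x - h) - 2 * F x - h ^+ 2 * f x| <= h ^+ 2 * d) ->
  forall x, 0 <= x <= L ->
    F x = chord L F x - \int[lebesgue_measure]_(y in `[0%R, L]) (green L x y * f y).
Proof.
move=> L0 mf intf cF sdF x xD.
have up : chord L F x - F x <= \int[lebesgue_measure]_(y in `[0%R, L]) (green L x y * f y).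
  apply: (green_upper L0 mf intf cF _ xD) => z zD d d0.
  have [r r0 H] := sdF z zD d d0; exists r => // h /H.
  by rewrite ler_norml => /andP[_]; rewrite mulrDr lerBlDl.
have intNf : (@lebesgue_measure R).-integrable `[0%R, L] (EFin \o (fun y => - f y)).
  by rewrite (_ : EFin \o _ = \- (EFin \o f))%E//; exact: integrableN.
have cNF : {within `[0%R, L], continuous (fun z => - F z)}.
  by move=> z; apply: cvgN; exact: cF.
have := @green_upper _ L (fun z => - F z) (fun y => - f y) L0
  (measurableT_comp (@oppr_measurable R setT) mf) intNf cNF _ x xD.
have -> : \int[lebesgue_measure]_(y in `[0%R, L]) (green L x y * - f y) =
    - \int[lebesgue_measure]_(y in `[0%R, L]) (green L x y * f y).
  rewrite -mulN1r -RintegralZl//; last first.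
    by apply: integrable_contM => //; exact: continuous_green.
  by apply: eq_Rintegral => y _; rewrite mulN1r mulrN.
have -> : chord L (fun z => - F z) x = - chord L F x by rewrite /chord -mulNr opprD !mulNr.
move=> dn; have {}dn := dn _; set I := Rintegral _ _ _ in up dn *.
have : - chord L F x - - F x <= - I; last by lra.
apply: dn => z zD d d0.
have [r r0 H] := sdF z zD d d0; exists r => // h /H.
rewrite ler_norml => /andP[+ _]; lra.
Qed.

(** * Elementary estimates on the sine and on (sin y / y)^2 *)

Lemma le_dist_of_derive (R : realType) (f df : R -> R) (B a b : R) :
  (forall x : R, is_derive x 1 f (df x)) ->
  (forall x, Num.min a b <= x <= Num.max a b -> `|df x| <= B) ->
  `|f b - f a| <= B * `|b - a|.
Proof.
wlog ab : a b / a <= b => [H|] dF hB.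
  have [ab|/ltW ba] := leP a b; first exact: H.
  by rewrite distrC [`|b - a|]distrC; apply: H => // x; rewrite minC maxC; exact: hB.
have [->|nab] := eqVneq a b; first by rewrite !subrr normr0 mulr0.
have {nab}ab' : a < b by rewrite lt_neqAle nab ab.
have cf : continuous f.
  by move=> x; apply/differentiable_continuous/derivable1_diffP; case: (dF x).
have [c + ->] := MVT ab' (fun x _ => dF x) (continuous_subspaceT cf).
rewrite in_itv /= => /andP[ac cb]; rewrite normrM; apply: ler_wpM2r => //.
by apply: hB; rewrite min_l// max_r// !ltW.
Qed.

Lemma sin_lip (R : realType) (x y : R) : `|sin x - sin y| <= `|x - y|.
Proof.
rewrite -[leRHS]mul1r; apply: (@le_dist_of_derive _ _ cos) => z _.
exact: cos_max.
Qed.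

Lemma norm_sin_le (R : realType) (x : R) : `|sin x| <= `|x|.
Proof. by have := sin_lip x 0; rewrite sin0 !subr0. Qed.

Lemma one_minus_cos (R : realType) (x : R) : 1 - cos x = 2 * sin (x / 2) ^+ 2.
Proof.
have {1}-> : x = (x / 2) *+ 2 by rewrite -mulr_natr; field.
by rewrite cos_mulr2n cos2sin2; ring.
Qed.

Lemma one_minus_cos_le (R : realType) (x : R) : 0 <= 1 - cos x <= x ^+ 2 / 2.
Proof.
rewrite one_minus_cos mulr_ge0 ?sqr_ge0//=.
have : sin (x / 2) ^+ 2 <= (x / 2) ^+ 2.
  rewrite -[sin _ ^+ 2]real_normK ?num_real// -[(x / 2) ^+ 2]real_normK ?num_real//.
  by rewrite lerXn2r ?nnegrE ?norm_sin_le.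
lra.
Qed.

Lemma sin_sub_id_le (R : realType) (x y : R) : 0 <= x -> x <= y ->
  `|(y - sin y) - (x - sin x)| <= y ^+ 2 / 2 * (y - x).
Proof.
move=> x0 xy; rewrite -[y - x in leRHS]ger0_norm ?subr_ge0//.
apply: (@le_dist_of_derive _ (fun z => z - sin z) (fun z => 1 - cos z)) => z.
rewrite min_l// max_r// => /andP[xz zy].
have /andP[c0 c1] := one_minus_cos_le z; rewrite ger0_norm//.
apply: le_trans c1 _; rewrite ler_pM2r ?invr_gt0//.
by rewrite lerXn2r ?nnegrE//; apply: le_trans x0 _ => //; apply: le_trans xz _.
Qed.

(** The weight of Riemann's summation method. *)
Definition sinc2 (R : realType) (y : R) : R := (sin y / y) ^+ 2.

Lemma norm_sinc_le1 (R : realType) (y : R) : 0 < y -> `|sin y / y| <= 1.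
Proof.
move=> y0; rewrite normrM normfV ler_pdivrMr ?normr_gt0 ?gt_eqF// mul1r.
exact: norm_sin_le.
Qed.

Lemma sinc2_le1 (R : realType) (y : R) : 0 < y -> 0 <= sinc2 y <= 1.
Proof.
move=> y0; rewrite /sinc2 sqr_ge0 /= -real_normK ?num_real//.
by apply: exprn_ile1 => //; exact: norm_sinc_le1.
Qed.

Lemma sinc2_near0 (R : realType) (y : R) : 0 < y -> 0 <= 1 - sinc2 y <= y ^+ 2.
Proof.
move=> y0; have /andP[_ h] := sinc2_le1 y0; rewrite subr_ge0 h /=.
have := sin_sub_id_le (lexx 0) (ltW y0).
rewrite sin0 !subr0 => h1.
have sE : sin y / y = 1 - (y - sin y) / y by field; rewrite gt_eqF.
have h2 : `|(y - sin y) / y| <= y ^+ 2 / 2.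
  by rewrite normrM normfV [`|y|]gtr0_norm// ler_pdivrMr.
rewrite /sinc2 sE; move: h2; rewrite ler_norml => /andP[_ h2].
have := sqr_ge0 ((y - sin y) / y); set t := _ / y in h2 *; nra.
Qed.

(** The bound is that of an increment of a multiple of y / (1 + y), so that the
    variation of [sinc2] over (0, +oo) is finite. *)
Lemma sinc2_lip (R : realType) (y z : R) : 0 < y -> y <= z ->
  `|sinc2 y - sinc2 z| <= 16 * ((z - y) / ((1 + y) * (1 + z))).
Proof.
move=> y0 yz; have z0 : 0 < z by exact: lt_le_trans yz.
have y1 : 0 < 1 + y by rewrite addr_gt0. have z1 : 0 < 1 + z by rewrite addr_gt0.
have sb (u : R) : 0 < u -> `|sin u / u| <= 2 / (1 + u).
  move=> u0; have u1 : 0 < 1 + u by rewrite addr_gt0.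
  rewrite ler_pdivlMr//; have [ul|ul] := leP u 1.
    have := norm_sinc_le1 u0; have := normr_ge0 (sin u / u); nra.
  rewrite normrM normfV [`|u|]gtr0_norm// mulrAC ler_pdivrMr//.
  have := sin_max u; have := normr_ge0 (sin u); nra.
have d : `|sin y / y - sin z / z| <= 4 * (z - y) / (1 + z).
  (* E is used for z > 1, and E', which contains the small differences y-sin
     y and z-sin z, for z <= 1. *)
  have E : sin y / y - sin z / z = ((z - y) * sin y + y * (sin y - sin z)) / (y * z).
    by field; rewrite !gt_eqF.
  have E' : sin y / y - sin z / z =
      (y * ((z - sin z) - (y - sin y)) - (z - y) * (y - sin y)) / (y * z).
    by field; rewrite !gt_eqF.
  have zy0 : 0 <= z - y by rewrite subr_ge0.
  have yz0 : 0 < y * z by rewrite mulr_gt0.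
  rewrite ler_pdivlMr//; have [zl|zl] := leP z 1.
    rewrite E' normrM normfV [`|y * z|]gtr0_norm// mulrAC ler_pdivrMr//.
    apply: (@le_trans _ _ ((y * (z ^+ 2 / 2 * (z - y)) + (z - y) * (y ^+ 2 / 2 * y)) * (1 + z))).
      apply: ler_wpM2r; first exact: ltW.
      apply: le_trans (ler_normB _ _) _; rewrite !normrM [`|y|]gtr0_norm//.
      rewrite [`|z - y|]ger0_norm//; apply: lerD.
        by apply: ler_wpM2l; [exact: ltW|apply: sin_sub_id_le => //; exact: ltW].
      apply: ler_wpM2l => //.
      by have := sin_sub_id_le (lexx 0) (ltW y0); rewrite sin0 !subr0.
    have -> : (y * (z ^+ 2 / 2 * (z - y)) + (z - y) * (y ^+ 2 / 2 * y)) * (1 + z) =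
        (z - y) * (y * ((z ^+ 2 + y ^+ 2) / 2 * (1 + z))) by field.
    have -> : 4 * (z - y) * (y * z) = (z - y) * (y * (4 * z)) by ring.
    apply: ler_wpM2l => //; apply: ler_wpM2l; first exact: ltW.
    have : y ^+ 2 <= z ^+ 2 by rewrite lerXn2r ?nnegrE// ltW.
    have : z ^+ 2 <= z by rewrite expr2 ger_pMl.
    nra.
  rewrite E normrM normfV [`|y * z|]gtr0_norm// mulrAC ler_pdivrMr//.
  apply: (@le_trans _ _ ((z - y) * y * 2 * (1 + z))).
    apply: ler_wpM2r; first exact: ltW.
    apply: le_trans (ler_normD _ _) _; rewrite !normrM [`|y|]gtr0_norm//.
    rewrite [`|z - y|]ger0_norm//.
    have -> : (z - y) * y * 2 = (z - y) * y + y * (z - y) by ring.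
    apply: lerD; first by apply: ler_wpM2l => //; rewrite -[leRHS]gtr0_norm// norm_sin_le.
    apply: ler_wpM2l; first exact: ltW.
    by rewrite -[leRHS]ger0_norm// [leRHS]distrC; exact: sin_lip.
  have -> : (z - y) * y * 2 * (1 + z) = (z - y) * y * (2 * (1 + z)) by ring.
  have -> : 4 * (z - y) * (y * z) = (z - y) * y * (4 * z) by ring.
  by apply: ler_wpM2l; [rewrite mulr_ge0// ltW|lra].
rewrite /sinc2 subr_sqr normrM.
have s2 : `|sin y / y + sin z / z| <= 4 / (1 + y).
  apply: le_trans (ler_normD _ _) _.
  have h1 := sb y y0; have h2 := sb z z0.
  have h3 : 2 / (1 + z) <= 2 / (1 + y) by rewrite ler_pM2l// lef_pV2 ?posrE// lerD2l.
  have -> : 4 / (1 + y) = 2 / (1 + y) + 2 / (1 + y) by rewrite -mulrDl; congr (_ / _); ring.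
  exact: lerD (h1) (le_trans h2 h3).
apply: le_trans (ler_pM _ _ d s2) _ => //.
rewrite le_eqVlt; apply/orP; left; apply/eqP; field.
by rewrite !gt_eqF.
Qed.

(** * Riemann's summation theorem *)

(** Summation by parts. *)
Lemma abel_sum (R : comNzRingType) (r w : nat -> R) (m N : nat) : (m <= N)%N ->
  \sum_(m <= n < N) (r n.+1 - r n) * w n =
  r N * w N - r m * w m + \sum_(m <= n < N) r n.+1 * (w n - w n.+1).
Proof.
elim: N => [|N IH]; first by rewrite leqn0 => /eqP ->; rewrite !big_geq// subrr addr0.
rewrite leq_eqVlt => /predU1P[->|]; first by rewrite !big_geq// subrr addr0.
rewrite ltnS => mN; rewrite !big_nat_recr//= IH//.
by set A := \sum_(_ <= _ < _) _; ring.
Qed.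

Lemma sinc2_variation (R : realType) (h : R) (N : nat) : 0 < h ->
  \sum_(1 <= n < N) `|sinc2 (n%:R * h) - sinc2 (n.+1%:R * h)| <= 16.
Proof.
move=> h0; pose psi (n : nat) := n%:R * h / (1 + n%:R * h).
have p0 n : 0 < 1 + n%:R * h by rewrite ltr_wpDr// mulr_ge0// ltW.
apply: (@le_trans _ _ (\sum_(1 <= n < N) 16 * (psi n.+1 - psi n))).
  rewrite [leLHS]big_nat_cond [leRHS]big_nat_cond.
  apply: ler_sum => n /andP[/andP[n1 _] _].
  apply: le_trans (sinc2_lip _ _) _.
  - by rewrite mulr_gt0// ltr0n.
  - by rewrite ler_wpM2r ?(ltW h0)// ler_nat.
  have E : n.+1%:R * h = n%:R * h + h by rewrite -natr1 mulrDl mul1r.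
  rewrite ler_pM2l// /psi; have := p0 n; have := p0 n.+1; rewrite E => p1 p2.
  by rewrite le_eqVlt; apply/orP; left; apply/eqP; field; rewrite !gt_eqF.
rewrite -mulr_sumr; have [N1|N1] := leqP N 1; first by rewrite big_geq// mulr0.
rewrite telescope_sumr; last exact: ltnW.
rewrite -[leRHS]mulr1 ler_pM2l//; apply: (@le_trans _ _ (psi N)).
  by rewrite gerBl divr_ge0 ?(ltW (p0 1%N))// mulr_ge0// ltW.
by rewrite ler_pdivrMr// mul1r lerDr.
Qed.

(** Riemann's theorem: if the series of the u_n converges to [s], then the sums
    of the u_n (sin n h / (n h))^2 are close to [s] for small [h]. Summation by
    parts reduces it to the uniformly bounded variation of the weights. *)
Lemma riemann_summation (R : realType) (u : nat -> R) (s : R) :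
  \sum_(1 <= n < N) u n @[N --> \oo] --> s ->
  forall d, 0 < d -> exists2 r, 0 < r & forall h, 0 < h < r ->
    exists N0, forall N, (N0 <= N)%N ->
      `|\sum_(1 <= n < N) u n * sinc2 (n%:R * h) - s| <= d.
Proof.
move=> cv d d0; pose S N := \sum_(1 <= n < N) u n; pose rr N := S N - s.
have e0 : 0 < d / 34 by rewrite divr_gt0.
have [M0 _ HM0] : \forall n \near \oo, `|s - S n| <= d / 34 by exact: cvgr_dist_le.
(* The remainders are at most d / 34 from M on: the boundary term takes one
   such share and the variation of the weights takes 16, which leaves d / 2
   for the terms before M and for s (1 - w 1). *)
pose M := M0.+1.
have HM n : (M <= n)%N -> `|rr n| <= d / 34.
  by move=> Mn; rewrite distrC; apply: HM0; exact: ltnW.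
pose B := \sum_(n < M.+1) `|rr n| + d / 34.
have B0 : 0 <= B by rewrite addr_ge0 ?(ltW e0)// sumr_ge0.
have HB n : `|rr n| <= B.
  have [nM|/ltnW nM] := ltnP n M.+1.
    rewrite /B (bigD1 (Ordinal nM))//= -addrA lerDl addr_ge0 ?(ltW e0)//.
    exact: sumr_ge0.
  by apply: le_trans (HM _ nM) _; rewrite lerDr sumr_ge0.
pose Q := `|s| + 16 * B * M%:R + 1.
have Q0 : 0 < Q by rewrite ltr_wpDl// addr_ge0// mulr_ge0// mulr_ge0.
exists (Num.min 1 (d / 2 / Q)); first by rewrite lt_min ltr01 !divr_gt0.
move=> h; rewrite lt_min => /and3P[h0 h1 hQ].
exists M => N MN; pose w n := sinc2 (n%:R * h).
have N1 : (1 <= N)%N by exact: leq_trans MN.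
have nh0 n : (1 <= n)%N -> 0 < n%:R * h by move=> n1; rewrite mulr_gt0// ltr0n.
have -> : \sum_(1 <= n < N) u n * sinc2 (n%:R * h) =
    \sum_(1 <= n < N) (rr n.+1 - rr n) * w n.
  apply: eq_big_nat => n /andP[n1 _]; congr (_ * _).
  by rewrite /rr /S big_nat_recr//=; ring.
rewrite abel_sum//.
have -> : rr 1 = - s by rewrite /rr /S big_geq// sub0r.
have w1 : 0 <= 1 - w 1 <= h.
  have /andP[a b] := sinc2_near0 (nh0 1%N isT); rewrite /w a /=; apply: le_trans b _.
  by rewrite mul1r expr2 ger_pMl// ltW.
have step n : (1 <= n)%N -> `|w n - w n.+1| <= 16 * h.
  move=> n1; apply: le_trans (sinc2_lip (nh0 n n1) _) _.
    by rewrite ler_wpM2r ?(ltW h0)// ler_nat.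
  have E : n.+1%:R * h = n%:R * h + h by rewrite -natr1 mulrDl mul1r.
  rewrite ler_pM2l// E [_ + h]addrC addrK.
  rewrite ler_pdivrMr ?mulr_gt0 ?addr_gt0 ?nh0//.
  rewrite -[leLHS]mulr1; apply: ler_wpM2l; first exact: ltW.
  have := nh0 n n1 => nh; nra.
have sum1 : \sum_(1 <= n < M) `|rr n.+1 * (w n - w n.+1)| <= B * (16 * h) * M%:R.
  apply: (@le_trans _ _ (\sum_(1 <= n < M) B * (16 * h))).
    rewrite [leLHS]big_nat_cond [leRHS]big_nat_cond.
    apply: ler_sum => n /andP[/andP[n1 _] _]; rewrite normrM.
    by apply: ler_pM => //; exact: step.
  rewrite sumr_const_nat -[leLHS]mulr_natr; apply: ler_wpM2l.
    by rewrite !mulr_ge0// ltW.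
  by rewrite ler_nat leq_subr.
have sum2 : \sum_(M <= n < N) `|rr n.+1 * (w n - w n.+1)| <= d / 34 * 16.
  apply: (@le_trans _ _ (d / 34 * \sum_(M <= n < N) `|w n - w n.+1|)).
    rewrite mulr_sumr [leLHS]big_nat_cond [leRHS]big_nat_cond.
    apply: ler_sum => n /andP[/andP[n1 _] _]; rewrite normrM.
    by apply: ler_wpM2r => //; apply: HM; exact: leqW.
  apply: ler_wpM2l; first exact: ltW.
  apply: le_trans (sinc2_variation N h0).
  by rewrite [leRHS](@big_cat_nat _ _ _ M)//= lerDr sumr_ge0.
have sumT : `|\sum_(1 <= n < N) rr n.+1 * (w n - w n.+1)| <= B * (16 * h) * M%:R + d /
  34 * 16.
  apply: le_trans (ler_norm_sum _ _ _) _.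
  by rewrite (@big_cat_nat _ _ _ M)//=; exact: lerD.
have rN : `|rr N * w N| <= d / 34.
  rewrite normrM -[leRHS]mulr1; apply: ler_pM => //; first exact: HM.
  by have /andP[a b] := sinc2_le1 (nh0 N N1); rewrite ger0_norm.
have sw : `|s * (1 - w 1)| <= `|s| * h.
  rewrite normrM; apply: ler_wpM2l => //; case/andP: w1 => a b.
  by rewrite ger0_norm.
set T := \sum_(_ <= _ < _) _ in sumT *.
have -> : rr N * w N - - s * w 1 + T - s = rr N * w N - s * (1 - w 1) + T by ring.
apply: le_trans (ler_normD _ _) _; apply: le_trans (lerD (ler_normB _ _) (lexx _)) _.
have hq : h * Q <= d / 2 by rewrite -ler_pdivlMr// ltW.
have hqE : h * Q = `|s| * h + B * (16 * h) * M%:R + h by rewrite /Q; ring.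
rewrite hqE in hq; lra.
Qed.

(** * The series integrated twice *)

(** A sequence whose increments after [M] are O(1/M) converges at that rate. *)
Lemma cvg_of_tail (R : realType) (S : nat -> R) (B : R) :
  (forall M N, (1 <= M)%N -> (M <= N)%N -> `|S N - S M| <= B / M%:R) ->
  S @ \oo --> limn S /\ forall M, (1 <= M)%N -> `|limn S - S M| <= B / M%:R.
Proof.
move=> H.
have B0 : 0 <= B.
  by have := H 1%N 1%N isT isT; rewrite subrr normr0 divr1.
have cS : cvgn S.
  apply/cauchy_cvgP/cauchy_exP => e e0.
  pose M := (Num.truncn (B / e)).+1.
  have M0 : (0 : R) < M%:R by rewrite ltr0n.
  exists (S M); exists M => // N /= MN; rewrite /ball /= distrC.
  apply: le_lt_trans (H M N isT MN) _.
  by rewrite ltr_pdivrMr// mulrC -ltr_pdivrMr//; exact: truncnS_gt.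
split=> // M M1.
apply: (@cvgr_to_le _ \oo _ _ (fun N => `|S N - S M|)).
  by apply: cvg_norm; apply: cvgB => //; exact: cvg_cst.
by exists M => // N /= MN; exact: H.
Qed.

(** Partial sums of the series integrated twice, term by term. *)
Definition Fpart (R : realType) (a : nat -> R) (th : R) (N : nat) (x : R) : R :=
  \sum_(1 <= n < N) - (a n / n%:R ^+ 2) * cos (n%:R * x - th).

(** Their limit, which exists for bounded [a]. *)
Definition Fser (R : realType) (a : nat -> R) (th : R) (x : R) : R :=
  limn (fun N => Fpart a th N x).

Lemma sum_invsq_le (R : realType) (M N : nat) : (1 <= M)%N -> (M <= N)%N ->
  \sum_(M <= n < N) (n%:R ^+ 2)^-1 <= 2 / M%:R :> R.
Proof.
move=> M1 MN.
apply: (@le_trans _ _ (\sum_(M <= n < N) (- 2 / n.+1%:R - - 2 / n%:R))).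
  rewrite [leLHS]big_nat_cond [leRHS]big_nat_cond.
  apply: ler_sum => n /andP[/andP[Mn _] _].
  have n1 : (1 : R) <= n%:R by rewrite ler1n; exact: leq_trans Mn.
  rewrite -[n.+1%:R]natr1; set z := n%:R in n1 *.
  have z0 : 0 < z by exact: lt_le_trans n1.
  have -> : - 2 / (z + 1) - - 2 / z = 2 / (z * (z + 1)).
    by field; rewrite !gt_eqF// addr_gt0.
  rewrite ler_pdivlMr ?mulr_gt0 ?addr_gt0// mulrC ler_pdivrMr ?exprn_gt0//.
  nra.
rewrite telescope_sumr// !mulNr opprK addrC gerBl.
by rewrite divr_ge0.
Qed.

Lemma Fpart_tail (R : realType) (a : nat -> R) (A th x : R) (M N : nat) :
  (forall n, (1 <= n)%N -> `|a n| <= A) -> (1 <= M)%N -> (M <= N)%N ->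
  `|Fpart a th N x - Fpart a th M x| <= 2 * A / M%:R.
Proof.
move=> aA M1 MN; rewrite /Fpart (@big_cat_nat _ _ _ M _ N)//= addrAC subrr add0r.
apply: le_trans (ler_norm_sum _ _ _) _.
apply: (@le_trans _ _ (A * \sum_(M <= n < N) (n%:R ^+ 2)^-1)).
  rewrite mulr_sumr [leLHS]big_nat_cond [leRHS]big_nat_cond.
  apply: ler_sum => n /andP[/andP[Mn _] _].
  rewrite normrM normrN normrM normfV [`|n%:R ^+ 2|]ger0_norm ?sqr_ge0//.
  rewrite -[leRHS]mulr1; apply: ler_pM;
    [by rewrite mulr_ge0// invr_ge0 sqr_ge0|exact: normr_ge0| |exact: cos_max].
  apply: ler_wpM2r; first by rewrite invr_ge0 sqr_ge0.
  by apply: aA; exact: leq_trans Mn.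
have A0 : 0 <= A by apply: le_trans (aA 1%N isT).
by rewrite mulrAC mulrC; apply: ler_wpM2r => //; exact: sum_invsq_le.
Qed.

Lemma Fser_cvg (R : realType) (a : nat -> R) (A th x : R) :
  (forall n, (1 <= n)%N -> `|a n| <= A) ->
  Fpart a th N x @[N --> \oo] --> Fser a th x.
Proof.
by move=> aA; have [] := @cvg_of_tail _ (fun N => Fpart a th N x) (2 * A)
  (fun M N => @Fpart_tail _ _ _ th x M N aA).
Qed.

Lemma Fser_tail (R : realType) (a : nat -> R) (A th x : R) (M : nat) :
  (forall n, (1 <= n)%N -> `|a n| <= A) -> (1 <= M)%N ->
  `|Fser a th x - Fpart a th M x| <= 2 * A / M%:R.
Proof.
move=> aA M1; have [_ ] := @cvg_of_tail _ (fun N => Fpart a th N x) (2 * A)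
  (fun M N => @Fpart_tail _ _ _ th x M N aA).
exact.
Qed.

Lemma continuous_cosMB (R : realType) (c th : R) :
  continuous (fun x => cos (c * x - th)).
Proof.
move=> x; apply: (@continuous_comp _ _ _ (fun x => c * x - th) cos).
  by apply: cvgB; [apply: cvgM => //; exact: cvg_cst|exact: cvg_cst].
exact: continuous_cos.
Qed.

Lemma continuous_sum_nat (R : realType) (f : nat -> R -> R) (m n : nat) :
  (forall i, continuous (f i)) -> continuous (fun x => \sum_(m <= i < n) f i x).
Proof.
move=> cf; elim: n => [|n IH].
  rewrite (_ : (fun x => _) = cst 0); first exact: cst_continuous.
  by apply/funext => x; rewrite big_geq.
have [mn|mn] := leqP m n.
  rewrite (_ : (fun x => _) = (fun x => \sum_(m <= i < n) f i x + f n x)).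
    by move=> x; apply: cvgD; [exact: IH|exact: cf].
  by apply/funext => x; rewrite big_nat_recr.
rewrite (_ : (fun x => _) = cst 0); first exact: cst_continuous.
by apply/funext => x; rewrite big_geq.
Qed.

Lemma continuous_Fpart (R : realType) (a : nat -> R) (th : R) N :
  continuous (Fpart a th N).
Proof.
apply: continuous_sum_nat => n x; apply: cvgM; first exact: cvg_cst.
exact: continuous_cosMB.
Qed.

Lemma continuous_Fser (R : realType) (a : nat -> R) (A th : R) :
  (forall n, (1 <= n)%N -> `|a n| <= A) -> continuous (Fser a th).
Proof.
move=> aA x; apply/cvgrPdist_le => e e0.
have A0 : 0 <= A by apply: le_trans (aA 1%N isT).
pose M := (Num.truncn (2 * A / (e / 3))).+1.
have M0 : (0 : R) < M%:R by rewrite ltr0n.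
have e3 : 0 < e / 3 by rewrite divr_gt0.
have AM : 2 * A / M%:R <= e / 3.
  by rewrite ler_pdivrMr// [_ * M%:R]mulrC -ler_pdivrMr//; apply: ltW; exact: truncnS_gt.
have cM := @continuous_Fpart _ a th M x.
near=> y.
have h1 : `|Fpart a th M x - Fpart a th M y| <= e / 3.
  by near: y; exact: cvgr_dist_le.
have h2 := le_trans (@Fser_tail _ a A th x M aA isT) AM.
have h3 := le_trans (@Fser_tail _ a A th y M aA isT) AM.
move: h1 h2 h3; rewrite !ler_norml => /andP[? ?] /andP[? ?] /andP[? ?].
by apply/andP; split; lra.
Unshelve. all: by end_near. Qed.

Lemma cos_2pi_nat (R : realType) (n : nat) (x : R) : cos (n%:R * (pi *+ 2) + x) = cos x.
Proof. by rewrite mulr_natl addrC (periodicn (@cosD2pi R)). Qed.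

Lemma Fser_2pi (R : realType) (a : nat -> R) (th : R) :
  Fser a th (pi *+ 2) = Fser a th 0.
Proof.
rewrite /Fser; congr (limn _); apply/funext => N.
by apply: eq_bigr => n _; rewrite cos_2pi_nat mulr0 sub0r.
Qed.

Lemma cos_sd (R : realType) (y t : R) :
  cos (y + t) + cos (y - t) - 2 * cos y = - (4 * sin (t / 2) ^+ 2 * cos y).
Proof.
have := one_minus_cos t; rewrite cosD cosB => h.
have {1 2}-> : cos t = 1 - 2 * sin (t / 2) ^+ 2 by rewrite -h; ring.
ring.
Qed.

(** The second difference multiplies the terms of the original series by the
    weights of Riemann's method. *)
Lemma Fpart_sd (R : realType) (a : nat -> R) (th x h : R) (N : nat) : h != 0 ->
  Fpart a th N (x + h) + Fpart a th N (x - h) - 2 * Fpart a th N x =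
  h ^+ 2 * \sum_(1 <= n < N) a n * cos (n%:R * x - th) * sinc2 (n%:R * (h / 2)).
Proof.
move=> h0; rewrite /Fpart !mulr_sumr -big_split /= -sumrB.
rewrite [LHS]big_nat_cond [RHS]big_nat_cond.
apply: eq_bigr => n /andP[/andP[n1 _] _].
have n0 : (n%:R : R) != 0 by rewrite pnatr_eq0 -lt0n.
have -> : n%:R * (x + h) - th = (n%:R * x - th) + n%:R * h by ring.
have -> : n%:R * (x - h) - th = (n%:R * x - th) - n%:R * h by ring.
set y := n%:R * x - th.
have := cos_sd y (n%:R * h).
rewrite /sinc2 [n%:R * (h / 2)]mulrA; set s := sin _; set c1 := cos (y + _);
  set c2 := cos (y - _).
move=> E; have -> : c1 = - (4 * s ^+ 2 * cos y) - c2 + 2 * cos y by rewrite -E; ring.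
by field; rewrite n0 h0.
Qed.

(** Where the series of the a_n cos (n x - th) converges, its sum is the
    symmetric second derivative of [Fser]. *)
Lemma Fser_sd (R : realType) (a : nat -> R) (A th x s : R) :
  (forall n, (1 <= n)%N -> `|a n| <= A) ->
  \sum_(1 <= n < N) a n * cos (n%:R * x - th) @[N --> \oo] --> s ->
  forall d, 0 < d -> exists2 r, 0 < r & forall h, 0 < h < r ->
    `|Fser a th (x + h) + Fser a th (x - h) - 2 * Fser a th x - h ^+ 2 * s| <= h ^+ 2 * d.
Proof.
move=> aA cv d d0; have [r r0 H] := riemann_summation cv d0.
exists r => // h /andP[h0 hr].
have [|N0 HN] := H (h / 2); first by apply/andP; split; lra.
have cF z := @Fser_cvg _ a A th z aA.
apply: (@cvgr_to_le _ \oo _ _ (fun N => `|Fpart a th N (x + h) + Fpart a th N (x - h)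
   - 2 * Fpart a th N x - h ^+ 2 * s|)).
  apply: cvg_norm; apply: cvgB; last exact: cvg_cst.
  by apply: cvgB; [apply: cvgD|apply: cvgM => //; exact: cvg_cst].
exists N0 => // N /= N0N; rewrite Fpart_sd ?gt_eqF// -mulrBr normrM.
rewrite ger0_norm ?sqr_ge0//; apply: ler_wpM2l; first exact: sqr_ge0.
exact: HN.
Qed.

(** * The coefficients are Fourier coefficients *)

(** Fubini's theorem for a bounded kernel and an integrable function. *)
Lemma Rintegral_exchange d (T : measurableType d) (R : realType)
    (m : {finite_measure set T -> \bar R}) (K : T -> T -> R) (f : T -> R) (B : R) :
  measurable_fun [set: T * T] (fun z => K z.1 z.2) ->
  (forall x y, `|K x y| <= B) -> m.-integrable [set: T] (EFin \o f) ->
  \int[m]_x (\int[m]_y (K x y * f y)) = \int[m]_y ((\int[m]_x K x y) * f y).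
Proof.
move=> mK KB intf.
have mf : measurable_fun [set: T] f by apply/measurable_EFinP; exact: measurable_int intf.
pose G (z : T * T) : \bar R := (K z.1 z.2 * f z.2)%:E.
have mG : measurable_fun [set: T * T] G.
  apply/measurable_EFinP; apply: measurable_funM => //.
  exact: measurableT_comp mf measurable_snd.
have mK1 x : measurable_fun [set: T] (K x).
  exact: (measurableT_comp mK (pair1_measurable x)).
have mK2 y : measurable_fun [set: T] (fun x => K x y).
  exact: (measurableT_comp mK (pair2_measurable y)).
have Kint y : m.-integrable [set: T] (EFin \o (fun x => K x y)).
  apply: measurable_bounded_integrable => //.
    by rewrite -ge0_fin_numE// fin_num_measure.
  exists B; split; first by rewrite num_real.
  by move=> r Br x _ /=; apply: le_trans (KB x y) (ltW Br).
have iG : (m \x m)%E.-integrable [set: T * T] G.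
  apply/integrable21ltyP => //=.
  pose C := B * fine (m [set: T]).
  have B0 (y : T) : 0 <= B := le_trans (normr_ge0 _) (KB y y).
  apply: (@le_lt_trans _ _ (\int[m]_y (C * `|f y|)%:E)%E).
    apply: ge0_le_integral => //.
    - by move=> y _; apply: integral_ge0.
    - apply: (@measurable_fun_fubini_tonelli_G _ _ _ _ _ m (abse \o G)).
        exact: measurableT_comp.
      by move=> z; exact: abse_ge0.
    - apply/measurable_EFinP; apply: measurable_funM => //.
      exact: measurableT_comp.
    - move=> y _.
      apply: (@le_trans _ _ (\int[m]_x (B * `|f y|)%:E)%E).
        apply: ge0_le_integral => //.
        + apply/measurable_EFinP; apply: measurableT_comp => //.
          by apply: measurable_funM => //; exact: mK2.
        + by move=> x _; rewrite lee_fin normrM ler_wpM2r.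
      have mT : m [set: T] = (fine (m [set: T]))%:E by rewrite fineK// fin_num_measure.
      by rewrite integral_cst// [X in (_ * X)%E]mT -EFinM lee_fin /C mulrAC.
  under eq_integral do rewrite EFinM.
  have [->|/set0P[y _]] := eqVneq [set: T] set0; first by rewrite integral_set0 ltry.
  rewrite ge0_integralZl//.
  - rewrite lte_mul_pinfty//.
    + by rewrite lee_fin mulr_ge0 ?(B0 y)// fine_ge0.
    + by case/integrableP: intf.
  - by apply/measurable_EFinP; exact: measurableT_comp.
  - by rewrite lee_fin mulr_ge0 ?(B0 y)// fine_ge0.
have Kf x : m.-integrable [set: T] (EFin \o (fun y => K x y * f y)).
  rewrite (_ : EFin \o _ = (EFin \o K x) \* (EFin \o f))%E//.
  apply: integrableMr => //.
  exists B; split; first by rewrite num_real.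
  by move=> r Br y _ /=; apply: le_trans (KB x y) (ltW Br).
have := Fubini iG; rewrite /G /= => E.
rewrite /Rintegral; congr fine; transitivity (\int[m]_x \int[m]_y (K x y * f y)%:E)%E.
  apply: eq_integral => x _; rewrite fineK//.
  exact: integrable_fin_num (Kf x).
rewrite E; apply: eq_integral => y _.
rewrite EFinM fineK; last exact: integrable_fin_num (Kint y).
by rewrite -integralZr//; exact: Kint.
Qed.

(** The chord of [Fser] over a period is constant. *)
Lemma series_green_repr (R : realType) (a : nat -> R) (A th : R) (f : R -> R) :
  measurable_fun [set: R] f ->
  (@lebesgue_measure R).-integrable `[0%R, pi *+ 2] (EFin \o f) ->
  (forall n, (1 <= n)%N -> `|a n| <= A) ->
  (forall x, 0 < x < pi *+ 2 ->
     \sum_(1 <= n < N) a n * cos (n%:R * x - th) @[N --> \oo] --> f x) ->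
  forall x, 0 <= x <= pi *+ 2 -> Fser a th x = Fser a th 0 -
    \int[lebesgue_measure]_(y in `[0%R, pi *+ 2]) (green (pi *+ 2) x y * f y).
Proof.
move=> mf intf aA cv x xD.
have cF : {within `[0%R, (pi *+ 2 : R)], continuous (Fser a th)}.
  apply: continuous_subspaceT. exact: (continuous_Fser aA).
have L0 : (pi *+ 2 : R) != 0 by rewrite gt_eqF// twopi_gt0.
have := green_repr (twopi_gt0 R) mf intf cF _ xD => ->.
  congr (_ - _); rewrite /chord Fser_2pi -mulrDr subrK mulfK//.
move=> z /cv cvz; exact: (Fser_sd aA cvz).
Qed.

Lemma is_derive_sin_affine (R : realType) (c th x : R) : c != 0 ->
  is_derive x 1 (fun x => sin (c * x - th) / c) (cos (c * x - th)).
Proof.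
move=> c0.
have dg : is_derive x 1 (fun x : R => c * x - th) c.
  apply: (@is_derive_quadratic _ _ _ _ 0) => h _.
  by rewrite mul0r (_ : _ - _ = 0) ?normr0//; ring.
have dh : is_derive x 1 (sin \o (fun x : R => c * x - th)) (cos (c * x - th) * c).
  exact: is_derive1_comp.
rewrite (_ : (fun x => _) = c^-1 *: (sin \o (fun x : R => c * x - th))); last first.
  by apply/funext => z /=; rewrite mulrC.
rewrite (_ : cos _ = c^-1 *: (cos (c * x - th) * c)); first exact: is_deriveZ.
by rewrite -[RHS]/(c^-1 * (_ * c)) mulrCA mulVf// mulr1.
Qed.

Lemma Rintegral_cos (R : realType) (c th : R) : c != 0 ->
  sin (c * (pi *+ 2) - th) = sin (- th) ->
  \int[pm R]_x cos (c * x - th) = 0.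
Proof.
move=> c0 E; have := @FTC_period R (fun x => sin (c * x - th) / c) _
  (@continuous_cosMB R c th) (fun x => @is_derive_sin_affine R c th x c0).
by move=> ->; rewrite E mulr0 sub0r subrr.
Qed.

Lemma sin_2pi_nat (R : realType) (n : nat) (x : R) : sin (n%:R * (pi *+ 2) + x) = sin x.
Proof. by rewrite mulr_natl addrC (periodicn (@sinD2pi R)). Qed.

Lemma Rintegral_cos_cos (R : realType) (n k : nat) (th : R) :
  (1 <= n)%N -> (1 <= k)%N ->
  \int[pm R]_x (cos (n%:R * x - th) * cos (k%:R * x - th)) =
  if n == k then pi else 0.
Proof.
move=> n1 k1.
have E (x : R) : cos (n%:R * x - th) * cos (k%:R * x - th) =
    2^-1 * cos ((n + k)%:R * x - th *+ 2) + 2^-1 * cos ((n%:R - k%:R) * x - 0).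
  have -> : (n + k)%:R * x - th *+ 2 = (n%:R * x - th) + (k%:R * x - th).
    by rewrite natrD mulr2n; ring.
  have -> : (n%:R - k%:R) * x - 0 = (n%:R * x - th) - (k%:R * x - th) by ring.
  by move: (n%:R * x - th) (k%:R * x - th) => u v; rewrite cosD cosB; field.
have int c th' : (pm R).-integrable [set: R] (EFin \o (fun x => cos (c * x - th'))).
  by apply: integrable_period_cont; exact: continuous_cosMB.
have int2 c th' : (pm R).-integrable [set: R] (EFin \o (fun x => 2^-1 * cos (c * x - th'))).
  apply: integrable_period_cont => x; apply: cvgM; first exact: cvg_cst.
  exact: continuous_cosMB.
under eq_Rintegral do rewrite E.
rewrite RintegralD// !RintegralZl//.
rewrite [X in _ * X + _]Rintegral_cos ?mulr0 ?add0r; last 2 first.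
- by rewrite pnatr_eq0 addn_eq0 negb_and -!lt0n n1.
- by rewrite sin_2pi_nat.
have [->|nk] := eqVneq n k.
  under eq_Rintegral do rewrite subrr mul0r subr0 cos0.
  rewrite Rintegral_cst// mul1r.
  have -> : fine (pm R [set: R]) = pi *+ 2 by have := period_measureT R => /(congr1 fine).
  by rewrite -mulr_natl; field.
rewrite Rintegral_cos ?mulr0//.
  by rewrite subr_eq0 eqr_nat.
rewrite subr0 oppr0 sin0 mulrBl sin_2pi_nat sinN.
by rewrite -[_ * _]addr0 sin_2pi_nat sin0 oppr0.
Qed.

Lemma Rintegral_Fser_cos (R : realType) (a : nat -> R) (A th : R) (k : nat) :
  (forall n, (1 <= n)%N -> `|a n| <= A) -> (1 <= k)%N ->
  \int[pm R]_x (Fser a th x * cos (k%:R * x - th)) = - (pi * a k / k%:R ^+ 2).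
Proof.
move=> aA k1.
have ccos c : continuous (fun x : R => cos (c * x - th)) by exact: continuous_cosMB.
have part N : (k < N)%N ->
    \int[pm R]_x (Fpart a th N x * cos (k%:R * x - th)) = - (pi * a k / k%:R ^+ 2).
  move=> kN.
  have step M : \int[pm R]_x (Fpart a th M x * cos (k%:R * x - th)) =
      \sum_(1 <= n < M) - (a n / n%:R ^+ 2) * (if n == k then pi else 0).
    elim: M => [|M IH].
      under eq_Rintegral do rewrite /Fpart big_geq// mul0r.
      by rewrite big_geq// Rintegral_cst// mul0r.
    have [M1|M1] := leqP M 0.
      under eq_Rintegral do rewrite /Fpart big_geq// mul0r.
      by rewrite big_geq// Rintegral_cst// mul0r.
    rewrite big_nat_recr//= -IH -(Rintegral_cos_cos th M1 k1) -RintegralZl//; last first.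
      by apply: integrable_period_cont => x; apply: cvgM; exact: ccos.
    rewrite -RintegralD//.
    - apply: eq_Rintegral => x _; rewrite {1}/Fpart big_nat_recr//= mulrDl.
      by rewrite mulrA.
    - apply: integrable_period_cont => x; apply: cvgM; last exact: ccos.
      exact: continuous_Fpart.
    - apply: integrable_period_cont => x; apply: cvgM; first exact: cvg_cst.
      by apply: cvgM; exact: ccos.
  rewrite step (bigD1_seq k)//= ?iota_uniq ?mem_index_iota ?k1//.
  rewrite eqxx big1 ?addr0; first by rewrite mulNr mulrAC [a k * _]mulrC.
  by move=> i /negbTE ->; rewrite mulr0.
apply/eqP; rewrite -subr_eq0 -normr_le0; apply/ler_addgt0Pr => e e0; rewrite add0r.
have A0 : 0 <= A by apply: le_trans (aA 1%N isT).
pose M := (maxn k (Num.truncn (2 * A * (pi *+ 2) / e))).+1.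
have M0 : (0 : R) < M%:R by rewrite ltr0n.
rewrite -(part M); last by rewrite ltnS leq_maxl.
rewrite -RintegralB//; last 2 first.
- apply: integrable_period_cont => x; apply: cvgM; last exact: ccos.
  exact: (continuous_Fser aA).
- apply: integrable_period_cont => x; apply: cvgM; last exact: ccos.
  exact: continuous_Fpart.
have ci : continuous (fun x => Fser a th x * cos (k%:R * x - th) -
    Fpart a th M x * cos (k%:R * x - th)).
  move=> x; apply: cvgB; apply: cvgM; try exact: ccos.
    exact: (continuous_Fser aA).
  exact: continuous_Fpart.
apply: le_trans (le_normr_Rintegral _ _) _ => //; first exact: integrable_period_cont.
apply: (@le_trans _ _ (\int[pm R]_x (2 * A / M%:R))).
  apply: le_Rintegral => //.
  - apply: (@integrable_period_cont _ (fun x => `|_|)) => x.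
    by apply: cvg_norm; exact: ci.
  - by apply: integrable_period_cont => x; exact: cvg_cst.
  - move=> x _; rewrite -mulrBl normrM -[leRHS]mulr1; apply: ler_pM => //.
      exact: Fser_tail.
    exact: cos_max.
rewrite Rintegral_cst//.
have -> : fine (pm R [set: R]) = pi *+ 2 by have := period_measureT R => /(congr1 fine).
rewrite mulrAC ler_pdivrMr// [e * _]mulrC -ler_pdivrMr//; apply/ltW.
apply: lt_le_trans (truncnS_gt _) _.
by rewrite ler_nat ltnS leq_maxr.
Qed.

Lemma integrable_period_leb (R : realType) (f : R -> R) :
  (pm R).-integrable [set: R] (EFin \o f) ->
  (@lebesgue_measure R).-integrable `[0%R, pi *+ 2] (EFin \o f).
Proof.
move=> /integrableP[mf fi].
have mf' : measurable_fun [set: R] f by exact/measurable_EFinP.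
apply/integrableP; split.
  by apply/measurable_EFinP; exact: measurable_funTS mf'.
move: fi; rewrite ge0_integral_periodE//.
by apply: measurableT_comp => //; exact/measurable_EFinP.
Qed.

Lemma eq_Rintegral_period (R : realType) (f g : R -> R) :
  measurable_fun [set: R] f -> measurable_fun [set: R] g ->
  (forall x, 0 <= x <= pi *+ 2 -> f x = g x) ->
  \int[pm R]_x f x = \int[pm R]_x g x.
Proof.
move=> mf mg fg; rewrite !Rintegral_periodE//; apply: eq_Rintegral => x.
by rewrite inE /period /= in_itv /= => /fg.
Qed.

(** Projection of the line onto [0, L]. It extends the Green function to a
    bounded kernel on the plane. *)
Definition clip (R : realType) (L z : R) : R := Num.max 0 (Num.min z L).

Lemma clip_itv (R : realType) (L z : R) : 0 <= L -> 0 <= clip L z <= L.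
Proof. by move=> L0; rewrite /clip le_max lexx /= ge_max L0 ge_min lexx orbT. Qed.

Lemma clip_id (R : realType) (L z : R) : 0 <= z <= L -> clip L z = z.
Proof. by move=> /andP[z0 zL]; rewrite /clip min_l// max_r. Qed.

Lemma measurable_clip (R : realType) (L : R) : measurable_fun [set: R] (clip L).
Proof. by apply: measurable_maxr => //; exact: measurable_minr. Qed.

(** The series reduced to its [k]-th term. *)
Lemma Fser_delta (R : realType) (th x : R) (k : nat) : (1 <= k)%N ->
  Fser (fun n => (n == k)%:R) th x = - (cos (k%:R * x - th) / k%:R ^+ 2).
Proof.
move=> k1; apply: cvg_lim => //; apply: cvg_near_cst; exists k.+1 => // N /= kN.
rewrite /Fpart (bigD1_seq k)//= ?iota_uniq ?mem_index_iota ?k1//.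
rewrite eqxx big1 ?addr0; first by rewrite mulNr mulrAC mul1r.
by move=> i /negbTE ->; rewrite mul0r oppr0 mul0r.
Qed.

(** The potential of a cosine, obtained from [series_green_repr] applied to a
    series with a single term. *)
Lemma green_cos (R : realType) (th x : R) (k : nat) : (1 <= k)%N ->
  0 <= x <= pi *+ 2 ->
  \int[lebesgue_measure]_(y in `[0%R, pi *+ 2])
    (green (pi *+ 2) x y * cos (k%:R * y - th)) =
  (cos (k%:R * x - th) - cos th) / k%:R ^+ 2.
Proof.
move=> k1 xD.
have cc : continuous (fun y : R => cos (k%:R * y - th)) by exact: continuous_cosMB.
have mc := continuous_measurable_fun cc.
have ic := integrable_period_leb (integrable_period_cont cc).
have bd n : (1 <= n)%N -> `|(n == k)%:R : R| <= 1 by move=> _; case: (n == k);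
  rewrite ?normr1 ?normr0.
have := series_green_repr mc ic bd _ xD.
move=> /(_ th); rewrite !Fser_delta// mulr0 sub0r cosN => H.
rewrite mulrBl; apply/eqP; rewrite -subr_eq0 -[X in X == 0]opprK oppr_eq0 opprB; apply/eqP.
rewrite [X in X - _](_ : _ = cos (k%:R * x - th) / k%:R ^+ 2 - cos th / k%:R ^+ 2)//.
apply/eqP; rewrite subr_eq0; apply/eqP.
set I := Rintegral _ _ _ in H *; have {}H := H _.
suff : - (cos (k%:R * x - th) / k%:R ^+ 2) = - (cos th / k%:R ^+ 2) - I by lra.
apply: H => z _; apply: cvg_near_cst; exists k.+1 => // N /= kN.
rewrite (bigD1_seq k)//= ?iota_uniq ?mem_index_iota ?k1//.
rewrite eqxx big1 ?addr0 ?mul1r//.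
by move=> i /negbTE ->; rewrite mul0r.
Qed.

(** The coefficients of a series with bounded coefficients and integrable sum
    are the Fourier coefficients of its sum, up to the term cos th times the
    integral of [f]. That term vanishes too, which is established in the proof
    of [coeff_bound] from the fact that the coefficients tend to 0. *)
Lemma fourier_coeff (R : realType) (a : nat -> R) (A th : R) (f : R -> R) (k : nat) :
  (pm R).-integrable [set: R] (EFin \o f) ->
  (forall n, (1 <= n)%N -> `|a n| <= A) ->
  (forall x, 0 < x < pi *+ 2 ->
     \sum_(1 <= n < N) a n * cos (n%:R * x - th) @[N --> \oo] --> f x) ->
  (1 <= k)%N ->
  \int[pm R]_y ((cos (k%:R * y - th) - cos th) * f y) = pi * a k.
Proof.
move=> ipf aA cv k1; pose L : R := pi *+ 2; have L0 : 0 < L := twopi_gt0 R.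
have L0' : L != 0 by rewrite gt_eqF.
have mf : measurable_fun [set: R] f by apply/measurable_EFinP; exact: measurable_int ipf.
have intf := integrable_period_leb ipf.
pose e (x : R) := cos (k%:R * x - th).
have ce : continuous e by exact: continuous_cosMB.
have me := continuous_measurable_fun ce.
have clipD z := clip_itv z (ltW L0).
(* The double integral of green(x, y) f(y) e(x) is evaluated in both orders:
   over y first it gives F, over x first it gives the potential of the cosine
   e. *)
pose K x y := green L (clip L x) (clip L y) * e x.
have mclip := @measurable_clip R L.
have mg : measurable_fun [set: R * R] (fun z => green L (clip L z.1) (clip L z.2)).
  have m1 : measurable_fun [set: R * R] (fun z => clip L z.1).
    exact: measurableT_comp mclip measurable_fst.
  have m2 : measurable_fun [set: R * R] (fun z => clip L z.2).
    exact: measurableT_comp mclip measurable_snd.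
  apply: measurable_funB.
    by apply: measurable_funM => //; apply: measurable_funM => //; exact: measurable_funB.
  by apply: measurable_maxr => //; exact: measurable_funB.
have mK : measurable_fun [set: R * R] (fun z => K z.1 z.2).
  by apply: measurable_funM => //; exact: measurableT_comp me measurable_fst.
have KL x y : `|K x y| <= L.
  rewrite normrM -[leRHS]mulr1; apply: ler_pM => //; last exact: cos_max.
  by rewrite ger0_norm ?green_ge0// green_le.
have := @Rintegral_exchange _ (measurableTypeR R) R (pm R) K f L mK KL ipf.
have mgx (x : R) : measurable_fun [set: R] (fun y => green L x (clip L y)).
  exact: measurableT_comp (continuous_measurable_fun (@continuous_green R L x)) mclip.
have inner1 x : \int[pm R]_y (K x y * f y) =
    e x * (Fser a th 0 - Fser a th (clip L x)).
  rewrite (series_green_repr mf intf aA cv (clipD x)) opprB addrC subrK.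
  rewrite Rintegral_periodE; last first.
    by apply: measurable_funM => //; apply: measurable_funM => //; exact: mgx.
  rewrite -RintegralZl//; last first.
    by apply: integrable_contM => //; exact: continuous_green.
  apply: eq_Rintegral => y; rewrite inE /period /= in_itv /= => yD.
  by rewrite /K (clip_id yD); ring.
have inner2 y : \int[pm R]_x K x y = (e (clip L y) - cos th) / k%:R ^+ 2.
  rewrite /e -(green_cos th k1 (clipD y)) Rintegral_periodE; last first.
    apply: measurable_funM => //.
    by under eq_fun do rewrite greenC//; exact: mgx.
  apply: eq_Rintegral => x; rewrite inE /period /= in_itv /= => xD.
  by rewrite /K (clip_id xD) greenC.
under eq_Rintegral do rewrite inner1.
under [X in _ = X -> _]eq_Rintegral do rewrite inner2.
have cF := continuous_Fser (th := th) aA.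
have mF := continuous_measurable_fun cF.
have -> : \int[pm R]_x (e x * (Fser a th 0 - Fser a th (clip L x))) =
    \int[pm R]_x (e x * Fser a th 0 - Fser a th x * e x).
  apply: eq_Rintegral_period => [| |x xD]; last by rewrite clip_id//; ring.
    apply: measurable_funM => //; apply: measurable_funB => //.
    exact: measurableT_comp mF mclip.
  by apply: measurable_funB; apply: measurable_funM.
have -> : \int[pm R]_y ((e (clip L y) - cos th) / k%:R ^+ 2 * f y) =
    \int[pm R]_y ((k%:R ^+ 2)^-1 * ((e y - cos th) * f y)).
  apply: eq_Rintegral_period => [| |y yD]; last by rewrite clip_id//; ring.
    apply: measurable_funM => //; apply: measurable_funM => //.
    by apply: measurable_funB => //; exact: measurableT_comp me mclip.
  by apply: measurable_funM => //; apply: measurable_funM => //; exact: measurable_funB.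
have ie := integrable_period_cont ce.
have iFe : (pm R).-integrable [set: R] (EFin \o (fun x => Fser a th x * e x)).
  by apply: integrable_period_cont => x; apply: cvgM; [exact: cF|exact: ce].
have ie0 : (pm R).-integrable [set: R] (EFin \o (fun x => e x * Fser a th 0)).
  by apply: integrable_period_cont => x; apply: cvgM; [exact: ce|exact: cvg_cst].
rewrite RintegralB// RintegralZr// (Rintegral_Fser_cos _ aA k1).
rewrite Rintegral_cos ?mul0r ?sub0r ?opprK; last 2 first.
- by rewrite pnatr_eq0 -lt0n.
- by rewrite sin_2pi_nat.
rewrite RintegralZl//; last first.
  apply: integrable_periodE.
    by apply: measurable_funM => //; exact: measurable_funB.
  apply: integrable_contM => // x; apply: cvgB; [exact: ce|exact: cvg_cst].
have k0 : (k%:R : R) ^+ 2 != 0 by rewrite expf_neq0// pnatr_eq0 -lt0n.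
move=> E; transitivity (k%:R ^+ 2 * (k%:R ^- 2 * \int[pm R]_x ((e x - cos th) * f x))).
  by rewrite mulrA mulfV// mul1r.
rewrite -E; field.
by move: k0; rewrite expf_eq0.
Qed.

(** * Summation by parts against cosines, and powers of |sin (x/2)| + h *)

(** The distance to the points of 2 pi Z, up to constant factors. *)
Definition halfsin (R : realType) (x : R) : R := `|sin (x / 2)|.

Lemma halfsin_ge0 (R : realType) (x : R) : 0 <= halfsin x.
Proof. exact: normr_ge0. Qed.

Lemma halfsin_le1 (R : realType) (x : R) : halfsin x <= 1.
Proof. exact: sin_max. Qed.

Lemma halfsin_lip (R : realType) (x y : R) : halfsin x <= halfsin y + `|x - y|.
Proof.
rewrite -lerBlDl; apply: le_trans (ler_norm _) _.
apply: le_trans (ler_dist_dist _ _) _.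
apply: le_trans (sin_lip _ _) _; rewrite -mulrBl normrM [`|2^-1|]ger0_norm//.
have := normr_ge0 (x - y); lra.
Qed.

(** The cosine sums are telescoping after multiplication by 2 sin (x/2), so
    that summation by parts applies. *)
Lemma abel_bound (R : realType) (b : nat -> R) (th x : R) (M N : nat) : (M <= N)%N ->
  halfsin x * `|\sum_(M <= k < N) b k * cos (k%:R * x - th)| <=
  `|b M| + \sum_(M <= k < N) `|b k - b k.+1|.
Proof.
move=> MN; pose r (k : nat) := sin ((k%:R - 2^-1) * x - th).
have Er k : r k.+1 - r k = 2 * sin (x / 2) * cos (k%:R * x - th).
  rewrite /r; have -> : (k.+1%:R - 2^-1) * x - th = (k%:R * x - th) + x / 2.
    by rewrite -natr1; field.
  have -> : (k%:R - 2^-1) * x - th = (k%:R * x - th) - x / 2 by field.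
  by move: (k%:R * x - th) (x / 2) => u v; rewrite sinD sinB; ring.
have r1 k : `|r k| <= 1 by exact: sin_max.
have -> : halfsin x * `|\sum_(M <= k < N) b k * cos (k%:R * x - th)| =
    2^-1 * `|\sum_(M <= k < N) (r k.+1 - r k) * b k|.
  rewrite -[2^-1]ger0_norm// -!normrM; congr `|_|; rewrite !mulr_sumr.
  by apply: eq_bigr => k _; rewrite Er; field.
rewrite abel_sum//; set V := \sum_(_ <= _ < _) `|_|.
have bN : `|b N| <= `|b M| + V.
  have -> : b N = b M + \sum_(M <= k < N) (b k.+1 - b k) by rewrite telescope_sumr//; ring.
  apply: le_trans (ler_normD _ _) _; rewrite lerD2l.
  apply: le_trans (ler_norm_sum _ _ _) _.
  by apply: ler_sum => k _; rewrite distrC.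
have h1 : `|r N * b N| <= `|b N| by rewrite normrM ler_piMl.
have h2 : `|r M * b M| <= `|b M| by rewrite normrM ler_piMl.
have h3 : `|\sum_(M <= n < N) r n.+1 * (b n - b n.+1)| <= V.
  apply: le_trans (ler_norm_sum _ _ _) _; apply: ler_sum => k _.
  by rewrite normrM ler_piMl.
have := le_trans (ler_normD _ _) (lerD (le_trans (ler_normB _ _) (lerD h1 h2)) h3).
set Z := `| _ + _ |; lra.
Qed.

Lemma sin_ge_quarter (R : realType) (y : R) : 0 <= y <= pi / 2 -> y / 4 <= sin y.
Proof.
move=> /andP[y0 yp].
(* On [0, 1] the cubic bound for z - sin z gives z / 2; on [1, pi / 2] the
   sine is at least sin 1, and y <= 2. *)
have small (z : R) : 0 <= z <= 1 -> z / 2 <= sin z.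
  move=> /andP[z0 z1]; have := sin_sub_id_le (lexx 0) z0; rewrite sin0 !subr0.
  have : z ^+ 2 / 2 * z <= 2^-1 * z.
    by apply: ler_wpM2r => //; rewrite ler_pdivrMr// mulVf// exprn_ile1.
  rewrite ler_norml => h /andP[_]; lra.
have [y1|y1] := leP y 1.
  by have := small y; rewrite y0 y1 => /(_ isT); lra.
have p2 := @pihalf_lt2 R; have p1 := @pihalf_ge1 R.
have : sin 1 <= sin y.
  apply/ltW; rewrite ltr_sin// in_itv /=; apply/andP; split; lra.
have := small 1; rewrite ler01 lexx => /(_ isT); lra.
Qed.

Lemma halfsin_ge (R : realType) (x : R) : 0 <= x <= pi *+ 2 ->
  x / 8 <= halfsin x \/ (pi *+ 2 - x) / 8 <= halfsin x.
Proof.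
rewrite -mulr_natl => /andP[x0 x2p]; have [xp|xp] := leP x pi.
  left; apply: le_trans (ler_norm _).
  have := @sin_ge_quarter _ (x / 2); have -> : (0 <= x / 2 <= pi / 2).
    by apply/andP; split; lra.
  by move=> /(_ isT); lra.
right; apply: le_trans (ler_norm _).
have := @sin_ge_quarter _ (pi - x / 2); have -> : (0 <= pi - x / 2 <= pi / 2).
  by apply/andP; split; lra.
move=> /(_ isT); rewrite sinB sinpi cospi mul0r sub0r mulN1r opprK; lra.
Qed.

Lemma integral_affine (R : realType) (A B : R -> R) (h : R) : 0 < h ->
  (forall y : R, 0 < y -> is_derive y 1 B (A y)) ->
  (forall y : R, 0 < y -> {for y, continuous A}) ->
  (\int[lebesgue_measure]_(x in `[0%R, (pi *+ 2)%R]) (A (x + h)%R)%:E =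
     (B (pi *+ 2 + h)%R - B h)%:E)%E /\
  (\int[lebesgue_measure]_(x in `[0%R, (pi *+ 2)%R]) (A (pi *+ 2 - x + h)%R)%:E =
     (B (pi *+ 2 + h)%R - B h)%:E)%E.
Proof.
move=> h0 dB cA; set T : R := pi *+ 2; have T0 : 0 < T by exact: twopi_gt0.
have cB (y : R) : 0 < y -> {for y, continuous B}.
  by move=> y0; apply/differentiable_continuous/derivable1_diffP; case: (dB y y0).
have d1 (y : R) : is_derive y 1 (fun x => x + h) 1.
  by apply: (@is_derive_quadratic _ _ _ _ 0) => k _;
    rewrite mul0r (_ : _ - _ = 0) ?normr0//; ring.
have d2 (y : R) : is_derive y 1 (fun x => T - x + h) (-1).
  by apply: (@is_derive_quadratic _ _ _ _ 0) => k _;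
    rewrite mul0r (_ : _ - _ = 0) ?normr0//; ring.
have c1 (y : R) : {for y, continuous (fun x => x + h)}.
  by apply/differentiable_continuous/derivable1_diffP; case: (d1 y).
have c2 (y : R) : {for y, continuous (fun x => T - x + h)}.
  by apply/differentiable_continuous/derivable1_diffP; case: (d2 y).
have e1 (x : R) : 0 < x + h -> is_derive x 1 (B \o (fun x : R => x + h)) (A (x + h) * 1).
  by move=> x1; have dBx := dB _ x1; exact: is_derive1_comp.
have e2 (x : R) : 0 < T - x + h ->
    is_derive x 1 (B \o (fun x : R => T - x + h)) (A (T - x + h) * -1).
  by move=> x1; have dBx := dB _ x1; exact: is_derive1_comp.
split.
- rewrite (@continuous_FTC2 _ _ (B \o (fun x => x + h)))//=.
  + by rewrite add0r EFinB.
  + apply/continuous_in_subspaceT => x; rewrite inE /= in_itv /= => /andP[x0 _].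
    by apply: continuous_comp => //; apply: cA; rewrite ltr_wpDl.
  + split.
    * move=> x; rewrite in_itv /= => /andP[x0 _].
      have x1 : 0 < x + h by rewrite addr_gt0.
      by have [] := e1 x x1.
    * apply: cvg_at_right_filter; apply: continuous_comp => //.
      by apply: cB; rewrite add0r.
    * apply: cvg_at_left_filter; apply: continuous_comp => //.
      by apply: cB; rewrite addr_gt0.
  + move=> x; rewrite in_itv /= => /andP[x0 _].
    have x1 : 0 < x + h by rewrite addr_gt0.
    rewrite derive1E; have [_ ->] := e1 x x1.
    by rewrite mulr1.
- rewrite (@continuous_FTC2 _ _ (fun x => - B (T - x + h)))//=.
  + by rewrite -EFinB subrr add0r subr0; congr EFin; ring.
  + apply/continuous_in_subspaceT => x; rewrite inE /= in_itv /= => /andP[_ xT].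
    apply: (@continuous_comp _ _ _ (fun x => T - x + h) A) => //.
    by apply: cA; rewrite ltr_wpDl// subr_ge0.
  + split.
    * move=> x; rewrite in_itv /= => /andP[_ xT].
      have x1 : 0 < T - x + h by rewrite addr_gt0// subr_gt0.
      by apply: derivableN; have [] := e2 x x1.
    * apply: cvg_at_right_filter; apply: cvgN.
      apply: (@continuous_comp _ _ _ (fun x => T - x + h) B) => //.
      by apply: cB; rewrite subr0 addr_gt0.
    * apply: cvg_at_left_filter; apply: cvgN.
      apply: (@continuous_comp _ _ _ (fun x => T - x + h) B) => //.
      by apply: cB; rewrite subrr add0r.
  + move=> x; rewrite in_itv /= => /andP[_ xT].
    have x1 : 0 < T - x + h by rewrite addr_gt0// subr_gt0.
    have dd := e2 x x1.
    have [_ ] := is_deriveN dd; rewrite derive1E => ->.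
    by rewrite mulrN1 opprK.
Qed.

Lemma continuous_halfsin (R : realType) : continuous (@halfsin R).
Proof.
move=> x; apply/cvgrPdist_le => e e0; near=> y.
have h : `|x - y| <= e by near: y; exact: cvgr_dist_le.
have h1 := halfsin_lip x y; have h2 := halfsin_lip y x; rewrite distrC in h2.
by rewrite ler_norml; apply/andP; split; lra.
Unshelve. all: by end_near. Qed.

(** Integration of a bound by [A] of the two distances to the endpoints of the
    period, increased by [h], where [B] is a primitive of [A]. *)
Lemma le_integral_affine (R : realType) (A B G : R -> R) (C h : R) : 0 < h ->
  measurable_fun [set: R] A -> measurable_fun [set: R] G ->
  (forall y, 0 < y -> 0 <= A y) -> 0 <= C -> (forall x, 0 <= G x) ->
  (forall y : R, 0 < y -> is_derive y 1 B (A y)) ->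
  (forall y : R, 0 < y -> {for y, continuous A}) ->
  (forall x, 0 <= x <= pi *+ 2 -> G x <= C * (A (x + h) + A (pi *+ 2 - x + h))) ->
  (\int[pm R]_x (G x)%:E <= (C * (2 * (B (pi *+ 2 + h)%R - B h)))%:E)%E.
Proof.
move=> h0 mA mG A0 C0 G0 dB cA GA.
rewrite ge0_integral_periodE; last 2 first.
- exact/measurable_EFinP.
- by move=> x; rewrite lee_fin.
have [i1 i2] := integral_affine h0 dB cA.
have m1 : measurable_fun [set: R] (fun x => (A (x + h))%:E).
  apply/measurable_EFinP; apply: (measurableT_comp mA); exact: measurable_funD.
have m2 : measurable_fun [set: R] (fun x => (A (pi *+ 2 - x + h))%:E).
  apply/measurable_EFinP; apply: (measurableT_comp mA); apply: measurable_funD => //.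
  exact: measurable_funB.
have a1 x : 0 <= x <= pi *+ 2 -> 0 <= A (x + h).
  by move=> /andP[x0 _]; apply: A0; rewrite ltr_wpDl.
have a2 x : 0 <= x <= pi *+ 2 -> 0 <= A (pi *+ 2 - x + h).
  by move=> /andP[_ xT]; apply: A0; rewrite ltr_wpDl// subr_ge0.
apply: (@le_trans _ _ (\int[lebesgue_measure]_(x in @period R)
    (C%:E * ((A (x + h)%R)%:E + (A (pi *+ 2 - x + h)%R)%:E)))%E).
  apply: ge0_le_integral.
  - exact: measurable_period.
  - by move=> x _; rewrite lee_fin.
  - by apply/measurable_EFinP; exact: measurable_funTS mG.
  - apply: measurable_funTS; apply: emeasurable_funM => //.
    exact: emeasurable_funD.
  - move=> x; rewrite /period /= in_itv /= => xD.
    by rewrite -EFinD -EFinM lee_fin; exact: GA.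
rewrite ge0_integralZl; first last.
- by rewrite lee_fin.
- move=> x; rewrite /period /= in_itv /= => xD; rewrite -EFinD lee_fin.
  by apply: addr_ge0; [exact: a1|exact: a2].
- apply: measurable_funTS; exact: emeasurable_funD.
- exact: measurable_period.
rewrite ge0_integralD; first last.
- exact: measurable_funTS.
- by move=> x; rewrite /period /= in_itv /= => xD; rewrite lee_fin a2.
- exact: measurable_funTS.
- by move=> x; rewrite /period /= in_itv /= => xD; rewrite lee_fin a1.
- exact: measurable_period.
by rewrite /period i1 i2 -EFinD -EFinM lee_fin
  (_ : _ + _ = 2 * (B (pi *+ 2 + h) - B h))//; ring.
Qed.

Lemma halfsin_add_ge (R : realType) (x h : R) : 0 < h -> 0 <= x <= pi *+ 2 ->
  (x + h) / 8 <= halfsin x + h \/ (pi *+ 2 - x + h) / 8 <= halfsin x + h.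
Proof.
move=> h0 xD; have [a|a] := halfsin_ge xD; [left|right]; lra.
Qed.

Lemma halfsin_powR_le (R : realType) (q h x : R) : 0 <= q -> 0 < h ->
  0 <= x <= pi *+ 2 ->
  (halfsin x + h) `^ (- q) <=
    8 `^ q * ((x + h) `^ (- q) + (pi *+ 2 - x + h) `^ (- q)).
Proof.
move=> q0 h0 xD.
have k (u : R) : 0 < u -> u / 8 <= halfsin x + h ->
    (halfsin x + h) `^ (- q) <= 8 `^ q * u `^ (- q).
  move=> u0 uh; rewrite !powRN.
  have s0 : 0 < halfsin x + h by rewrite ltr_wpDl ?halfsin_ge0.
  rewrite -[leLHS]mul1r ler_pdivrMr ?powR_gt0// mulrAC ler_pdivlMr ?powR_gt0// mul1r.
  rewrite -powRM ?(ltW s0)//; apply: ge0_ler_powR => //.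
  - by rewrite nnegrE ltW.
  - by rewrite nnegrE mulr_ge0// ltW.
  - by rewrite mulrC -ler_pdivrMr.
have x0 : 0 < x + h by case/andP: xD => ? _; rewrite ltr_wpDl.
have x1 : 0 < pi *+ 2 - x + h by case/andP: xD => _ ?; rewrite ltr_wpDl// subr_ge0.
have [/(k _ x0)|/(k _ x1)] := halfsin_add_ge h0 xD => /le_trans; apply;
  (apply: ler_wpM2l; first exact: powR_ge0); by rewrite ?lerDl ?lerDr powR_ge0.
Qed.

Lemma measurable_halfsin_powR (R : realType) (q h : R) :
  measurable_fun [set: R] (fun x => (halfsin x + h) `^ q).
Proof.
apply: (measurableT_comp (@measurable_powR R q)).
by apply: measurable_funD => //; apply: continuous_measurable_fun;
  exact: continuous_halfsin.
Qed.

Lemma integral_halfsin_powR (R : realType) (q h : R) : 1 < q -> 0 < h ->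
  (\int[pm R]_x ((halfsin x + h) `^ (- q))%:E <=
    (8 `^ q * (2 * (h `^ (1 - q) / (q - 1))))%:E)%E.
Proof.
move=> q1 h0; have q0 : 0 < q by lra.
pose A (y : R) := y `^ (- q); pose B (y : R) := (1 - q)^-1 * y `^ (1 - q).
have q1' : 1 - q != 0 by rewrite lt_eqF// subr_lt0.
apply: (@le_trans _ _ (8 `^ q * (2 * (B (pi *+ 2 + h)%R - B h)))%:E); last first.
  rewrite lee_fin; apply: ler_wpM2l; first exact: powR_ge0.
  rewrite ler_pM2l// /B -mulrBr.
  have : 0 <= (pi *+ 2 + h) `^ (1 - q) by exact: powR_ge0.
  set u := (_ + _) `^ _; set v := h `^ _ => u0.
  have -> : (1 - q)^-1 * (u - v) = (v - u) / (q - 1).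
    by field; rewrite q1' -oppr_eq0 opprB q1'.
  by rewrite ler_pM2r ?invr_gt0 ?subr_gt0// gerBl.
apply: (@le_integral_affine _ A) => //.
- exact: measurable_powR.
- exact: measurable_halfsin_powR.
- by move=> y _; exact: powR_ge0.
- by move=> x; exact: powR_ge0.
- move=> y y0; have d := is_derive1_powR (1 - q) y0.
  have -> : A y = (1 - q)^-1 *: ((1 - q) * y `^ (1 - q - 1)).
    rewrite -[RHS]/((1 - q)^-1 * ((1 - q) * y `^ (1 - q - 1))) mulKf//.
    by congr (_ `^ _); ring.
  by rewrite (_ : B = (1 - q)^-1 *: (fun y => y `^ (1 - q)))//; exact: is_deriveZ.
- move=> y y0; apply/differentiable_continuous/derivable1_diffP.
  by have [] := is_derive1_powR (- q) y0.
- by move=> x xD; apply: halfsin_powR_le => //; exact: ltW.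
Qed.

Lemma integral_halfsin_inv (R : realType) (h : R) : 0 < h ->
  (\int[pm R]_x ((halfsin x + h) `^ (- 1))%:E <=
    (8 * (2 * (ln (pi *+ 2 + h)%R - ln h)))%:E)%E.
Proof.
move=> h0; apply: (@le_integral_affine R (fun y => y `^ (- 1)) (@ln R)) => //.
- exact: measurable_halfsin_powR.
- by move=> y _; exact: powR_ge0.
- by move=> x; exact: powR_ge0.
- by move=> y y0; rewrite powR_inv1 ?ltW//; exact: is_derive1_ln.
- move=> y y0; apply/differentiable_continuous/derivable1_diffP.
  by have [] := is_derive1_powR (- 1) y0.
- by move=> x xD; have := @halfsin_powR_le _ 1 h x ler01 h0 xD; rewrite (powRr1 _)//.
Qed.

Lemma lebesgue_measure_shift (R : realType) (t : R) (A : set R) : measurable A ->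
  pushforward (@lebesgue_measure R) ((fun x => x + t) : _ -> measurableTypeR R) A =
  lebesgue_measure A.
Proof.
move=> mA; apply/esym/lebesgue_measure_unique => //=.
  exact: measurable_funD.
move=> ms _ [[a b]] _ <-.
rewrite /pushforward.
have -> : (fun x : R => x + t) @^-1` `]a, b]%classic = `](a - t), (b - t)]%classic.
  by apply/seteqP; split => x /=; rewrite !in_itv /= ltrBlDr lerBrDr.
rewrite !lebesgue_measure_itv/= !lte_fin ltrD2r; case: ifP => // _.
by rewrite -!EFinB; congr EFin; ring.
Qed.

Lemma ge0_integral_shift (R : realType) (a b t : R) (F : R -> \bar R) :
  measurable_fun [set: R] F -> (forall x, 0 <= F x)%E ->
  (\int[lebesgue_measure]_(x in `[(a + t)%R, (b + t)%R]) F x =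
   \int[lebesgue_measure]_(x in `[a, b]) F (x + t)%R)%E.
Proof.
move=> mF F0; pose s : R -> measurableTypeR R := fun x => x + t.
have ms : measurable_fun [set: measurableTypeR R] s by exact: measurable_funD.
have -> : `[a, b]%classic = s @^-1` `[(a + t), (b + t)]%classic.
  by apply/seteqP; split => x /=; rewrite !in_itv /= !lerD2r.
transitivity (\int[pushforward lebesgue_measure s]_(x in `[(a + t)%R, (b + t)%R]) F x)%E.
  apply: eq_measure_integral => A mA _; exact/esym/lebesgue_measure_shift.
rewrite (ge0_integral_pushforward ms) //.
exact: measurable_funTS.
Qed.

Lemma ge0_integral_period_shift (R : realType) (t : R) (F : R -> \bar R) :
  measurable_fun [set: R] F -> (forall x, 0 <= F x)%E ->
  (forall x, F (x + pi *+ 2) = F x) ->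
  0 <= t <= pi *+ 2 ->
  (\int[pm R]_x F (x + t)%R = \int[pm R]_x F x)%E.
Proof.
move=> mF F0 pF /andP[t0 tT]; set T : R := pi *+ 2 in tT *.
have mFt : measurable_fun [set: R] (fun x => F (x + t)).
  by apply: (measurableT_comp mF); exact: measurable_funD.
rewrite !ge0_integral_periodE// /period.
rewrite -(@ge0_integral_shift _ 0 (pi *+ 2) t)// add0r -/T.
have split (u v w : R) : u <= v -> v <= w ->
    (\int[lebesgue_measure]_(x in `[u, w]) F x = \int[lebesgue_measure]_(x in `[u, v]) F x
     + \int[lebesgue_measure]_(x in `[v, w]) F x)%E.
  move=> uv vw.
  have -> : `[u, w]%classic = `[u, v]%classic `|` `]v, w]%classic.
    apply/seteqP; split => x /=; rewrite !in_itv /=.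
      by move=> /andP[ux xw]; have [xv|xv] := leP x v; [left|right]; apply/andP.
    by move=> [|] /andP[h1 h2]; apply/andP; split; lra.
  rewrite ge0_integral_setU; first last.
  - rewrite disj_set2E; apply/eqP; rewrite -subset0 => x [] /=.
    by rewrite !in_itv /= => /andP[_ h1] /andP[h2 _]; lra.
  - by [].
  - exact: measurable_funTS.
  - exact: measurable_itv.
  - exact: measurable_itv.
  congr (_ + _)%E; apply: integral_itv_obnd_cbnd; exact: measurable_funTS.
rewrite (split t T (T + t))// ?lerDl// (split 0 t T)// addeC; congr (_ + _)%E.
have -> : (\int[lebesgue_measure]_(x in `[T, (T + t)%R]) F x =
    \int[lebesgue_measure]_(x in `[0%R, t]) F (x + T)%R)%E.
  by rewrite -ge0_integral_shift// add0r [t + T]addrC.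
by apply: eq_integral => x _; rewrite pF.
Qed.

(** * Translations and second differences *)

Lemma ge0_integral_period_translate (R : realType) (t : R) (F : R -> \bar R) :
  measurable_fun [set: R] F -> (forall x, 0 <= F x)%E ->
  (forall x, F (x + pi *+ 2) = F x) -> `|t| <= pi *+ 2 ->
  (\int[pm R]_x F (x + t)%R = \int[pm R]_x F x)%E.
Proof.
move=> mF F0 pF; rewrite ler_norml => /andP[t1 t2].
have [t0|/ltW t0] := leP 0 t.
  by apply: ge0_integral_period_shift => //; rewrite t0.
rewrite -[LHS](@ge0_integral_period_shift R (- t) (fun x => F (x + t)))//.
- by apply: eq_integral => x _; rewrite subrK.
- by apply: (measurableT_comp mF); exact: measurable_funD.
- by move=> x; rewrite addrAC pF.
- by rewrite oppr_ge0 t0 lerNl.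
Qed.

Lemma Rintegral_period_shift (R : realType) (t : R) (F : R -> R) :
  measurable_fun [set: R] F -> periodic F (pi *+ 2) -> `|t| <= pi *+ 2 ->
  \int[pm R]_x F (x + t) = \int[pm R]_x F x.
Proof.
move=> mF pF tT; rewrite /Rintegral; congr fine.
have mE : measurable_fun [set: R] (EFin \o F) by exact/measurable_EFinP.
have mp := measurable_funepos mE; have mn := measurable_funeneg mE.
have pp x : (0 <= funepos (EFin \o F) x)%E by exact: funepos_ge0.
have pn x : (0 <= funeneg (EFin \o F) x)%E by exact: funeneg_ge0.
rewrite integralE [in RHS]integralE; congr (_ - _)%E.
  transitivity (\int[pm R]_x funepos (EFin \o F) (x + t)%R)%E.
    by apply: eq_integral => x _; rewrite !funeposE.
  by apply: ge0_integral_period_translate => // x; rewrite !funeposE /= pF.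
transitivity (\int[pm R]_x funeneg (EFin \o F) (x + t)%R)%E.
  by apply: eq_integral => x _; rewrite !funenegE.
by apply: ge0_integral_period_translate => // x; rewrite !funenegE /= pF.
Qed.

Lemma integrable_period_shift (R : realType) (t : R) (f : R -> R) :
  (pm R).-integrable [set: R] (EFin \o f) -> periodic f (pi *+ 2) -> `|t| <= pi *+ 2 ->
  (pm R).-integrable [set: R] (EFin \o (fun x => f (x + t))).
Proof.
move=> /integrableP[mf fi] pf tT.
have mf' : measurable_fun [set: R] f by exact/measurable_EFinP.
apply/integrableP; split.
  by apply/measurable_EFinP; apply: (measurableT_comp mf'); exact: measurable_funD.
rewrite (@ge0_integral_period_translate R t (fun x => `|(f x)%:E|)%E) //.
  by apply: measurableT_comp => //; exact/measurable_EFinP.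
by move=> x; rewrite pf.
Qed.

Lemma integrable_period_contM (R : realType) (c f : R -> R) :
  continuous c -> (pm R).-integrable [set: R] (EFin \o f) ->
  (pm R).-integrable [set: R] (EFin \o (fun x => f x * c x)).
Proof.
move=> cc intf.
have mf : measurable_fun [set: R] f by apply/measurable_EFinP; exact: measurable_int intf.
rewrite (_ : EFin \o _ = EFin \o (fun x => c x * f x)); last first.
  by apply/funext => x /=; rewrite mulrC.
apply: integrable_periodE.
  by apply: measurable_funM => //; exact: continuous_measurable_fun.
exact: integrable_contM cc (integrable_period_leb intf).
Qed.

Lemma integrable_pmD (R : realType) (f g : R -> R) :
  (pm R).-integrable [set: R] (EFin \o f) -> (pm R).-integrable [set: R] (EFin \o g) ->
  (pm R).-integrable [set: R] (EFin \o (fun x => f x + g x)).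
Proof.
move=> intf intg; rewrite (_ : EFin \o _ = (EFin \o f) \+ (EFin \o g))%E//.
exact: integrableD.
Qed.

(** Taking the second difference with step [t] multiplies the [k]-th Fourier
    coefficients by - 4 sin^2 (k t / 2). Moving the translations onto the
    cosine gives this for every phase [th]. *)
Lemma second_diff_coeff (R : realType) (f : R -> R) (t th : R) (k : nat) :
  (pm R).-integrable [set: R] (EFin \o f) -> periodic f (pi *+ 2) -> `|t| <= pi *+ 2 ->
  \int[pm R]_x ((f (x + t) + f (x - t) - 2 * f x) * cos (k%:R * x - th)) =
  - (4 * sin (k%:R * t / 2) ^+ 2 * \int[pm R]_x (f x * cos (k%:R * x - th))).
Proof.
move=> intf pf tT.
have mf : measurable_fun [set: R] f by apply/measurable_EFinP; exact: measurable_int intf.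
have tT' : `|- t| <= pi *+ 2 by rewrite normrN.
have cc c : continuous (fun x : R => cos (k%:R * x - c)) by exact: continuous_cosMB.
have sh u : `|u| <= pi *+ 2 -> \int[pm R]_x (f (x + u) * cos (k%:R * x - th)) =
    \int[pm R]_x (f x * cos (k%:R * x - (th + k%:R * u))).
  move=> uT;
    rewrite -(@Rintegral_period_shift R u (fun x => f x * cos (k%:R * x - (th + k%:R * u)))) //.
  - by apply: eq_Rintegral => x _; congr (_ * cos _); ring.
  - by apply: measurable_funM => //; exact: continuous_measurable_fun.
  - move=> x; rewrite pf; congr (_ * _).
    have -> : k%:R * (x + pi *+ 2) - (th + k%:R * u) =
       k%:R * (pi *+ 2) + (k%:R * x - (th + k%:R * u)) by ring.
    exact: cos_2pi_nat.
have i1 := integrable_period_contM (cc th) (integrable_period_shift intf pf tT).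
have i2 := integrable_period_contM (cc th) (integrable_period_shift intf pf tT').
have i3 := integrable_period_contM (cc th) intf.
have j1 := integrable_period_contM (cc (th + k%:R * t)) intf.
have j2 := integrable_period_contM (cc (th + k%:R * - t)) intf.
have i3' : (pm R).-integrable [set: R] (EFin \o (fun x => 2 * (f x * cos (k%:R * x - th)))).
  rewrite (_ : EFin \o _ = EFin \o (fun x => f x * cos (k%:R * x - th) + f x * cos (k%:R * x - th))).
    exact: integrable_pmD.
  by apply/funext => x /=; congr EFin; ring.
transitivity (\int[pm R]_x (f (x + t) * cos (k%:R * x - th)) +
    \int[pm R]_x (f (x - t) * cos (k%:R * x - th)) -
    2 * \int[pm R]_x (f x * cos (k%:R * x - th))).
  rewrite -RintegralZl// -RintegralD// -RintegralB//.
    by apply: eq_Rintegral => x _; ring.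
  exact: integrable_pmD.
rewrite -[RHS]mulNr sh// sh// -!RintegralZl// -!RintegralD// -RintegralB//; last first.
  exact: integrable_pmD.
apply: eq_Rintegral => x _.
have := cos_sd (k%:R * x - th) (k%:R * t).
have -> : k%:R * x - (th + k%:R * t) = k%:R * x - th - k%:R * t by ring.
have -> : k%:R * x - (th + k%:R * - t) = k%:R * x - th + k%:R * t by ring.
set c1 := cos _; set c2 := cos _; set c3 := cos _ => E.
have -> : f x * c2 + f x * c1 - 2 * (f x * c3) = f x * (c1 + c2 - 2 * c3) by ring.
by rewrite E; ring.
Qed.

(** * Pairing with a block of cosines *)

Lemma holder_period (R : realType) (p q : R) (f g : R -> R) (Cf Cg : R) :
  0 < p -> 0 < q -> p^-1 + q^-1 = 1 ->
  measurable_fun [set: R] f -> measurable_fun [set: R] g ->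
  (pm R).-integrable [set: R] (EFin \o (fun x => f x * g x)) ->
  (Lp_norm p f <= Cf%:E)%E ->
  (\int[pm R]_x (`|g x| `^ q)%:E <= Cg%:E)%E -> 0 <= Cg ->
  `|\int[pm R]_x (f x * g x)| <= Cf * Cg `^ q^-1.
Proof.
move=> p0 q0 pq mf mg ifg fC gC Cg0.
rewrite -lee_fin EFin_normr_Rintegral//.
apply: le_trans (le_abse_integral _ _ _) _ => //.
  by apply: measurable_int ifg.
have := @hoelder _ _ _ (pm R) f g p q mf mg p0 q0 pq.
rewrite Lnorm1 => /le_trans; apply.
rewrite EFinM; apply: lee_pmul; try exact: Lnorm_ge0.
  exact: fC.
rewrite unlock -poweR_EFin; apply: gt0_ler_poweR.
- by rewrite invr_ge0 ltW.
- by rewrite in_itv /= leey integral_ge0// => x _; exact: poweR_ge0.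
- by rewrite in_itv /= lee_fin Cg0 leey.
- exact: gC.
Qed.

(** The block of cosines from n to 2 n - 1. *)
Definition dirichlet (R : realType) (n : nat) (th x : R) : R :=
  \sum_(n <= k < 2 * n) cos (k%:R * x - th).

Lemma continuous_dirichlet (R : realType) (n : nat) (th : R) :
  continuous (dirichlet n th).
Proof. by apply: continuous_sum_nat => k; exact: continuous_cosMB. Qed.

Lemma dirichlet_le (R : realType) (n : nat) (th x : R) : (1 <= n)%N ->
  `|dirichlet n th x| <= 2 * (halfsin x + n%:R^-1)^-1.
Proof.
move=> n1; have n0 : (0 : R) < n%:R by rewrite ltr0n.
have s0 := halfsin_ge0 x.
have h1 : halfsin x * `|dirichlet n th x| <= 1.
  have V0 : \sum_(n <= k < 2 * n) `|(1 : R) - 1| = 0.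
    by rewrite big1// => k _; rewrite subrr normr0.
  have := @abel_bound R (fun=> 1) th x n (2 * n) (leq_pmull n (isT : (0 < 2)%N)).
  by rewrite V0 normr1 addr0; under eq_bigr do rewrite mul1r.
have h2 : `|dirichlet n th x| <= n%:R.
  apply: le_trans (ler_norm_sum _ _ _) _.
  apply: (@le_trans _ _ (\sum_(n <= k < 2 * n) 1)).
    by apply: ler_sum => k _; exact: cos_max.
  by rewrite sumr_const_nat mul2n -addnn addnK.
rewrite ler_pdivlMr; last by rewrite ltr_wpDl// invr_gt0.
rewrite mulrDr; have : `|dirichlet n th x| * n%:R^-1 <= 1 by rewrite ler_pdivrMr// mul1r.
by rewrite mulrC in h1; lra.
Qed.

Lemma dirichlet_Lq (R : realType) (q : R) (n : nat) (th : R) : 1 < q -> (1 <= n)%N ->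
  (\int[pm R]_x (`|dirichlet n th x| `^ q)%:E <=
   (2 `^ q * (8 `^ q * (2 * (n%:R `^ (q - 1) / (q - 1)))))%:E)%E.
Proof.
move=> q1 n1; have q0 : 0 < q by lra.
have n0 : (0 : R) < n%:R^-1 by rewrite invr_gt0 ltr0n.
have e1 : n%:R `^ (q - 1) = n%:R^-1 `^ (1 - q) :> R.
  rewrite -[n%:R in LHS]invrK -powR_inv1 ?(ltW n0)// -powRrM; congr (_ `^ _); ring.
rewrite e1 EFinM.
apply: le_trans (lee_wpmul2l _ (integral_halfsin_powR q1 n0));
  last by rewrite lee_fin powR_ge0.
rewrite -ge0_integralZl; first last.
- by rewrite lee_fin powR_ge0.
- by move=> x _; rewrite lee_fin powR_ge0.
- by apply/measurable_EFinP; exact: measurable_halfsin_powR.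
- exact: measurableT.
apply: ge0_le_integral.
- exact: measurableT.
- by move=> x _; rewrite lee_fin powR_ge0.
- apply/measurable_EFinP; apply: (measurableT_comp (@measurable_powR R q)).
  apply: measurableT_comp => //; apply: continuous_measurable_fun;
    exact: continuous_dirichlet.
- apply/measurable_EFinP; apply: measurable_funM => //; exact: measurable_halfsin_powR.
- move=> x _; rewrite -EFinM lee_fin.
  have s0 : 0 < halfsin x + n%:R^-1 by rewrite ltr_wpDl// halfsin_ge0.
  rewrite powRN -powR_inv1 ?powR_ge0// -powRrM mulrN1 -mulN1r powRrM powR_inv1 ?(ltW s0)//.
  rewrite -powRM ?invr_ge0 ?(ltW s0)//; apply: ge0_ler_powR; rewrite ?nnegrE ?(ltW q0)//.
    by rewrite mulr_ge0// invr_ge0 ltW.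
  exact: dirichlet_le.
Qed.

(** The norm of [dirichlet n th] in the dual of L^p is O(n^(1/p)), uniformly in
    the phase. *)
Lemma dirichlet_pairing (R : realType) (p : R) : 1 < p ->
  exists2 C : R, 0 <= C & forall (n : nat) (th : R) (g : R -> R) (B : R), (1 <= n)%N ->
    (pm R).-integrable [set: R] (EFin \o g) -> (Lp_norm p g <= B%:E)%E ->
    `|\int[pm R]_x (g x * dirichlet n th x)| <= C * B * n%:R `^ p^-1.
Proof.
move=> p1; have p0 : 0 < p by lra.
pose q := p / (p - 1); have p10 : 0 < p - 1 by lra.
have q1 : 1 < q by rewrite /q ltr_pdivlMr//; lra.
have q0 : 0 < q by lra.
have pq : p^-1 + q^-1 = 1 by rewrite /q invf_div; field; rewrite gt_eqF.
pose K := 2 `^ q * (8 `^ q * (2 / (q - 1))).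
have K0 : 0 <= K by rewrite !mulr_ge0 ?powR_ge0// invr_ge0; lra.
exists (K `^ q^-1); first exact: powR_ge0.
move=> n th g B n1 ig gB.
have mg : measurable_fun [set: R] g by apply/measurable_EFinP; exact: measurable_int ig.
have cD := @continuous_dirichlet R n th.
have := @holder_period _ p q g (dirichlet n th) B (K * n%:R `^ (q - 1)) p0 q0 pq mg
  (continuous_measurable_fun cD) (integrable_period_contM cD ig) gB.
move=> /(_ _ _)/le_trans; apply.
- apply: le_trans (dirichlet_Lq th q1 n1) _.
  by rewrite lee_fin /K le_eqVlt; apply/orP; left; apply/eqP; ring.
- by rewrite mulr_ge0// powR_ge0.
- rewrite powRM ?powR_ge0// -powRrM.
  have -> : (q - 1) / q = p^-1 by rewrite -[p^-1](addrK q^-1) pq; field; rewrite gt_eqF.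
  by rewrite mulrA [B * _]mulrC.
Qed.

(** * Sequences in NBVS *)

Lemma cvg_series_term (R : realType) (u : nat -> R) (l : R) :
  \sum_(1 <= n < N) u n @[N --> \oo] --> l -> u n @[n --> \oo] --> 0.
Proof.
move=> cv; pose S N := \sum_(1 <= n < N) u n.
have cS : (fun n => S n.+1) @ \oo --> l by rewrite (cvg_shiftS S).
have cD : (fun n => S n.+1 - S n) @ \oo --> 0.
  by rewrite -[0](subrr l); apply: cvgB.
apply: cvg_trans cD; apply: near_eq_cvg; exists 1%N => // n /= n1.
by rewrite /S big_nat_recr//= addrAC subrr add0r.
Qed.

(** In a block from n to 2 n the terms are controlled by the two extreme
    ones. *)
Lemma NBVS_le (R : realType) (a : nat -> R) : NBVS a ->
  exists2 K : R, 1 <= K & forall n m, (1 <= n)%N -> (n <= m <= 2 * n)%N ->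
    a m <= K * (a n + a (2 * n)%N).
Proof.
move=> [a0 [K HK]]; exists (1 + `|K|); first by rewrite lerDl.
move=> n m n1 /andP[nm m2n].
have an0 := a0 n n1; have a2n0 : 0 <= a (2 * n)%N by apply: a0; rewrite muln_gt0 n1.
have -> : a m = a n - \sum_(n <= k < m) (a k - a k.+1).
  by rewrite -[\sum_(_ <= _ < _) _]opprK -sumrN; under eq_bigr do rewrite opprB;
    rewrite telescope_sumr//; ring.
have h : `|\sum_(n <= k < m) (a k - a k.+1)| <= K * (a n + a (2 * n)%N).
  apply: le_trans (HK n n1); apply: le_trans (ler_norm_sum _ _ _) _.
  rewrite [leRHS](@big_cat_nat _ _ _ m)//=; last exact: leqW.
  by rewrite lerDl sumr_ge0.
have h2 : K * (a n + a (2 * n)%N) <= `|K| * (a n + a (2 * n)%N).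
  by apply: ler_wpM2r; [rewrite addr_ge0|exact: ler_norm].
move: h; rewrite ler_norml => /andP[h _]; rewrite mulrDl mul1r; lra.
Qed.

Lemma norm_sin_addMpi (R : realType) (j : nat) (x : R) :
  `|sin (x + j%:R * pi)| = `|sin x|.
Proof.
elim: j => [|j IH]; first by rewrite mul0r addr0.
by rewrite -natr1 mulrDl mul1r addrA sinDpi normrN.
Qed.

(** Cantor and Lebesgue: two points are enough, because cos 2y = 2 cos^2 y - 1
    gives a_n = 2 a_n cos^2 n - a_n cos 2n. *)
Lemma coeff_cvg0_cos (R : realType) (a : nat -> R) (f : R -> R) :
  (forall x, 0 < x < pi *+ 2 ->
     \sum_(1 <= n < N) a n * cos (n%:R * x) @[N --> \oo] --> f x) ->
  a n @[n --> \oo] --> 0.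
Proof.
move=> H; have p2 := @pi_ge2 R; have T2pi : (pi : R) *+ 2 = 2 * pi by rewrite mulr_natl.
have h1 : 0 < (1 : R) < pi *+ 2 by apply/andP; split=> //; rewrite ?T2pi; lra.
have h2 : 0 < (2 : R) < pi *+ 2 by apply/andP; split=> //; rewrite ?T2pi; lra.
have c1 := cvg_series_term (H 1 h1); have c2 := cvg_series_term (H 2 h2).
apply/cvgr0Pnorm_le => e e0; near=> n.
have k1 : `|a n * cos (n%:R * 1)| <= e / 3.
  near: n; move/cvgr0Pnorm_le : c1; apply; exact: divr_gt0.
have k2 : `|a n * cos (n%:R * 2)| <= e / 3.
  near: n; move/cvgr0Pnorm_le : c2; apply; exact: divr_gt0.
have -> : a n = 2 * cos (n%:R * 1) * (a n * cos (n%:R * 1)) - a n * cos (n%:R * 2).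
  rewrite (_ : n%:R * 2 = (n%:R * 1) *+ 2); last by rewrite -mulr_natr; ring.
  by rewrite cos_mulr2n; ring.
apply: le_trans (ler_normB _ _) _.
have k3 : `|2 * cos (n%:R * 1) * (a n * cos (n%:R * 1))| <= 2 * `|a n * cos (n%:R * 1)|.
  rewrite normrM; apply: ler_wpM2r => //; rewrite normrM ger0_norm//.
  by rewrite -[leRHS]mulr1; apply: ler_wpM2l => //; exact: cos_max.
lra.
Unshelve. all: by end_near. Qed.

(** At pi / 2 the terms with an odd index n have absolute value a_n, and at pi
    / 4 those with index 2 n do; every index lies in a block from an odd n to 2
    n. *)
Lemma coeff_cvg0_sin (R : realType) (a : nat -> R) (f : R -> R) : NBVS a ->
  (forall x, 0 < x < pi *+ 2 ->
     \sum_(1 <= n < N) a n * sin (n%:R * x) @[N --> \oo] --> f x) ->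
  a n @[n --> \oo] --> 0.
Proof.
move=> na H; have [K K1 HK] := NBVS_le na; have a0 := na.1.
have p2 := @pi_ge2 R; have T2pi : (pi : R) *+ 2 = 2 * pi by rewrite mulr_natl.
have h1 : 0 < (pi : R) / 2 < pi *+ 2 by apply/andP; split=> //; rewrite ?T2pi; lra.
have h2 : 0 < (pi : R) / 4 < pi *+ 2 by apply/andP; split=> //; rewrite ?T2pi; lra.
have c1 := cvg_series_term (H _ h1); have c2 := cvg_series_term (H _ h2).
apply/cvgr0Pnorm_le => e e0.
have K0 : 0 < K by lra.
have e1 : 0 < e / (2 * K) by rewrite divr_gt0// mulr_gt0.
have [N1 _ H1] : \forall n \near \oo, `|a n * sin (n%:R * (pi / 2))| <= e / (2 * K).
  by move/cvgr0Pnorm_le : c1; exact.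
have [N2 _ H2] : \forall n \near \oo, `|a n * sin (n%:R * (pi / 4))| <= e / (2 * K).
  by move/cvgr0Pnorm_le : c2; exact.
have sodd n : odd n -> `|sin (n%:R * (pi / 2) : R)| = 1.
  move=> on; rewrite -[n]odd_double_half on /= natrD -mul2n natrM.
  have -> : (1 + 2 * n./2%:R) * (pi / 2) = pi / 2 + n./2%:R * pi :> R by field.
  by rewrite norm_sin_addMpi sin_pihalf normr1.
exists (maxn N1 N2).+2 => // m /= mN.
pose n := if odd m then m else m.-1.
have m2 : (2 <= m)%N by apply: leq_trans mN.
have on : odd n by rewrite /n; case: ifP => // om; rewrite -subn1 oddB ?(ltnW m2)// om.
have n1 : (1 <= n)%N by case: n on.
have nm : (n <= m <= 2 * n)%N by rewrite /n; case: ifP => _; lia.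
have nN1 : (N1 <= n)%N by rewrite /n; case: ifP => _; lia.
have nN2 : (N2 <= 2 * n)%N by rewrite /n; case: ifP => _; lia.
have b1 : a n <= e / (2 * K).
  by have := H1 n nN1; rewrite normrM sodd// mulr1 ger0_norm// a0.
have b2 : a (2 * n)%N <= e / (2 * K).
  have := H2 _ nN2; rewrite natrM (_ : 2 * n%:R * (pi / 4) = n%:R * (pi / 2));
    last by field.
  by rewrite normrM sodd// mulr1 ger0_norm// a0// muln_gt0 n1.
rewrite ger0_norm; last by apply: a0; exact: ltnW.
apply: le_trans (HK n m n1 nm) _.
have -> : e = K * (e / (2 * K) + e / (2 * K)) by field; rewrite gt_eqF.
by rewrite ler_pM2l// lerD.
Qed.

(** Bounds on the sums over the blocks [n, 2n) give bounds on single terms. *)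
Lemma NBVS_block_coeff (R : realType) (a : nat -> R) (n0 : nat) (b C : R) :
  NBVS a -> b <= 0 -> (1 <= n0)%N -> 0 <= C ->
  (forall n, (n0 <= n)%N -> \sum_(n <= k < 2 * n) a k <= C * n%:R `^ b) ->
  exists2 C' : R, 0 <= C' & forall n, (1 <= n)%N -> a n <= C' * n%:R `^ (b - 1).
Proof.
move=> na b0 n01 C0 H; have [K K1 HK] := NBVS_le na; have a0 := na.1.
have big m : (2 * n0 <= m)%N -> a m <= K * (2 * C) * 2 `^ (1 - b) * m%:R `^ (b - 1).
  (* Every k with j <= k < 2 j satisfies k <= m <= 2 k, hence a_m <= K (a_k +
     a_(2k)). These inequalities are added; the sum of the a_(2k) is part of
     a sum over the block from 2 j to 4 j. *)
  move=> mn; pose j := uphalf m.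
  have jm : (m <= 2 * j <= m.+1)%N by rewrite /j; have := uphalfE m; lia.
  have jn : (n0 <= j)%N by lia.
  have j1 : (1 <= j)%N by lia.
  have j0 : (0 : R) < j%:R by rewrite ltr0n.
  have m0 : (0 : R) < m%:R by rewrite ltr0n; lia.
  have sub2 : \sum_(j <= k < 2 * j) a (2 * k)%N <= \sum_(2 * j <= l < 2 * (2 * j)) a l.
    have gen N : (j <= N)%N -> \sum_(j <= k < N) a (2 * k)%N <=
      \sum_(2 * j <= l < 2 * N) a l.
      elim: N => [|N IH]; first by move=> jN; rewrite !big_geq//; lia.
      rewrite leq_eqVlt => /predU1P[<-|jN]; first by rewrite !big_geq.
      rewrite (_ : 2 * N.+1 = (2 * N).+2)%N; last lia.
      rewrite !big_nat_recr//=; try lia.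
      rewrite -addrA; apply: lerD; first by apply: IH.
      by rewrite lerDl a0.
    by apply: gen; lia.
  have s1 := H j jn; have s2 : \sum_(2 * j <= l < 2 * (2 * j)) a l <= C * j%:R `^ b.
    apply: le_trans (H (2 * j)%N _) _; first lia.
    apply: ler_wpM2l => //; rewrite -[b]opprK !(powRN _ (- b)) lef_pV2 ?posrE ?powR_gt0//.
      by apply: ge0_ler_powR; rewrite ?nnegrE ?oppr_ge0// ler_nat; lia.
    by rewrite ltr0n; lia.
  have key : j%:R * a m <= K * (2 * C * j%:R `^ b).
    apply: (@le_trans _ _ (\sum_(j <= k < 2 * j) K * (a k + a (2 * k)%N))).
      have -> : j%:R * a m = \sum_(j <= k < 2 * j) a m.
        by rewrite sumr_const_nat mul2n -addnn addnK mulr_natl.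
      rewrite [leLHS]big_nat_cond [leRHS]big_nat_cond.
      by apply: ler_sum => k /andP[/andP[jk k2] _]; apply: HK; lia.
    rewrite -mulr_sumr ler_pM2l; last by lra.
    rewrite big_split /=; have := le_trans sub2 s2; lra.
  have am : a m <= K * (2 * C) * j%:R `^ (b - 1).
    rewrite -(ler_pM2l j0); apply: le_trans key _.
    rewrite le_eqVlt; apply/orP; left; apply/eqP.
    have -> : j%:R `^ b = j%:R * j%:R `^ (b - 1) :> R.
      by rewrite -{2}[j%:R]powRr1 ?(ltW j0)// -powRD ?(gt_eqF j0) ?implybT//;
        congr (_ `^ _); ring.
    by ring.
  apply: le_trans am _; rewrite -[leRHS]mulrA; apply: ler_wpM2l.
    by rewrite !mulr_ge0//; lra.
  have -> : b - 1 = - (1 - b) by ring.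
  have b1 : 0 <= 1 - b by lra.
  rewrite !powRN -[leLHS]mul1r ler_pdivrMr ?powR_gt0// mulrAC ler_pdivlMr ?powR_gt0// mul1r.
  rewrite -powRM//; apply: ge0_ler_powR; rewrite ?nnegrE//.
  by rewrite -natrM ler_nat; lia.
pose M := (2 * n0)%N.
pose C1 := K * (2 * C) * 2 `^ (1 - b).
have C10 : 0 <= C1 by rewrite !mulr_ge0 ?powR_ge0//; lra.
(* C2 takes care of the finitely many small indices. *)
pose C2 := (\sum_(1 <= k < M) a k) * M%:R `^ (1 - b).
have sa0 : 0 <= \sum_(1 <= k < M) a k.
  by rewrite big_nat_cond; apply: sumr_ge0 => k /andP[/andP[k1 _] _]; exact: a0.
have C20 : 0 <= C2 by rewrite mulr_ge0 ?powR_ge0.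
exists (C1 + C2); first exact: addr_ge0.
move=> m m1; have m0 : (0 : R) < m%:R by rewrite ltr0n.
have [mM|mM] := ltnP m M; last first.
  by apply: le_trans (big m mM) _; rewrite -/C1 mulrDl lerDl mulr_ge0 ?powR_ge0.
have am : a m <= \sum_(1 <= k < M) a k.
  rewrite (bigD1_seq m)//= ?iota_uniq ?mem_index_iota ?m1//.
  rewrite lerDl big_seq_cond; apply: sumr_ge0 => k /andP[].
  by rewrite mem_index_iota => /andP[k1 _] _; exact: a0.
apply: le_trans am _; rewrite mulrDl; apply: ler_wpDl; first by rewrite mulr_ge0 ?powR_ge0.
rewrite /C2 -mulrA -[leLHS]mulr1; apply: ler_wpM2l => //.
have -> : b - 1 = - (1 - b) by ring.
rewrite powRN ler_pdivlMr ?powR_gt0// mul1r; apply: ge0_ler_powR; rewrite ?nnegrE//.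
  by lra.
by rewrite ler_nat ltnW.
Qed.

(** * Decay of the coefficients *)

Lemma in_Lp_integrable (R : realType) (p : R) (f : R -> R) : 1 <= p -> in_Lp p f ->
  (pm R).-integrable [set: R] (EFin \o f).
Proof.
move=> p1 [_ fp]; apply/Lfun1_integrable.
have := @Lfun_subset _ (measurableTypeR R) R (pm R) 1 p%:E.
apply=> //.
exact: fin_num_measure (@measurableT _ _).
Qed.

Lemma Rintegral_dirichlet (R : realType) (g : R -> R) (n : nat) (th : R) :
  (pm R).-integrable [set: R] (EFin \o g) ->
  \int[pm R]_x (g x * dirichlet n th x) =
  \sum_(n <= k < 2 * n) \int[pm R]_x (g x * cos (k%:R * x - th)).
Proof.
move=> ig; rewrite /dirichlet.
have gen N : \int[pm R]_x (g x * \sum_(n <= k < N) cos (k%:R * x - th)) =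
    \sum_(n <= k < N) \int[pm R]_x (g x * cos (k%:R * x - th)).
  elim: N => [|N IH].
    rewrite big_geq//; under eq_Rintegral do rewrite big_geq// mulr0.
    by rewrite Rintegral_cst// mul0r.
  have [nN|nN] := leqP n N; last first.
    rewrite big_geq//; under eq_Rintegral do rewrite big_geq// mulr0.
    by rewrite Rintegral_cst// mul0r.
  rewrite big_nat_recr//= -IH -RintegralD//.
  - by apply: eq_Rintegral => x _; rewrite big_nat_recr//= mulrDr.
  - apply: integrable_period_contM => //; apply: continuous_sum_nat => k.
    exact: continuous_cosMB.
  - by apply: integrable_period_contM => //; exact: continuous_cosMB.
exact: gen.
Qed.

Lemma powR_vanish (R : realType) (b e : R) : b < 0 -> 0 < e ->
  \forall n \near \oo, n%:R `^ b <= e.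
Proof.
move=> b0 e0; exists (Num.truncn (e `^ b^-1)).+1 => // n /= nN.
have n0 : (0 : R) < n%:R by rewrite ltr0n; case: n nN.
have nb : e `^ b^-1 <= n%:R.
  by apply/ltW; apply: lt_le_trans (truncnS_gt _) _; rewrite ler_nat.
have w0 : 0 < e `^ b^-1 by exact: powR_gt0.
have wE : e = (e `^ b^-1) `^ b by rewrite -powRrM mulVf ?lt_eqF// powRr1// ltW.
rewrite [leRHS]wE; move: (e `^ b^-1) w0 nb => w w0 nb.
have -> : b = - (- b) by rewrite opprK.
rewrite !(powRN _ (- b)) lef_pV2 ?posrE ?powR_gt0//.
by apply: ge0_ler_powR => //; rewrite ?nnegrE ?oppr_ge0 ltW.
Qed.

(** The decay of the coefficients under the Zygmund condition. *)
Lemma coeff_bound (R : realType) (p : R) (a : nat -> R) (f : R -> R) (th : R) :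
  1 < p -> in_Lp p f -> NBVS a -> Zygmund_class p f ->
  a n @[n --> \oo] --> 0 ->
  (forall x, 0 < x < pi *+ 2 ->
     \sum_(1 <= n < N) a n * cos (n%:R * x - th) @[N --> \oo] --> f x) ->
  exists2 C : R, 0 <= C & forall n, (1 <= n)%N -> a n <= C * n%:R `^ (p^-1 - 2).
Proof.
move=> p1 fLp na [_ [Cz HZ]] ca cv; have p0 : 0 < p by lra.
have a0 := na.1.
have intf := in_Lp_integrable (ltW p1) fLp.
have [pf] := fLp; rewrite inE => /andP[_]; rewrite inE /= /finite_norm => fB.
pose B := fine (Lp_norm p f).
have B0 : 0 <= B by apply: fine_ge0; exact: Lnorm_ge0.
have HB : (Lp_norm p f <= B%:E)%E.
  by rewrite /B fineK// ge0_fin_numE// Lnorm_ge0.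
have [A aA] : exists A : R, forall n, (1 <= n)%N -> `|a n| <= A.
  have [N _ HN] : \forall n \near \oo, `|a n| <= 1 by move/cvgr0Pnorm_le : ca; exact.
  exists (\sum_(k < N) `|a k| + 1) => n _; have [nN|nN] := ltnP n N; last first.
    by apply: le_trans (HN n nN) _; rewrite lerDr sumr_ge0.
  by rewrite (bigD1 (Ordinal nN))//= -addrA lerDl addr_ge0// sumr_ge0.
pose I := \int[pm R]_x f x; pose c (k : nat) := \int[pm R]_x (f x * cos (k%:R * x - th)).
have ccos (k : nat) : continuous (fun x : R => cos (k%:R * x - th)).
  exact: continuous_cosMB.
have cE k : (1 <= k)%N -> c k = pi * a k + cos th * I.
  move=> k1; rewrite -(fourier_coeff intf aA cv k1) /I -RintegralZl//.
  rewrite -RintegralD//.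
  - by apply: eq_Rintegral => x _; ring.
  - rewrite (_ : EFin \o _ = EFin \o (fun x => f x * (cos (k%:R * x - th) - cos th))).
      apply: integrable_period_contM => // x; apply: cvgB; [exact: ccos|exact: cvg_cst].
    by apply/funext => x /=; rewrite mulrC.
  - rewrite (_ : EFin \o _ = EFin \o (fun x => f x * cos th)).
      by apply: integrable_period_contM => // x; exact: cvg_cst.
    by apply/funext => x /=; rewrite mulrC.
have [C C0 HC] := dirichlet_pairing p1.
have pi0 := @pi_ge2 R.
have b0 : p^-1 - 1 < 0 by rewrite subr_lt0 invf_lt1.
have nsplit (n : nat) : (1 <= n)%N -> n%:R `^ p^-1 = n%:R * n%:R `^ (p^-1 - 1) :> R.
  move=> n1; have n0 : (0 : R) < n%:R by rewrite ltr0n.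
  rewrite -{2}[n%:R]powRr1 ?(ltW n0)// -powRD ?(gt_eqF n0) ?implybT//.
  by congr (_ `^ _); ring.
(* The pairing of f with n consecutive cosines is O(n^(1/p)) = o(n), while
   the constant term contributes n cos th I to it and the a_k contribute
   o(n). *)
have z0 : cos th * I = 0.
  apply/eqP; rewrite -normr_le0; apply/ler_addgt0Pr => e e0; rewrite add0r.
  have e1 : 0 < e / (2 * (C * B + 1)) by rewrite divr_gt0// mulr_gt0// ltr_wpDl// mulr_ge0.
  have e2 : 0 < e / (2 * pi) by rewrite divr_gt0//; lra.
  have := powR_vanish b0 e1; move/cvgr0Pnorm_le : ca => /(_ _ e2) [N1 _ H1] [N2 _ H2].
  pose n := (maxn N1 N2).+1.
  have n0 : (0 : R) < n%:R by rewrite ltr0n.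
  have h1 := HC n th f B isT intf HB; rewrite Rintegral_dirichlet// in h1.
  have h2 : \sum_(n <= k < 2 * n) \int[pm R]_x (f x * cos (k%:R * x - th)) =
      \sum_(n <= k < 2 * n) pi * a k + n%:R * (cos th * I).
    rewrite (eq_big_nat _ _ (F2 := fun k => pi * a k + cos th * I)); last first.
      by move=> k /andP[nk _]; rewrite -cE//; exact: leq_trans nk.
    by rewrite big_split /= sumr_const_nat mul2n -addnn addnK mulr_natl.
  rewrite h2 in h1.
  have h3 : `|\sum_(n <= k < 2 * n) pi * a k| <= n%:R * (e / 2).
    apply: le_trans (ler_norm_sum _ _ _) _.
    apply: (@le_trans _ _ (\sum_(n <= k < 2 * n) (e / 2))).
      rewrite [leLHS]big_nat_cond [leRHS]big_nat_cond;
        apply: ler_sum => k /andP[/andP[nk _] _].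
      have := H1 k (leq_trans (leq_trans (leq_maxl _ _) (leqnSn _)) nk).
      rewrite /= ler_pdivlMr; last by lra.
      rewrite normrM ger0_norm; last by lra.
      by rewrite mulrCA [pi * _]mulrC; lra.
    by rewrite sumr_const_nat mul2n -addnn addnK mulr_natl.
  have h4 : C * B * n%:R `^ p^-1 <= n%:R * (e / 2).
    rewrite nsplit// mulrCA; apply: ler_wpM2l; first exact: ltW.
    have := H2 n (leq_trans (leq_maxr _ _) (leqnSn _)).
    have CB1 : 0 < C * B + 1 by rewrite ltr_wpDl// mulr_ge0.
    rewrite /= ler_pdivlMr; last by rewrite mulr_gt0.
    have := powR_ge0 (n%:R : R) (p^-1 - 1); set u := _ `^ _ => u0 h.
    by rewrite ler_pdivlMr//; lra.
  have : n%:R * `|cos th * I| <= n%:R * e.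
    rewrite -[n%:R in leLHS]ger0_norm ?(ltW n0)// -normrM.
    set X := n%:R * (cos th * I) in h1 *; set S := \sum_(_ <= _ < _) _ in h1 h3.
    have -> : X = (S + X) - S by ring.
    apply: le_trans (ler_normB _ _) _.
    have -> : n%:R * e = n%:R * (e / 2) + n%:R * (e / 2) by field.
    by apply: lerD => //; exact: le_trans h1 h4.
  by rewrite ler_pM2l.
move: HZ => [d /= d0 HZ].
pose n0 := (Num.truncn d^-1).+1.
(* With t = 1/n and n <= k < 2 n, the number k t / 2 lies in [1/2, 1], where
   the sine is at least 1/8. *)
have blk n : (n0 <= n)%N ->
    \sum_(n <= k < 2 * n) a k <= 8 * (C * `|Cz|) * n%:R `^ (p^-1 - 1).
  move=> nn0; have n1 : (1 <= n)%N by apply: leq_trans nn0.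
  have n0' : (0 : R) < n%:R by rewrite ltr0n.
  pose t : R := n%:R^-1; have t0 : 0 < t by rewrite invr_gt0.
  have td : t < d.
    rewrite /t -[d]invrK ltf_pV2 ?posrE ?invr_gt0//.
    by apply: lt_le_trans (truncnS_gt _) _; rewrite ler_nat.
  have t1 : t <= 1 by rewrite invf_le1// ler1n.
  pose g x := f (x + t) + f (x - t) - 2 * f x.
  have gB : (Lp_norm p g <= (`|Cz| * t)%:E)%E.
    apply: (@le_trans _ _ (omega_star p f t)).
      by apply: ereal_sup_ubound; exists t => //=; rewrite t0 lexx.
    apply: le_trans (HZ t _ t0) _; first by rewrite /ball_ /= sub0r normrN gtr0_norm.
    by rewrite lee_fin ler_wpM2r ?ler_norm// ltW.
  have tT : `|t| <= pi *+ 2 by rewrite gtr0_norm// -[pi *+ 2]mulr_natl; lra.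
  have tT' : `|- t| <= pi *+ 2 by rewrite normrN.
  have ig : (pm R).-integrable [set: R] (EFin \o g).
    rewrite (_ : EFin \o g = EFin \o (fun x => (f (x + t) + f (x - t)) + f x * (-2))).
      apply: integrable_pmD; first apply: integrable_pmD;
        try exact: integrable_period_shift.
      by apply: integrable_period_contM => // x; exact: cvg_cst.
    by apply/funext => x /=; rewrite /g; congr EFin; ring.
  have := HC n th g _ n1 ig gB; rewrite Rintegral_dirichlet//.
  rewrite (eq_big_nat _ _ (F2 := fun k => - (4 * sin (k%:R * t / 2) ^+ 2 * (pi * a k)))); last first.
    move=> k /andP[nk _]; rewrite second_diff_coeff// -/(c k) cE ?z0 ?addr0//.
    exact: leq_trans nk.
  rewrite sumrN normrN => h.
  have h5 : \sum_(n <= k < 2 * n) a k / 8 <=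
      `|\sum_(n <= k < 2 * n) 4 * sin (k%:R * t / 2) ^+ 2 * (pi * a k)|.
    apply: le_trans (ler_norm _).
    rewrite [leLHS]big_nat_cond [leRHS]big_nat_cond;
      apply: ler_sum => k /andP[/andP[nk k2] _].
    have ak : 0 <= a k by apply: a0; exact: leq_trans nk.
    have kt1 : 1 <= k%:R * t by rewrite ler_pdivlMr// mul1r ler_nat.
    have kt2 : k%:R * t <= 2 by rewrite ler_pdivrMr// -natrM ler_nat ltnW.
    have sq : 8^-1 <= sin (k%:R * t / 2).
      have := @sin_ge_quarter _ (k%:R * t / 2); have -> : (0 <= k%:R * t / 2 <= pi / 2).
        by apply/andP; split; lra.
      by move=> /(_ isT); lra.
    have sq2 : 64^-1 <= sin (k%:R * t / 2) ^+ 2 by move: sq; set s := sin _; nra.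
    have : 64^-1 * (2 * a k) <= sin (k%:R * t / 2) ^+ 2 * (pi * a k).
      by apply: ler_pM => //; [rewrite mulr_ge0|apply: ler_wpM2r].
    rewrite -[4 * _ * _]mulrA; set s := _ ^+ 2 * _; lra.
  have := le_trans h5 h; rewrite -mulr_suml nsplit// ler_pdivrMr//.
  have -> : C * (`|Cz| * t) * (n%:R * n%:R `^ (p^-1 - 1)) * 8 =
      8 * (C * `|Cz|) * n%:R `^ (p^-1 - 1) by rewrite /t; field; rewrite gt_eqF.
  by [].
have -> : p^-1 - 2 = (p^-1 - 1) - 1 by ring.
apply: (@NBVS_block_coeff _ _ n0 _ (8 * (C * `|Cz|))) => //; first exact: ltW.
by rewrite !mulr_ge0.
Qed.

(** * Sums of the coefficients and increments of the sum-function *)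

Lemma powR_le_npos (R : realType) (b x y : R) : b <= 0 -> 0 < x -> x <= y ->
  y `^ b <= x `^ b.
Proof.
move=> b0 x0 xy; have y0 : 0 < y by exact: lt_le_trans xy.
have -> : b = - (- b) by rewrite opprK.
rewrite !(powRN _ (- b)) lef_pV2 ?posrE ?powR_gt0//.
by apply: ge0_ler_powR => //; rewrite ?nnegrE ?oppr_ge0// ltW.
Qed.

Lemma powR_le_nneg (R : realType) (b x y : R) : 0 <= b -> 0 <= x -> x <= y ->
  x `^ b <= y `^ b.
Proof.
move=> b0 x0 xy; apply: ge0_ler_powR => //; rewrite nnegrE//; exact: le_trans xy.
Qed.

(** Bounds O(M^g) on the sums over the blocks [M, 2M), with g < 0, extend to
    the tails. *)
Lemma dyadic_tail (R : realType) (u : nat -> R) (D g : R) : g < 0 -> 0 <= D ->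
  (forall k, (1 <= k)%N -> 0 <= u k) ->
  (forall M, (1 <= M)%N -> \sum_(M <= k < 2 * M) u k <= D * M%:R `^ g) ->
  exists2 B : R, 0 <= B & forall M N, (1 <= M)%N -> \sum_(M <= k < N) u k <= B * M%:R `^ g.
Proof.
move=> g0 D0 u0 H.
have g1 : 2 `^ g < 1 :> R.
  rewrite -[g]opprK powRN invf_lt1 ?powR_gt0//.
  have : 1 `^ (- g) < 2 `^ (- g) :> R.
    by apply: gt0_ltr_powR; rewrite ?oppr_gt0 ?nnegrE// ltr1n.
  by rewrite powR1.
have g2 : 0 < 1 - 2 `^ g by rewrite subr_gt0.
pose B := D / (1 - 2 `^ g).
have B0 : 0 <= B by rewrite divr_ge0// ltW.
(* B is chosen so that the bound for the tail from M follows from the bound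
   for the block and the bound for the tail from 2 M. *)
have DB : D + B * 2 `^ g = B by rewrite /B; field; rewrite gt_eqF.
exists B => // M N; move: {2}(N - M)%N (leqnn (N - M)%N) => j.
elim: j M => [|j IH] M jN M1.
  have NM : (N <= M)%N by lia.
  by rewrite big_geq// mulr_ge0// powR_ge0.
have Mg0 := powR_ge0 (M%:R : R) g.
have [N2|N2] := leqP N (2 * M)%N.
  apply: (@le_trans _ _ (\sum_(M <= k < 2 * M) u k)).
    have [NM|NM] := leqP N M.
      rewrite big_geq// big_nat_cond; apply: sumr_ge0 => k /andP[/andP[Mk _] _].
      by apply: u0; exact: leq_trans Mk.
    rewrite [leRHS](@big_cat_nat _ _ _ N)//=; last exact: ltnW.
    rewrite lerDl big_nat_cond; apply: sumr_ge0 => k /andP[/andP[Nk _] _].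
    by apply: u0; lia.
  apply: le_trans (H M M1) _; apply: ler_wpM2r => //.
  by rewrite -[leRHS]DB lerDl mulr_ge0// powR_ge0.
rewrite (@big_cat_nat _ _ _ (2 * M))//=; [|lia|exact: ltnW].
have h2 := IH (2 * M)%N; rewrite natrM powRM// in h2.
rewrite -[X in _ <= X * _]DB mulrDl; apply: lerD; first exact: H.
by rewrite -mulrA; apply: h2; lia.
Qed.

(** The same for initial sums, with g > 0. *)
Lemma dyadic_head (R : realType) (u : nat -> R) (D g : R) : 0 < g -> 0 <= D ->
  (forall k, (1 <= k)%N -> 0 <= u k) ->
  (forall M, (1 <= M)%N -> \sum_(M <= k < 2 * M) u k <= D * M%:R `^ g) ->
  exists2 B : R, 0 <= B & forall N, \sum_(1 <= k < N) u k <= B * N%:R `^ g.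
Proof.
move=> g0 D0 u0 H.
have g1 : (3 / 4) `^ g < 1 :> R.
  have : (3 / 4) `^ g < 1 `^ g :> R by apply: gt0_ltr_powR; rewrite ?nnegrE//; lra.
  by rewrite powR1.
have g2 : 0 < 1 - (3 / 4) `^ g :> R by rewrite subr_gt0.
pose B := D / (1 - (3 / 4) `^ g).
have B0 : 0 <= B by rewrite divr_ge0// ltW.
have DB : B * (3 / 4) `^ g + D = B by rewrite /B; field; rewrite gt_eqF.
exists B => // N; move: {2}N (leqnn N) => j.
elim: j N => [|j IH] N jN.
  have NM : (N <= 1)%N by lia.
  by rewrite big_geq// mulr_ge0// powR_ge0.
have [N1|N1] := leqP N 1; first by rewrite big_geq// mulr_ge0// powR_ge0.
(* With M = N / 2 rounded up, one has M <= 3 N / 4 for N >= 2. *)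
pose M := uphalf N; have MN : (N <= 2 * M <= N.+1)%N by rewrite /M; have := uphalfE N; lia.
rewrite (@big_cat_nat _ _ _ M)//=; try lia.
have h1 : \sum_(1 <= k < M) u k <= B * (3 / 4) `^ g * N%:R `^ g.
  apply: le_trans (IH M _) _; first lia.
  rewrite -mulrA; apply: ler_wpM2l => //; rewrite -powRM//.
  apply: powR_le_nneg => //; first exact: ltW.
  rewrite mulrAC ler_pdivlMr// -natrM -[3]/(3%:R) -natrM ler_nat; lia.
have h2 : \sum_(M <= k < N) u k <= D * N%:R `^ g.
  apply: (@le_trans _ _ (\sum_(M <= k < 2 * M) u k)).
    rewrite [leRHS](@big_cat_nat _ _ _ N)//=; try lia.
    rewrite lerDl big_nat_cond; apply: sumr_ge0 => k /andP[/andP[Nk _] _].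
    by apply: u0; lia.
  apply: le_trans (H M _) _; first lia.
  apply: ler_wpM2l => //; apply: powR_le_nneg => //; first exact: ltW.
  by rewrite ler_nat; lia.
by rewrite -[X in _ <= X * _]DB mulrDl; exact: lerD.
Qed.

Lemma is_derive_cos_sum (R : realType) (a : nat -> R) (th : R) (N : nat) (y : R) :
  is_derive y 1 (fun x => \sum_(1 <= k < N) a k * cos (k%:R * x - th))
    (- \sum_(1 <= k < N) k%:R * a k * sin (k%:R * y - th)).
Proof.
case: N => [|N].
  rewrite big_geq// oppr0.
  under eq_fun do rewrite big_geq//.
  exact: is_derive_cst.
elim: N => [|N IH].
  rewrite big_geq// oppr0.
  under eq_fun do rewrite big_geq//.
  exact: is_derive_cst.
have -> : (fun x => \sum_(1 <= k < N.+2) a k * cos (k%:R * x - th)) =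
    (fun x => \sum_(1 <= k < N.+1) a k * cos (k%:R * x - th)) +
    a N.+1 \*: (fun x => cos (N.+1%:R * x - th)).
  by apply/funext => x; rewrite big_nat_recr.
have -> : - \sum_(1 <= k < N.+2) k%:R * a k * sin (k%:R * y - th) =
    - \sum_(1 <= k < N.+1) k%:R * a k * sin (k%:R * y - th) +
    a N.+1 *: (- (N.+1%:R * sin (N.+1%:R * y - th))).
  by rewrite big_nat_recr//= opprD /GRing.scale /=; congr (_ + _); ring.
apply: is_deriveD; apply: is_deriveZ.
have dg : is_derive y 1 (fun x : R => N.+1%:R * x - th) N.+1%:R.
  apply: (@is_derive_quadratic _ _ _ _ 0) => h _.
  by rewrite mul0r (_ : _ - _ = 0) ?normr0//; ring.
rewrite -mulrN mulrC.
exact: is_derive1_comp.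
Qed.

(** The index, just above 1/h, at which the series is cut. *)
Definition cutoff (R : realType) (h : R) : nat := (Num.truncn h^-1).+1.

Lemma cutoff_gt (R : realType) (h : R) : h^-1 < (cutoff h)%:R.
Proof. exact: truncnS_gt. Qed.

Lemma cutoff_le (R : realType) (h : R) : 0 < h -> (cutoff h)%:R <= h^-1 + 1.
Proof.
by move=> h0; rewrite /cutoff -natr1 lerD2r truncn_le invr_ge0 ltW.
Qed.

Lemma cutoff_homo (R : realType) (h r : R) : 0 < h -> h <= r -> (cutoff r <= cutoff h)%N.
Proof.
move=> h0 hr; have r0 : 0 < r by exact: lt_le_trans hr.
rewrite /cutoff ltnS; by apply: le_truncn; rewrite lef_pV2.
Qed.

(** In this section [P] plays the role of 1/p. *)
Section coefficient_sums.
Context (R : realType) (P : R) (a : nat -> R) (C : R).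
Hypotheses (P0 : 0 < P) (P1 : P < 1) (na : NBVS a) (C0 : 0 <= C)
  (aC : forall n, (1 <= n)%N -> a n <= C * n%:R `^ (P - 2)).

Let a0 n : (1 <= n)%N -> 0 <= a n. Proof. exact: na.1. Qed.

Let aCM (k M : nat) : (1 <= M)%N -> (M <= k)%N -> a k <= C * M%:R `^ (P - 2).
Proof.
move=> M1 Mk; apply: le_trans (aC _) _; first exact: leq_trans Mk.
apply: ler_wpM2l => //; apply: powR_le_npos; [have := P1;
  lra|by rewrite ltr0n|by rewrite ler_nat].
Qed.

Let powS (M : nat) (b : R) : (1 <= M)%N -> M%:R * M%:R `^ (b - 1) = M%:R `^ b :> R.
Proof.
move=> M1; have M0 : (0 : R) < M%:R by rewrite ltr0n.
rewrite -{1}[M%:R]powRr1 ?(ltW M0)// -powRD ?(gt_eqF M0) ?implybT//.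
by congr (_ `^ _); ring.
Qed.

Lemma sum_coeff_tail : exists2 B : R, 0 <= B & forall M N, (1 <= M)%N ->
  \sum_(M <= k < N) a k <= B * M%:R `^ (P - 1).
Proof.
apply: (dyadic_tail _ C0 a0); first by have := P1; lra.
move=> M M1; apply: (@le_trans _ _ (\sum_(M <= k < 2 * M) C * M%:R `^ (P - 2))).
  rewrite [leLHS]big_nat_cond [leRHS]big_nat_cond; apply: ler_sum => k /andP[/andP[Mk _] _].
  exact: aCM.
rewrite sumr_const_nat mul2n -addnn addnK -[leLHS]mulr_natl mulrCA.
have -> : P - 2 = P - 1 - 1 by ring.
by rewrite powS.
Qed.

Lemma sum_coeff_head : exists2 B : R, 0 <= B & forall N,
  \sum_(1 <= k < N) k%:R * a k <= B * N%:R `^ P.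
Proof.
apply: (dyadic_head P0 C0); first by move=> k k1; rewrite mulr_ge0// a0.
move=> M M1; apply: (@le_trans _ _ (\sum_(M <= k < 2 * M) C * M%:R `^ (P - 1))).
  rewrite [leLHS]big_nat_cond [leRHS]big_nat_cond; apply: ler_sum => k /andP[/andP[Mk _] _].
  have k1 : (1 <= k)%N by exact: leq_trans Mk.
  apply: (@le_trans _ _ (k%:R * (C * k%:R `^ (P - 2)))).
    by apply: ler_wpM2l => //; exact: aC.
  have -> : P - 2 = P - 1 - 1 by ring.
  rewrite mulrCA powS//; apply: ler_wpM2l => //.
  by apply: powR_le_npos; [have := P1; lra|by rewrite ltr0n|by rewrite ler_nat].
by rewrite sumr_const_nat mul2n -addnn addnK -[leLHS]mulr_natl mulrCA powS.
Qed.

(** On a block this is the defining inequality of NBVS together with the decay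
    of the coefficients. *)
Lemma sum_variation_tail : exists2 B : R, 0 <= B & forall M N, (1 <= M)%N ->
  \sum_(M <= k < N) k%:R * `|a k - a k.+1| <= B * M%:R `^ (P - 1).
Proof.
have [_ [K HK]] := na.
have D0 : 0 <= 4 * `|K| * C by rewrite !mulr_ge0.
apply: (dyadic_tail _ D0) => [||M M1]; first by have := P1; lra.
  by move=> k _; rewrite mulr_ge0.
have M0 : (0 : R) < M%:R by rewrite ltr0n.
apply: (@le_trans _ _ (\sum_(M <= k < (2 * M).+1) (2 * M%:R) * `|a k - a k.+1|)).
  rewrite [leRHS]big_nat_recr ?leq_pmull//=.
  apply: ler_wpDr; first by rewrite mulr_ge0// mulr_ge0// ltW.
  rewrite [leLHS]big_nat_cond [leRHS]big_nat_cond;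
    apply: ler_sum => k /andP[/andP[Mk kM] _].
  by apply: ler_wpM2r => //; rewrite -natrM ler_nat ltnW.
rewrite -mulr_sumr;
  apply: (@le_trans _ _ (2 * M%:R * (`|K| * (2 * (C * M%:R `^ (P - 2)))))).
  apply: ler_wpM2l; first by rewrite mulr_ge0// ltW.
  apply: le_trans (HK M M1) _.
  have h1 : 0 <= a M + a (2 * M)%N by rewrite addr_ge0// a0// muln_gt0 M1.
  apply: (@le_trans _ _ (`|K| * (a M + a (2 * M)%N))).
    by apply: ler_wpM2r => //; exact: ler_norm.
  apply: ler_wpM2l => //.
  have := aCM M1 (leqnn M); have := aCM M1 (leq_pmull M (isT : (0 < 2)%N)); lra.
have -> : P - 2 = P - 1 - 1 by ring.
by rewrite -(@powS M (P - 1) M1) le_eqVlt; apply/orP; left; apply/eqP; ring.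
Qed.

(** The derivative of the head of the series. Below the index 1 / (halfsin x +
    h) the terms are added in absolute value; beyond it summation by parts is
    used. When halfsin x < h the first estimate suffices. *)
Lemma partial_derivative_bound : exists2 B : R, 0 <= B &
  forall th x h : R, 0 < h <= 2^-1 ->
    `|\sum_(1 <= k < cutoff h) k%:R * a k * sin (k%:R * x - th)| <=
    B * (halfsin x + h) `^ (- P).
Proof.
have [B1 B10 H1] := sum_variation_tail.
have [B2 B20 H2] := sum_coeff_tail.
have [D D0 HD] := sum_coeff_head.
pose B3 := C + B1 + B2.
exists (D * 4 `^ P + 2 * B3).
  by rewrite addr_ge0 ?mulr_ge0 ?powR_ge0// !addr_ge0.
move=> th x h /andP[h0 h2]; have s0 := halfsin_ge0 x; have s1 := halfsin_le1 x.
set rho := halfsin x + h; have r0 : 0 < rho by exact: ltr_wpDl.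
have rP0 := powR_ge0 rho (- P).
have low M : (1 <= M)%N -> `|\sum_(1 <= k < M) k%:R * a k * sin (k%:R * x - th)| <= D
  * M%:R `^ P.
  move=> M1; apply: le_trans (HD M); apply: le_trans (ler_norm_sum _ _ _) _.
  rewrite [leLHS]big_nat_cond [leRHS]big_nat_cond; apply: ler_sum => k /andP[/andP[k1 _] _].
  rewrite normrM -[leRHS]mulr1 ger0_norm; last by rewrite mulr_ge0// a0.
  by apply: ler_wpM2l; [rewrite mulr_ge0// a0|exact: sin_max].
have scale (M : nat) (c : R) : (1 <= M)%N -> 0 <= c -> c <= 4 -> M%:R <= c / rho ->
    D * M%:R `^ P <= D * 4 `^ P * rho `^ (- P).
  move=> M1 c0 c4 Mc; rewrite -mulrA; apply: ler_wpM2l => //.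
  rewrite powRN -[_^-1]powR_inv1 ?powR_ge0// powRAC powR_inv1 ?(ltW r0)// -powRM
    ?invr_ge0 ?(ltW r0)//.
  apply: powR_le_nneg => //; first exact: ltW.
  by apply: le_trans Mc _; rewrite ler_pM2r ?invr_gt0.
have rho2 : rho <= 2 by rewrite /rho; lra.
have N1 : (1 <= cutoff h)%N by [].
have [sh|sh] := ltP (halfsin x) h.
  apply: le_trans (low _ N1) _.
  apply: le_trans (@scale _ 4 N1 _ _ _) _ => //.
    apply: le_trans (cutoff_le h0) _; rewrite ler_pdivlMr//.
    have -> : (h^-1 + 1) * rho = rho / h + rho by field; rewrite gt_eqF.
    have : rho / h <= 2 by rewrite ler_pdivrMr// /rho; lra.
    lra.
  by rewrite mulrDl lerDl mulr_ge0// mulr_ge0// !addr_ge0.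
pose M := cutoff rho.
have MN : (M <= cutoff h)%N by apply: cutoff_homo => //; rewrite lerDr.
have M1 : (1 <= M)%N by [].
have M0 : (0 : R) < M%:R by rewrite ltr0n.
rewrite (@big_cat_nat _ _ _ M)//=.
apply: le_trans (ler_normD _ _) _; rewrite mulrDl; apply: lerD.
  apply: le_trans (low _ M1) _.
  apply: le_trans (@scale _ 3 M1 _ _ _) _ => //; first lra.
  apply: le_trans (cutoff_le r0) _; rewrite ler_pdivlMr//.
  have -> : (rho^-1 + 1) * rho = 1 + rho by field; rewrite gt_eqF.
  lra.
have sx0 : 0 < halfsin x by exact: lt_le_trans sh.
have Mg : M%:R `^ (P - 1) <= rho^-1 `^ (P - 1).
  apply: powR_le_npos; [by have := P1; lra|by rewrite invr_gt0|apply/ltW; exact: cutoff_gt].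
have powM : M%:R * M%:R `^ (P - 2) = M%:R `^ (P - 1) :> R.
  rewrite -{1}[M%:R]powRr1 ?(ltW M0)// -powRD ?(gt_eqF M0) ?implybT//.
  by congr (_ `^ _); ring.
have ab := @abel_bound R (fun k => k%:R * a k) (th + pi / 2) x M (cutoff h) MN.
have absum : \sum_(M <= k < cutoff h) k%:R * a k * cos (k%:R * x - (th + pi / 2)) =
    \sum_(M <= k < cutoff h) k%:R * a k * sin (k%:R * x - th).
  by apply: eq_bigr => k _; rewrite opprD addrA cosBpihalf.
rewrite absum in ab.
have V : `|M%:R * a M| + \sum_(M <= k < cutoff h) `|k%:R * a k - k.+1%:R * a k.+1| <=
    B3 * M%:R `^ (P - 1).
  rewrite /B3 -addrA mulrDl; apply: lerD.
    rewrite ger0_norm; last by rewrite mulr_ge0// a0.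
    by rewrite -powM mulrCA; apply: ler_wpM2l => //; exact: aC.
  rewrite mulrDl; apply: le_trans (lerD (H1 M (cutoff h) M1) (H2 M (cutoff h).+1 M1)).
  apply: (@le_trans _ _ (\sum_(M <= k < cutoff h) (k%:R * `|a k - a k.+1| + a k.+1))).
    rewrite [leLHS]big_nat_cond [leRHS]big_nat_cond;
      apply: ler_sum => k /andP[/andP[Mk _] _].
    have -> : k%:R * a k - k.+1%:R * a k.+1 = k%:R * (a k - a k.+1) - a k.+1.
      by rewrite -natr1; ring.
    apply: le_trans (ler_normB _ _) _; rewrite normrM ger0_norm// lerD2l ger0_norm// a0//.
  rewrite big_split /= lerD2l.
  rewrite [leRHS]big_nat_recl//.
  by rewrite lerDr a0.
have h3 : `|\sum_(M <= k < cutoff h) k%:R * a k * sin (k%:R * x - th)| <=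
    B3 * rho^-1 `^ (P - 1) / halfsin x.
  rewrite ler_pdivlMr// mulrC; apply: le_trans ab _; apply: le_trans V _.
  by apply: ler_wpM2l => //; rewrite !addr_ge0.
apply: le_trans h3 _.
have -> : rho `^ (- P) = rho^-1 `^ (P - 1) * rho^-1.
  rewrite -[rho^-1]powR_inv1 ?(ltW r0)// -powRrM -powRD ?(gt_eqF r0) ?implybT//.
  by congr (_ `^ _); ring.
have i2 : (halfsin x)^-1 <= 2 * rho^-1.
  rewrite -[(halfsin x)^-1]mul1r ler_pdivrMr// mulrAC ler_pdivlMr// /rho; lra.
have -> : 2 * B3 * (rho^-1 `^ (P - 1) * rho^-1) = B3 * rho^-1 `^ (P - 1) * (2 * rho^-1)
  by ring.
by apply: ler_wpM2l => //; rewrite mulr_ge0 ?powR_ge0// !addr_ge0.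
Qed.

(** The tail of the series: by absolute values when halfsin x < h, and by
    summation by parts otherwise. *)
Lemma remainder_bound : exists2 B : R, 0 <= B &
  forall (th x h : R) (N : nat), 0 < h <= 2^-1 -> (cutoff h <= N)%N ->
    `|\sum_(cutoff h <= k < N) a k * cos (k%:R * x - th)| <=
    B * (h * (halfsin x + h) `^ (- P)).
Proof.
have [B1 B10 H1] := sum_variation_tail.
have [B2 B20 H2] := sum_coeff_tail.
exists (2 `^ P * B2 + 2 * (C + B1)).
  by rewrite addr_ge0// mulr_ge0 ?powR_ge0// addr_ge0.
move=> th x h N /andP[h0 h2] cN; set M := cutoff h in cN *.
have s0 := halfsin_ge0 x.
set rho := halfsin x + h; have r0 : 0 < rho by exact: ltr_wpDl.
have rP0 := powR_ge0 rho (- P).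
have M1 : (1 <= M)%N by [].
have M0 : (0 : R) < M%:R by rewrite ltr0n.
have hM : h^-1 <= M%:R by apply/ltW; exact: cutoff_gt.
have hi0 : 0 < h^-1 by rewrite invr_gt0.
have [sh|sh] := ltP (halfsin x) h.
  apply: (@le_trans _ _ (\sum_(M <= k < N) a k)).
    apply: le_trans (ler_norm_sum _ _ _) _.
    rewrite [leLHS]big_nat_cond [leRHS]big_nat_cond;
      apply: ler_sum => k /andP[/andP[Mk _] _].
    have ak : 0 <= a k by apply: a0; exact: leq_trans Mk.
    by rewrite normrM ger0_norm// -[leRHS]mulr1; apply: ler_wpM2l => //; exact: cos_max.
  apply: le_trans (H2 M N M1) _.
  apply: (@le_trans _ _ (B2 * h^-1 `^ (P - 1))).
    by apply: ler_wpM2l => //; apply: powR_le_npos => //; have := P1; lra.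
  have -> : h^-1 `^ (P - 1) = h * h^-1 `^ P.
    rewrite -[X in X * _]invrK -[X in X * _]powR_inv1 ?(ltW hi0)// -powRD
      ?(gt_eqF hi0) ?implybT//.
    by congr (_ `^ _); ring.
  rewrite mulrDl; apply: ler_wpDr.
    by rewrite mulr_ge0 ?mulr_ge0// ?addr_ge0// ltW.
  have -> : 2 `^ P * B2 * (h * rho `^ (- P)) = B2 * (h * (2 `^ P * rho `^ (- P))) by ring.
  apply: ler_wpM2l => //; apply: ler_wpM2l; first exact: ltW.
  rewrite powRN -[(rho `^ P)^-1]powR_inv1 ?powR_ge0// powRAC powR_inv1 ?(ltW r0)//.
  rewrite -powRM ?invr_ge0 ?(ltW r0)//; apply: powR_le_nneg; try exact: ltW.
  by rewrite -[h^-1]mul1r ler_pdivrMr// mulrAC ler_pdivlMr// /rho; lra.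
have sx0 : 0 < halfsin x by exact: lt_le_trans sh.
have ab := @abel_bound R a th x M N cN.
have V : `|a M| + \sum_(M <= k < N) `|a k - a k.+1| <= (C + B1) * M%:R `^ (P - 2).
  rewrite mulrDl; apply: lerD; first by rewrite ger0_norm ?a0//; exact: aC.
  have powM : M%:R `^ (P - 1) = M%:R * M%:R `^ (P - 2) :> R.
    rewrite -{2}[M%:R]powRr1 ?(ltW M0)// -powRD ?(gt_eqF M0) ?implybT//.
    by congr (_ `^ _); ring.
  rewrite -(ler_pM2l M0) mulrCA -powM; apply: le_trans (H1 M N M1).
  rewrite mulr_sumr [leLHS]big_nat_cond [leRHS]big_nat_cond.
  apply: ler_sum => k /andP[/andP[Mk _] _]; apply: ler_wpM2r => //.
  by rewrite ler_nat.
have h3 : `|\sum_(M <= k < N) a k * cos (k%:R * x - th)| <=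
    (C + B1) * h^-1 `^ (P - 2) / halfsin x.
  rewrite ler_pdivlMr// mulrC; apply: le_trans ab _; apply: le_trans V _.
  apply: ler_wpM2l; first by rewrite addr_ge0.
  by apply: powR_le_npos => //; have := P1; lra.
apply: le_trans h3 _.
have -> : h^-1 `^ (P - 2) = h * h `^ (1 - P).
  rewrite -[h^-1]powR_inv1 ?(ltW h0)// -powRrM -{2}[h]powRr1 ?(ltW h0)// -powRD
    ?(gt_eqF h0) ?implybT//.
  by congr (_ `^ _); ring.
rewrite [leRHS]mulrDl; apply: ler_wpDl; first by rewrite mulr_ge0 ?mulr_ge0 ?powR_ge0// ltW.
have -> : 2 * (C + B1) * (h * rho `^ (- P)) = (C + B1) * (h * (2 * rho `^ (- P))) by ring.
rewrite -!mulrA; apply: ler_wpM2l; first by rewrite addr_ge0.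
apply: ler_wpM2l; first exact: ltW.
have -> : rho `^ (- P) = rho `^ (1 - P) * rho^-1.
  rewrite -[rho^-1]powR_inv1 ?(ltW r0)// -powRD ?(gt_eqF r0) ?implybT//.
  by congr (_ `^ _); ring.
rewrite mulrCA; apply: ler_pM; rewrite ?powR_ge0 ?invr_ge0//.
  by apply: powR_le_nneg; [have := P1; lra|exact: ltW|rewrite lerDr].
by rewrite -[(halfsin x)^-1]mul1r ler_pdivrMr// mulrAC ler_pdivlMr// /rho; lra.
Qed.

(** The mean value theorem applies to the head, and the tail is bounded at both
    points. Over a distance [h] the weight halfsin x + h changes by a factor of
    2 at most. *)
Lemma increment_bound (f : R -> R) (th : R) :
  exists2 B : R, 0 <= B & forall x t h : R, 0 < h <= 2^-1 -> `|t| <= h ->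
    \sum_(1 <= n < N) a n * cos (n%:R * x - th) @[N --> \oo] --> f x ->
    \sum_(1 <= n < N) a n * cos (n%:R * (x + t) - th) @[N --> \oo] --> f (x + t) ->
    `|f (x + t) - f x| <= B * (h * (halfsin x + h) `^ (- P)).
Proof.
have [B1 B10 H1] := partial_derivative_bound.
have [B2 B20 H2] := remainder_bound.
exists (B1 * 2 `^ P + B2 * 2 `^ P + B2).
  by rewrite !addr_ge0// mulr_ge0// powR_ge0.
move=> x t h hh th_ cx cxt; have /andP[h0 h2] := hh.
have s0 (y : R) := halfsin_ge0 y.
pose S (y : R) := \sum_(1 <= k < cutoff h) a k * cos (k%:R * y - th).
have rem (y : R) : \sum_(1 <= n < N) a n * cos (n%:R * y - th) @[N --> \oo] --> f y ->
    `|f y - S y| <= B2 * (h * (halfsin y + h) `^ (- P)).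
  move=> cy; apply: (@cvgr_to_le _ \oo _ _
      (fun N => `|\sum_(1 <= n < N) a n * cos (n%:R * y - th) - S y|)).
    by apply: cvg_norm; apply: cvgB => //; exact: cvg_cst.
  exists (cutoff h) => // N /= cN.
  rewrite (@big_cat_nat _ _ _ (cutoff h))//= addrAC subrr add0r.
  exact: H2.
have near (y : R) : `|y - x| <= h ->
    (halfsin y + h) `^ (- P) <= 2 `^ P * (halfsin x + h) `^ (- P).
  move=> yx; have l := halfsin_lip x y; rewrite distrC in l.
  have r1 : 0 < halfsin y + h by exact: ltr_wpDl.
  have r2 : 0 < halfsin x + h by exact: ltr_wpDl.
  rewrite !powRN -[leLHS]mul1r ler_pdivrMr ?powR_gt0// mulrAC ler_pdivlMr ?powR_gt0// mul1r.
  rewrite -powRM ?(ltW r1)//; apply: powR_le_nneg; try exact: ltW.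
  by have := s0 y; lra.
have dS (y : R) : is_derive y (1 : R) S
  (- \sum_(1 <= k < cutoff h) k%:R * a k * sin (k%:R * y - th)).
  exact: is_derive_cos_sum.
have h1 : `|S (x + t) - S x| <= B1 * (2 `^ P * (halfsin x + h) `^ (- P)) * h.
  apply: (@le_trans _ _ (B1 * (2 `^ P * (halfsin x + h) `^ (- P)) * `|(x + t) - x|)).
    apply: (le_dist_of_derive dS) => y yx; rewrite normrN.
    apply: le_trans (H1 th y h hh) _; apply: ler_wpM2l => //; apply: near.
    apply: le_trans th_; move: yx => /andP[].
    rewrite ge_min le_max => /orP[y1|y1] /orP[y2|y2]; rewrite ler_norml; apply/andP;
    have := ler_norm t; have := ler_norm (- t); rewrite normrN; split; lra.
  by apply: ler_wpM2l; [rewrite mulr_ge0// mulr_ge0 ?powR_ge0|rewrite addrAC subrr add0r].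
have h3 := rem _ cx; have h4 := rem _ cxt.
have h5 : B2 * (h * (halfsin (x + t) + h) `^ (- P)) <=
    B2 * (h * (2 `^ P * (halfsin x + h) `^ (- P))).
  apply: ler_wpM2l => //; apply: ler_wpM2l; first exact: ltW.
  by apply: near; rewrite addrAC subrr add0r.
have -> : f (x + t) - f x = (S (x + t) - S x) + (f (x + t) - S (x + t)) - (f x - S x)
  by ring.
apply: le_trans (ler_normB _ _) _; rewrite mulrDl; apply: lerD => //.
apply: le_trans (ler_normD _ _) _; rewrite mulrDl; apply: lerD.
  by apply: le_trans h1 _; rewrite le_eqVlt; apply/orP; left; apply/eqP; ring.
apply: le_trans h4 _; apply: le_trans h5 _.
by rewrite le_eqVlt; apply/orP; left; apply/eqP; ring.
Qed.

End coefficient_sums.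

(** * The modulus of continuity *)

(** The points where the series need not converge to [f], and their translates,
    form negligible sets. *)
Lemma negligible_lattice (R : realType) (t : R) :
  (pm R).-negligible [set x | exists k : int, x + t = k%:~R * (pi *+ 2)].
Proof.
pose A : set R := range (fun k : int => k%:~R * (pi *+ 2) - t).
have cA : countable A by apply: sub_countable (card_image_le _ _) _; exact: countableP.
have mA : measurable (A : set (measurableTypeR R)) by exact: countable_measurable.
exists A; split => //.
  apply: (countable_lebesgue_measure0 (A := A `&` @period R)).
  exact: sub_countable (subset_card_le (@subIsetl _ _ _)) cA.
by move=> x /= [k xk]; exists k => //; rewrite -xk addrK.
Qed.

Lemma neq_lattice (R : realType) (x : R) : 0 < x < pi *+ 2 ->
  forall k : int, x != k%:~R * (pi *+ 2).
Proof.
move=> /andP[x0 xT] k; apply/eqP => xk; move: x0 xT; rewrite xk.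
have T0 := twopi_gt0 R.
rewrite pmulr_lgt0// -[X in _ -> _ < X -> _]mul1r ltr_pM2r//.
by rewrite ltr0z -[1]/(1%:~R) ltr_int; lia.
Qed.

(** The hypothesis h <= 1/2 keeps |ln h| away from 0, which absorbs the
    constant ln (2 pi + h). *)
Lemma ln_ratio_le (R : realType) (h : R) : 0 < h <= 2^-1 ->
  8 * (2 * (ln (pi *+ 2 + h) - ln h)) <= 80 * `|ln h|.
Proof.
move=> /andP[h0 h2]; have pi4 : (pi : R) < 4 by have /andP[] := pihalf_02 R; lra.
have pi0 := pi_gt0 R.
have l2 : ln h <= - ln 2 :> R.
  by rewrite -lnV ?posrE// ler_ln ?posrE ?invr_gt0.
have l20 : 0 < ln 2 :> R by rewrite ln_gt0// ltr1n.
(* 2 pi + h <= 16 = 2^4 *)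
have l16 : ln (pi *+ 2 + h) <= 4 * ln 2.
  have -> : 4 * ln 2 = ln (2 ^+ 4) :> R by rewrite lnXn// mulr_natl.
  rewrite ler_ln ?posrE ?exprn_gt0//; last by rewrite -[pi *+ 2]mulr_natl; lra.
  by rewrite -natrX -[pi *+ 2]mulr_natl; lra.
by rewrite ler0_norm; lra.
Qed.

Lemma Lp_norm_le (R : realType) (p B h : R) (g : R -> R) :
  1 < p -> 0 <= B -> 0 < h <= 2^-1 -> measurable_fun [set: R] g ->
  {ae pm R, forall x, `|g x| <= B * (h * (halfsin x + h) `^ (- p^-1))} ->
  (Lp_norm p g <= (B * 80 `^ p^-1 * h * `|ln h| `^ p^-1)%:E)%E.
Proof.
move=> p1 B0 hh mg H; have /andP[h0 h2] := hh.
have p0 : 0 < p by lra.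
have ip0 : 0 <= p^-1 by rewrite invr_ge0 ltW.
have Bh0 : 0 <= B * h by rewrite mulr_ge0// ltW.
have r0 (x : R) : 0 < halfsin x + h by apply: ltr_wpDl => //; exact: halfsin_ge0.
have -> : B * 80 `^ p^-1 * h * `|ln h| `^ p^-1 =
    ((B * h) `^ p * (80 * `|ln h|)) `^ p^-1.
  rewrite powRM ?powR_ge0 ?mulr_ge0// -powRrM mulfV ?gt_eqF// powRr1//.
  by rewrite powRM//; ring.
rewrite /Lp_norm unlock -poweR_EFin; apply: gt0_ler_poweR => //.
- by rewrite in_itv /= leey integral_ge0// => x _; exact: poweR_ge0.
- by rewrite in_itv /= leey lee_fin mulr_ge0 ?powR_ge0// mulr_ge0.
apply: (@le_trans _ _ (\int[pm R]_x ((B * h) `^ p * (halfsin x + h) `^ (- 1))%:E)%E).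
  apply: ae_ge0_le_integral => //.
  - by move=> x _; exact: poweR_ge0.
  - under eq_fun do rewrite abse_EFin poweR_EFin.
    apply/measurable_EFinP; apply: (measurableT_comp (@measurable_powR R p)).
    exact: measurableT_comp.
  - by move=> x _; rewrite lee_fin mulr_ge0// powR_ge0.
  - apply/measurable_EFinP; apply: measurable_funM => //.
    exact: measurable_halfsin_powR.
  - apply: negligibleS H => x; apply: contra_not => Hx _;
    rewrite abse_EFin poweR_EFin lee_fin.
    have -> : (B * h) `^ p * (halfsin x + h) `^ (- 1) =
        (B * (h * (halfsin x + h) `^ (- p^-1))) `^ p.
      rewrite mulrA [RHS]powRM ?powR_ge0// -powRrM mulNr mulVf// gt_eqF//.
    by apply: powR_le_nneg => //; exact: ltW.
under eq_integral do rewrite EFinM.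
rewrite ge0_integralZl//; first last.
- by rewrite lee_fin powR_ge0.
- by move=> x _; rewrite lee_fin powR_ge0.
- by apply/measurable_EFinP; exact: measurable_halfsin_powR.
rewrite EFinM; apply: lee_wpmul2l; first by rewrite lee_fin powR_ge0.
by apply: le_trans (integral_halfsin_inv h0) _; rewrite lee_fin ln_ratio_le.
Qed.

Lemma omega_le (R : realType) (p th : R) (a : nat -> R) (f : R -> R) :
  1 < p -> in_Lp p f -> NBVS a -> Zygmund_class p f -> a @ \oo --> 0 ->
  is_sum_function (fun n x => a n * cos (n%:R * x - th)) f ->
  exists K : R, forall h : R, 0 < h <= 2^-1 ->
    (omega p f h <= (K * h * `|ln h| `^ p^-1)%:E)%E.
Proof.
move=> p1 fp na fZ av cvf; have p0 : 0 < p by lra.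
have cv0 (x : R) : 0 < x < pi *+ 2 ->
    \sum_(1 <= n < N) a n * cos (n%:R * x - th) @[N --> \oo] --> f x.
  by move=> /neq_lattice; exact: cvf.
have [C C0 aC] := coeff_bound p1 fp na fZ av cv0.
have P0 : 0 < p^-1 by rewrite invr_gt0.
have P1 : p^-1 < 1 by rewrite invf_lt1.
have [B B0 HB] := increment_bound P0 P1 na C0 aC f th.
have mf : measurable_fun [set: R] f.
  by apply/measurable_EFinP; apply: measurable_int (in_Lp_integrable (ltW p1) fp).
exists (B * 80 `^ p^-1) => h hh; apply: ge_ereal_sup => _ [t /= th' <-].
apply: Lp_norm_le => //.
  by apply: measurable_funB => //; apply: (measurableT_comp mf); exact: measurable_funD.
(* The estimate may fail only if x or x + t is a point of 2 pi Z. *)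
apply: negligibleS (negligibleU (negligible_lattice (0 : R)) (negligible_lattice t)).
move=> x /= bad; apply: contrapT => /not_orP[n0 nt]; apply: bad.
apply: HB => //; apply: cvf => k; apply/eqP => xk.
- by apply: n0; exists k; rewrite addr0.
- by apply: nt; exists k.
Qed.

Theorem theorem5 (R : realType) (p : R) (a : nat -> R) (f : R -> R)
    (hp : 1 < p) (hf : in_Lp p f) (ha : NBVS a)
    (hsum : is_sum_function (fun n x => a n * cos (n%:R * x)) f \/
            is_sum_function (fun n x => a n * sin (n%:R * x)) f)
    (hZ : Zygmund_class p f) :
  exists K : R, forall h : R, 0 < h <= 2^-1 ->
    (omega p f h <= (K * h * `|ln h| `^ p^-1)%:E)%E.
Proof.
case: hsum => cvf.
- have av : a @ \oo --> 0 by apply: (@coeff_cvg0_cos _ a f) => x /neq_lattice; exact: cvf.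
  apply: (@omega_le _ _ 0 _ _ hp hf ha hZ av) => x xk.
  by under eq_cvg do under eq_bigr do rewrite subr0; exact: cvf.
- have av : a @ \oo --> 0.
    by apply: (@coeff_cvg0_sin _ a f) => // x /neq_lattice; exact: cvf.
  apply: (@omega_le _ _ (pi / 2) _ _ hp hf ha hZ av) => x xk.
  by under eq_cvg do under eq_bigr do rewrite cosBpihalf; exact: cvf.
Qed.
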